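(* Let $n\in\mathbb N$ and let $\Phi=\{\varphi_m\}_{m=1}^\infty$ be a family of nondecreasing continuous functions $\varphi_m:[0,\infty)\to\mathbb R$ such that for each $m\in\mathbb N$: ($i_1$) $\lim_{x\to+\infty}\varphi_m(x)/x=+\infty$; ($i_2$) for each $A>0$ there is a constant $C(m,A)>0$ with $\varphi_m(x)+A\ln(1+x)\le\varphi_{m+1}(x)+C(m,A)$ for all $x\ge0$; ($i_3$) there is a constant $a_m>0$ such that $\varphi_m(2x)\le\varphi_{m+1}(x)+a_m$ for all $x\ge 0$; ($i_5$) there exist numbers $h_m>1$ and $l_m>0$ such that $2\varphi_m(x)\le\varphi_{m+1}(h_m x)+l_m$ for all $x\ge 0$. Then the Fourier transformation $\mathcal F: f\in E(\Phi)\mapsto\hat f$, where $$\hat f(x)=\int_{\mathbb R^n}f(\xi)e^{-i\langle x,\xi\rangle}\,d\xi,\quad x\in\mathbb R^n,$$ establishes an isomorphism (of topological vector spaces) between $E(\Phi)$ and $G(\Psi^* )$.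
   Context: $\|\cdot\|$ is the Euclidean norm on $\mathbb R^n$ or $\mathbb C^n$; $\langle u,v\rangle=u_1v_1+\dots+u_nv_n$; $H(\mathbb C^n)$ is the space of entire functions on $\mathbb C^n$. For $\alpha\in\mathbb Z_+^n$, $|\alpha|=\alpha_1+\dots+\alpha_n$, $x^\alpha=x_1^{\alpha_1}\cdots x_n^{\alpha_n}$, $D^\alpha=\partial^{|\alpha|}/\partial x_1^{\alpha_1}\cdots\partial x_n^{\alpha_n}$. Functions on $\mathbb R^n$ are complex-valued. For $\nu\in\mathbb N$, $k\in\mathbb Z_+$ let $$E_k(\varphi_\nu)=\Big\{f\in H(\mathbb C^n):\ p_{\nu,k}(f)=\sup_{z\in\mathbb C^n}\frac{|f(z)|(1+\|z\|)^k}{e^{\varphi_\nu(\|\operatorname{Im}z\|)}}<\infty\Big\},$$ a Banach space with norm $p_{\nu,k}$. $E(\varphi_\nu)=\bigcap_{k=0}^\infty E_k(\varphi_\nu)$ has the projective limit topology (defined by the norms $p_{\nu,k}$, $k\in\mathbb Z_+$), and $E(\Phi)=\bigcup_{\nu=1}^\infty E(\varphi_\nu)$ has the (locally convex) inductive limit topology of the increasing sequence of continuously embedded spaces $E(\varphi_\nu)$. For a continuous $g:[0,\infty)\to\mathbb R$ with $g(x)/x\to+\infty$ as $x\to+\infty$, the Young conjugate is $g^*(x)=\sup_{y\ge0}(xy-g(y))$, $x\ge0$. Put $\psi_\nu(x)=\varphi_\nu(e^x)$ for $x\ge0$, and $\Psi^*=\{\psi_\nu^*\}_{\nu=1}^\infty$.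 For $\nu\in\mathbb N$, $m\in\mathbb Z_+$ let $$G_m(\psi_\nu^* )=\Big\{f\in C^m(\mathbb R^n):\ \|f\|_{m,\psi_\nu^*}=\sup_{x\in\mathbb R^n,\ |\alpha|\le m,\ \beta\in\mathbb Z_+^n}\frac{|x^\beta(D^\alpha f)(x)|}{|\beta|!\,e^{-\psi_\nu^*(|\beta|)}}<\infty\Big\}.$$ $G(\psi_\nu^* )=\bigcap_{m=0}^\infty G_m(\psi_\nu^* )$ has the topology defined by the norms $\|\cdot\|_{m,\psi_\nu^*}$, $m\in\mathbb Z_+$, and $G(\Psi^* )=\bigcup_{\nu=1}^\infty G(\psi_\nu^* )$ has the (locally convex) inductive limit topology of the spaces $G(\psi_\nu^* )$. *)

(* Defs.v *)
From HB Require Import structures.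
From mathcomp Require Import all_boot all_order all_algebra complex.
From mathcomp Require Import all_classical all_reals all_analysis.
Set Implicit Arguments. Unset Strict Implicit. Unset Printing Implicit Defensive.
Import Order.TTheory GRing.Theory Num.Theory.
Import numFieldNormedType.Exports.
Local Open Scope classical_set_scope.
Local Open Scope ring_scope.

(* R[i] seen through its numClosedFieldType structure, which is what the norm,
   topology and normed-module structures of a numeric field are attached to. *)
Definition Cx (R : realType) : numClosedFieldType := R[i]%C.

Section complex_parts.
Context (R : realType).
Definition ReC (z : Cx R) : R := complex.Re z.
Definition ImC (z : Cx R) : R := complex.Im z.
Definition modC (z : Cx R) : R := Num.sqrt (ReC z ^+ 2 + ImC z ^+ 2).
Definition mkC (a b : R) : Cx R := (a +i* b)%C.

Lemma modCE (z : Cx R) : (modC z)%:C%C = `|z|.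
Proof. by rewrite /modC /ReC /ImC normc_def. Qed.

Lemma modC_ge0 z : 0 <= modC z. Proof. exact: sqrtr_ge0. Qed.

Lemma modCM a b : modC (a * b) = modC a * modC b.
Proof.
apply: (fmorph_inj (real_complex R)); rewrite rmorphM /=.
by rewrite [LHS]modCE normrM -!modCE.
Qed.

Lemma modCD a b : modC (a + b) <= modC a + modC b.
Proof. by rewrite -lecR rmorphD/= !modCE ler_normD. Qed.
End complex_parts.

(* An increasing sequence of subspaces of V, each carrying a countable family of
   seminorms, with continuous embeddings.  The values snorm nu k v are only
   meaningful for v in step nu. *)
Record lc_spectrum (R : realType) (V : lmodType (Cx R)) := LCSpectrum {
  step : nat -> set V;
  snorm : nat -> nat -> V -> \bar R;
  step0 : forall nu, step nu 0;
  stepP : forall nu a u v, step nu u -> step nu v -> step nu (a *: u + v);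
  step_incr : forall nu, step nu `<=` step nu.+1;
  snorm_fin : forall nu k v, step nu v -> snorm nu k v \is a fin_num;
  snormZ : forall nu k a v, step nu v ->
    snorm nu k (a *: v) = ((modC a)%:E * snorm nu k v)%E;
  snormD : forall nu k u v, step nu u -> step nu v ->
    (snorm nu k (u + v) <= snorm nu k u + snorm nu k v)%E;
  step_cts : forall nu k, exists l (c : R), forall v, step nu v ->
    (snorm nu.+1 k v <= c%:E * snorm nu l v)%E
}.

Section inductive_limit.
Context (R : realType) (V : lmodType (Cx R)) (S : lc_spectrum V).

Definition indlim_mem : {pred V} := [pred v | `[< exists nu, step S nu v >]].

Lemma step_le mu nu : (mu <= nu)%N -> step S mu `<=` step S nu.
Proof.
move=> /subnK <-; elim: (nu - mu)%N => [//|k IH] v /IH.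
exact: step_incr.
Qed.

Lemma indlim_submod : submod_closed indlim_mem.
Proof.
split=> [|a u v]; first by apply/asboolP; exists 0%N; exact: step0.
move=> /asboolP[mu hu] /asboolP[nu hv]; apply/asboolP.
exists (maxn mu nu); apply: stepP.
  exact: step_le (leq_maxl _ _) _ hu.
exact: step_le (leq_maxr _ _) _ hv.
Qed.

HB.instance Definition _ :=
  GRing.isSubmodClosed.Build (Cx R) V indlim_mem indlim_submod.

(* The union of the steps; it is given below the locally convex inductive limit
   topology: a base of neighbourhoods of 0 consists of all absolutely convex sets
   whose trace on every step is a neighbourhood of 0 in that step. *)
Definition indlim := {v : V | v \in indlim_mem}.
HB.instance Definition _ := SubChoice.on indlim.
HB.instance Definition _ := [SubChoice_isSubLmodule of indlim by <:].

Implicit Types (U A : set indlim) (x y : indlim).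

Definition abs_convex U :=
  forall (a b : Cx R) x y, `|a| + `|b| <= 1 -> U x -> U y -> U (a *: x + b *: y).

(* The trace of U on step nu is a neighbourhood of 0 for the topology defined by
   the seminorms snorm nu k, k : nat. *)
Definition step_nbhs0 (nu : nat) U := exists (m : nat) (e : R), 0 < e /\
  forall x, step S nu (val x) ->
    (forall k, (k <= m)%N -> (snorm S nu k (val x) < e%:E)%E) -> U x.

Definition indlim_base0 U := abs_convex U /\ forall nu, step_nbhs0 nu U.

Definition indlim_nbhs x : set_system indlim := [set A |
  exists2 U, indlim_base0 U & forall u, U u -> A (x + u)].

Lemma base0_0 U : indlim_base0 U -> U 0.
Proof.
case=> _ /(_ 0%N) [m [e [e0]]]; apply; rewrite raddf0; first exact: step0.
move=> k _; rewrite -(scale0r 0) snormZ; last exact: step0.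
rewrite (_ : modC 0 = 0) ?mul0e ?lte_fin//.
by rewrite /modC /ReC /ImC /= expr0n addr0 sqrtr0.
Qed.

Lemma base0T : indlim_base0 setT.
Proof. by split=> // nu; exists 0%N, 1. Qed.

Lemma base0I U1 U2 :
  indlim_base0 U1 -> indlim_base0 U2 -> indlim_base0 (U1 `&` U2).
Proof.
move=> [c1 n1] [c2 n2]; split.
  by move=> a b x y ab [? ?] [? ?]; split; [exact: c1|exact: c2].
move=> nu; have [m1 [e1 [e10 h1]]] := n1 nu; have [m2 [e2 [e20 h2]]] := n2 nu.
exists (maxn m1 m2), (Num.min e1 e2); split; first by rewrite lt_min e10.
move=> x sx hx; split.
- apply: h1 => // k km; have := hx k (leq_trans km (leq_maxl _ _)).
  by move=> /lt_le_trans; apply; rewrite lee_fin ge_min lexx.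
- apply: h2 => // k km; have := hx k (leq_trans km (leq_maxr _ _)).
  by move=> /lt_le_trans; apply; rewrite lee_fin ge_min lexx orbT.
Qed.

Lemma modC_gt0 (a : Cx R) : a != 0 -> 0 < modC a.
Proof. by move=> a0; rewrite -ltcR modCE normr_gt0. Qed.

Lemma base0Z U (c : Cx R) : c != 0 -> indlim_base0 U ->
  indlim_base0 [set x | U (c *: x)].
Proof.
move=> c0 [cU nU]; split.
  move=> a b x y ab Ux Uy /=.
  rewrite scalerDr !scalerA ![c * _]mulrC -!scalerA; exact: cU.
move=> nu; have [m [e [e0 h]]] := nU nu.
exists m, (e / modC c); split; first by rewrite divr_gt0// modC_gt0.
move=> x sx hx /=; apply: h.
  by rewrite linearZ/= -[_ *: _]addr0; apply: stepP => //; exact: step0.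
move=> k km; rewrite linearZ/= snormZ//.
have := hx k km; have := snorm_fin k sx.
case: (snorm _ _ _ _) => // r _; rewrite -EFinM !lte_fin.
by rewrite ltr_pdivlMr ?modC_gt0// mulrC.
Qed.

Lemma base0_absorb U x : indlim_base0 U ->
  exists2 d : Cx R, 0 < d & forall c, `|c| < d -> U (c *: x).
Proof.
case=> _ nU; have /asboolP[nu sx] := valP x.
have [m [e [e0 h]]] := nU nu.
pose M := \sum_(k < m.+1) `|fine (snorm S nu k (val x))|.
have M0 : 0 <= M by apply: sumr_ge0.
have eM : 0 < e / (M + 1) by rewrite divr_gt0// ltr_wpDl.
exists (e / (M + 1))%:C%C; first by rewrite ltcR.
move=> c; rewrite -modCE ltcR => hc; apply: h.
  by rewrite linearZ/= -[_ *: _]addr0; apply: stepP => //; exact: step0.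
move=> k km; rewrite linearZ/= snormZ// -(fineK (snorm_fin k sx)) -EFinM lte_fin.
apply: (@le_lt_trans _ _ (modC c * M)).
  apply: ler_wpM2l; first exact: modC_ge0.
  rewrite (le_trans (ler_norm _))// /M (bigD1 (Ordinal (km : (k < m.+1)%N)))//=.
  by rewrite lerDl sumr_ge0.
apply: (@le_lt_trans _ _ (modC c * (M + 1))).
  by rewrite ler_wpM2l ?modC_ge0// lerDl.
by rewrite -ltr_pdivlMr// ltr_wpDl.
Qed.

Lemma base0_half U x y : indlim_base0 U ->
  U (2 *: x) -> U (2 *: y) -> U (x + y).
Proof.
move=> [cU _] Ux Uy.
have two0 : (2 : Cx R) != 0 by rewrite pnatr_eq0.
have H : `|2^-1 : Cx R| + `|2^-1 : Cx R| <= 1.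
  rewrite ger0_norm ?invr_ge0// [leLHS](_ : _ = 1)//.
  by apply: (mulIf two0); rewrite mulrDl mulVf// mul1r.
have := cU _ _ _ _ H Ux Uy.
by rewrite !scalerA (mulVf two0) !scale1r.
Qed.

HB.instance Definition _ := hasNbhs.Build indlim indlim_nbhs.

Lemma indlim_nbhs_filter x : ProperFilter (nbhs x).
Proof.
split.
  by move=> [U bU /(_ 0 (base0_0 bU))].
split.
- by exists setT; [exact: base0T|].
- move=> A B [U bU UA] [W bW WB]; exists (U `&` W); first exact: base0I.
  by move=> u [/UA ? /WB].
- by move=> A B AB [U bU UA]; exists U => // u /UA /AB.
Qed.

Lemma indlim_nbhs_singleton x A : nbhs x A -> A x.
Proof. by move=> [U bU /(_ 0 (base0_0 bU))]; rewrite addr0. Qed.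


Lemma base0_2 U : indlim_base0 U -> indlim_base0 [set x | U (2%:R *: x)].
Proof. by apply: base0Z; rewrite pnatr_eq0. Qed.

Lemma indlim_nbhs_nbhs x A : nbhs x A -> nbhs x (nbhs^~ A).
Proof.
move=> [U bU UA]; exists [set x | U (2%:R *: x)]; first exact: base0_2.
move=> u Uu; exists [set x | U (2%:R *: x)]; first exact: base0_2.
by move=> w Uw; rewrite -addrA; apply: UA; exact: base0_half.
Qed.

HB.instance Definition _ := Nbhs_isNbhsTopological.Build indlim
  indlim_nbhs_filter indlim_nbhs_singleton indlim_nbhs_nbhs.

Lemma indlim_add_continuous : continuous (fun x : indlim * indlim => x.1 + x.2).
Proof.
move=> [x y] A [U bU UA].
pose W := [set x | U (2%:R *: x)].
exists ([set z | W (z - x)], [set z | W (z - y)]).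
  by split; exists W; rewrite ?/W/=; (try exact: base0_2) => u; rewrite addrC addKr.
move=> [a b] [/= Wa Wb] /=; rewrite (_ : a + b = x + y + ((a - x) + (b - y))).
  by apply: UA; exact: base0_half.
by rewrite addrACA !(addrC _ (_ - _)) !subrK.
Qed.

Lemma indlim_scale_continuous :
  continuous (fun z : (Cx R)^o * indlim => z.1 *: z.2).
Proof.
move=> [r x] A [U bU UA].
have b2 := base0_2 bU; have [d d0 hd] := base0_absorb x b2.
pose M : Cx R := `|r| + d.
have M0 : 0 < M by rewrite ltr_wpDl.
exists ([set l | `|l - r| < d], [set z | U (2%:R *: (M *: (z - x)))]).
  split=> /=.
    by apply/nbhs_ballP; exists d => //= l; rewrite -ball_normE/= distrC.
  exists [set z | U (2%:R *: (M *: z))]; last first.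
    by move=> u; rewrite /= [y in y - _]addrC addrK.
  exact: base0Z (lt0r_neq0 M0) b2.
move=> [l y] [/= hl hy] /=.
rewrite (_ : l *: y = r *: x + ((l - r) *: x + l *: (y - x))).
  apply: UA; apply: base0_half => //; first exact: hd.
  have [cU _] := bU; have lM : `|l / M| + `|0 : Cx R| <= 1.
    rewrite normr0 addr0 normf_div (gtr0_norm M0) ler_pdivrMr// mul1r /M.
    rewrite -[l](subrK r) addrC (le_trans (ler_normD _ _))// lerD2l.
    exact: ltW.
  have := cU _ _ _ _ lM hy hy.
  rewrite scale0r addr0 !scalerA; congr (U (_ *: _)).
  by rewrite mulrCA divfK// lt0r_neq0.
by rewrite addrA -scalerDl [r + _]addrC subrK scalerBr addrC subrK.
Qed.

Lemma indlim_locally_convex : exists2 B : set_system indlim,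
  (forall b, b \in B -> convex_set b) & basis B.
Proof.
exists [set b | open b /\ convex_set b]; first by move=> b /set_mem[].
split; first by move=> b [].
move=> x A [U bU UA].
exists [set y | nbhs y [set x + u | u in U]]; last first.
  move=> y /indlim_nbhs_singleton [u Uu <-]; exact: UA.
have base_mem : nbhs x [set x + u | u in U] by exists U => // u Uu; exists u.
split=> //; split.
  by rewrite openE => y; exact: indlim_nbhs_nbhs.
apply/convex_setW => y z /set_mem[V1 bV1 yV] /set_mem[V2 bV2 zV] k k0 k1.
apply/mem_set; exists (V1 `&` V2); first exact: base0I.
move=> w [w1 w2]; have [u1 U1 e1] := yV _ w1; have [u2 U2 e2] := zV _ w2.
have [cU _] := bU.
exists (k%:num *: u1 + (1 - k%:num) *: u2).
  apply: cU => //; rewrite ger0_norm ?(ltW k0)// ger0_norm ?subr_ge0 ?(ltW k1)//.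
  by rewrite addrC subrK.
have -> : conv k y z = (k%:num *: (y : indlim) + (1 - k%:num) *: (z : indlim)).
  by [].
have -> : u1 = y + (w - x) by rewrite addrA -e1 addrC addKr.
have -> : u2 = z + (w - x) by rewrite addrA -e2 addrC addKr.
have xd : w = (w - x) + x by rewrite subrK.
rewrite [in RHS]xd; move: (w - x) => e.
rewrite !scalerDr addrACA -scalerDl [k%:num + _]addrC subrK scale1r.
by rewrite [LHS]addrC [RHS]addrA.
Qed.

HB.instance Definition _ := PreTopologicalLmod_isTvs.Build (Cx R) indlim
  indlim_add_continuous indlim_scale_continuous indlim_locally_convex.
HB.instance Definition _ :=
  PreTopologicalNmodule_isTopologicalNmodule.Build indlim indlim_add_continuous.
HB.instance Definition _ :=
  TopologicalNmodule_isTopologicalLmodule.Build (Cx R) indlim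
    indlim_scale_continuous.
HB.instance Definition _ :=
  Uniform_isTvs.Build (Cx R) indlim indlim_locally_convex.
End inductive_limit.

Section weighted_sup.
Context (R : realType) (I : Type) (D : set I).
Implicit Types F G : I -> R.

Definition wsup F : \bar R := ereal_sup [set (F i)%:E | i in D].

Lemma wsup_fin F : D !=set0 -> (wsup F < +oo)%E -> wsup F \is a fin_num.
Proof.
move=> [i Di] F_lty; rewrite fin_numElt F_lty andbT.
apply: (@lt_le_trans _ _ (F i)%:E); first exact: ltNyr.
by apply: ereal_sup_ubound; exists i.
Qed.

Lemma wsup_le (c : R) F G : 0 <= c -> (forall i, D i -> F i <= c * G i) ->
  (wsup F <= c%:E * wsup G)%E.
Proof.
move=> c0 FG; apply: ge_ereal_sup => _ [i Di <-].
apply: (@le_trans _ _ (c%:E * (G i)%:E)%E); first by rewrite -EFinM lee_fin FG.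
by apply: lee_wpmul2l; [rewrite lee_fin|apply: ereal_sup_ubound; exists i].
Qed.

Lemma wsupZ (c : R) F G : D !=set0 -> 0 <= c ->
  (forall i, D i -> F i = c * G i) -> wsup F = (c%:E * wsup G)%E.
Proof.
move=> [i Di] c0 FG; have [c_eq|cN0] := eqVneq c 0.
  rewrite c_eq mul0e /wsup (_ : [set _ | _ in _] = [set 0%E]) ?ereal_sup1//.
  apply/seteqP; split=> [_ [j Dj <-]|_ ->] /=; first by rewrite FG// c_eq mul0r.
  by exists i; rewrite // FG// c_eq mul0r.
have c_gt0 : 0 < c by rewrite lt_neqAle eq_sym cN0.
apply/eqP; rewrite eq_le wsup_le//=; last by move=> j /FG ->.
have : (wsup G <= c^-1%:E * wsup F)%E.
  by apply: wsup_le => [|j Dj]; rewrite ?invr_ge0// FG// mulKf.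
move=> /(@lee_wpmul2l _ c%:E); rewrite lee_fin => /(_ c0) /le_trans; apply.
by rewrite muleA -EFinM divff// mul1e.
Qed.

Lemma wsupD F G H : (forall i, D i -> F i <= G i + H i) ->
  (wsup F <= wsup G + wsup H)%E.
Proof.
move=> FGH; apply: ge_ereal_sup => _ [i Di <-].
apply: (@le_trans _ _ ((G i)%:E + (H i)%:E)%E).
  by rewrite -EFinD lee_fin FGH.
by apply: leeD; apply: ereal_sup_ubound; exists i.
Qed.
End weighted_sup.

Section smooth.
Context (R : realType) (n : nat).
Implicit Types g h : 'rV[R]_n -> R.

Definition partial (i : 'I_n) g : 'rV[R]_n -> R := fun x => 'D_(delta_mx 0 i) g x.

(* All iterated partial derivatives of order <= m, taken in any order, exist and
   are continuous. *)
Fixpoint Ck (m : nat) g : Prop :=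
  if m is m'.+1 then
    continuous g /\
    forall i, (forall x, derivable g x (delta_mx 0 i)) /\ Ck m' (partial i g)
  else continuous g.

(* d_1^(a_1) ... d_n^(a_n) g *)
Definition mderiv (a : 'I_n -> nat) g : 'rV[R]_n -> R :=
  foldr (fun i => iter (a i) (partial i)) g (enum 'I_n).

Definition CkC (m : nat) (f : 'rV[R]_n -> Cx R) : Prop :=
  Ck m (@ReC R \o f) /\ Ck m (@ImC R \o f).

Definition mderivC (a : 'I_n -> nat) (f : 'rV[R]_n -> Cx R) (x : 'rV[R]_n) :=
  mkC (mderiv a (@ReC R \o f) x) (mderiv a (@ImC R \o f) x).

Definition msize (a : 'I_n -> nat) : nat := \sum_i a i.

Lemma Ck_continuous m g : Ck m g -> continuous g.
Proof. by case: m => [//|m []]. Qed.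

Lemma partial_lin (c : R) i g h :
  (forall x, derivable g x (delta_mx 0 i)) ->
  (forall x, derivable h x (delta_mx 0 i)) ->
  partial i (fun x => c * g x + h x) = (fun x => c * partial i g x + partial i h x).
Proof.
move=> dg dh; apply/funext => x; rewrite /partial.
rewrite (_ : (fun _ => _) = (c \*: g : 'rV[R]_n -> R) + h)//.
rewrite deriveD//; last exact: derivableZ.
by rewrite deriveZ.
Qed.

Lemma Ck_lin (c : R) m g h : Ck m g -> Ck m h -> Ck m (fun x => c * g x + h x).
Proof.
have cont g' h' : continuous g' -> continuous h' ->
    continuous (fun x : 'rV[R]_n => c * g' x + h' x).
  move=> cg ch x; have Fx : Filter (nbhs x) by exact: nbhs_filter.
  by apply: (cvgD (F := nbhs x)); [apply: (cvgMl_tmp (F := nbhs x)); exact: cg|exact: ch].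
elim: m g h => [|m IH] g h; first exact: cont.
move=> /= [cg dg] [ch dh]; split; first exact: cont.
move=> i; have [gi gi'] := dg i; have [hi hi'] := dh i; split.
  move=> x; rewrite (_ : (fun _ => _) = (c \*: g : 'rV[R]_n -> R) + h)//.
  by apply: derivableD => //; exact: derivableZ.
rewrite partial_lin; [exact: IH|exact: gi|exact: hi].
Qed.

Lemma iter_partial_lin (c : R) i k m g h : Ck (k + m) g -> Ck (k + m) h ->
  [/\ Ck m (iter k (partial i) g), Ck m (iter k (partial i) h) &
   iter k (partial i) (fun x => c * g x + h x) =
   fun x => c * iter k (partial i) g x + iter k (partial i) h x].
Proof.
elim: k m => [|k IH] m; first by [].
rewrite addSnnS => Cg Ch; have [[_ dg] [_ dh] e] := IH _ Cg Ch.
have [gi gi'] := dg i; have [hi hi'] := dh i.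
by split=> //=; rewrite e partial_lin.
Qed.

Lemma mderiv_lin (c : R) a g h : Ck (msize a) g -> Ck (msize a) h ->
  mderiv a (fun x => c * g x + h x) = fun x => c * mderiv a g x + mderiv a h x.
Proof.
rewrite /mderiv /msize -big_enum/=; set s := enum _.
suff H m : Ck (\sum_(i <- s) a i + m) g -> Ck (\sum_(i <- s) a i + m) h ->
  let F := foldr (fun i => iter (a i) (partial i)) in
  [/\ Ck m (F g s), Ck m (F h s) &
    F (fun x => c * g x + h x) s = fun x => c * F g s x + F h s x].
  by move=> Cg Ch; have [] := H 0%N; rewrite ?addn0.
elim: s m => [|i s IH] m; first by rewrite big_nil.
rewrite big_cons -addnA addnCA => Cg Ch /=.
have [C1 C2 ->] := IH _ Cg Ch.
exact: iter_partial_lin.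
Qed.

Lemma Ck_le m m' g : (m <= m')%N -> Ck m' g -> Ck m g.
Proof.
elim: m m' g => [|m IH] [|m'] g //=; first by move=> _ [].
move=> mm' [cg dg]; split=> // i; have [di Ci] := dg i; split=> //.
exact: IH Ci.
Qed.

Lemma ReC_lin (c : Cx R) (f g : 'rV[R]_n -> Cx R) : @ReC R \o (c *: f + g) =
  fun x => ReC c * (@ReC R \o f) x + (- ImC c * (@ImC R \o f) x + (@ReC R \o g) x).
Proof.
apply/funext => x; rewrite /comp -[LHS]/(ReC (c * f x + g x)).
rewrite /ReC /ImC; case: (c) (f x) (g x) => [c1 c2] [f1 f2] [g1 g2] /=.
by rewrite mulNr addrA.
Qed.

Lemma ImC_lin (c : Cx R) (f g : 'rV[R]_n -> Cx R) : @ImC R \o (c *: f + g) =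
  fun x => ReC c * (@ImC R \o f) x + (ImC c * (@ReC R \o f) x + (@ImC R \o g) x).
Proof.
apply/funext => x; rewrite /comp -[LHS]/(ImC (c * f x + g x)).
rewrite /ReC /ImC; case: (c) (f x) (g x) => [c1 c2] [f1 f2] [g1 g2] /=.
by rewrite addrA [c2 * f1]mulrC.
Qed.

Lemma CkC_lin (c : Cx R) m (f g : 'rV[R]_n -> Cx R) : CkC m f -> CkC m g -> CkC m (c *: f + g).
Proof.
move=> [f1 f2] [g1 g2]; split; [rewrite ReC_lin|rewrite ImC_lin];
  by do 2![apply: Ck_lin => //].
Qed.

Lemma mderivC_lin (c : Cx R) a (f g : 'rV[R]_n -> Cx R) x : CkC (msize a) f -> CkC (msize a) g ->
  mderivC a (c *: f + g) x = c * mderivC a f x + mderivC a g x.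
Proof.
move=> [f1 f2] [g1 g2]; rewrite /mderivC ReC_lin ImC_lin.
rewrite !mderiv_lin//; try exact: Ck_lin.
case: c => c1 c2; rewrite /mkC /ReC /ImC /=.
apply/eqP; rewrite eq_complex /=; apply/andP; split; apply/eqP.
  by rewrite mulNr addrA.
by rewrite addrA [c2 * _]mulrC.
Qed.
End smooth.

(* The family is indexed from 0: phi m is the (m+1)-st function of the usual
   1-based enumeration.  Only the values on [0, +oo[ are constrained (and used). *)
Record weight_family (R : realType) (phi : nat -> R -> R) : Prop := WeightFamily {
  wf_nondecreasing : forall m x y, 0 <= x -> x <= y -> phi m x <= phi m y;
  wf_continuous : forall m, {within [set x | 0 <= x], continuous (phi m)};
  wf_superlinear : forall m, phi m x / x @[x --> +oo] --> +oo;
  wf_log : forall m A, 0 < A -> exists2 C, 0 < C &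
    forall x, 0 <= x -> phi m x + A * ln (1 + x) <= phi m.+1 x + C;
  wf_dilation : forall m, exists2 a, 0 < a &
    forall x, 0 <= x -> phi m (2 * x) <= phi m.+1 x + a;
  wf_doubling : forall m, exists h l : R, [/\ 1 < h, 0 < l &
    forall x, 0 <= x -> 2 * phi m x <= phi m.+1 (h * x) + l]
}.

Section weights.
Context (R : realType).

(* The real supremum is the genuine one (the set is bounded above) for the
   functions psi (phi m) of a weight family, see young_psi_ub. *)
Definition young (g : R -> R) (x : R) : R :=
  sup [set x * y - g y | y in [set y | 0 <= y]].

Definition psi (phi : R -> R) (x : R) : R := phi (expR x).

Variables (phi : nat -> R -> R) (hphi : weight_family phi).

Lemma weight_le m : exists2 C, 0 < C &
  forall x, 0 <= x -> phi m x <= phi m.+1 x + C.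
Proof.
have [C C0 hC] := wf_log hphi m ltr01; exists C => // x x0.
by apply: le_trans (hC x x0); rewrite lerDl mul1r ln_ge0// lerDl.
Qed.

Lemma young_psi_ub m x : 0 <= x ->
  has_ubound [set x * y - psi (phi m) y | y in [set y | 0 <= y]].
Proof.
move=> x0; have /cvgryPge /(_ x) [M [_ hM]] := wf_superlinear hphi m.
pose T := Num.max M 1; have T0 : 0 < T by rewrite lt_max ltr01 orbT.
exists (Num.max 0 (x * T - phi m 0)) => _ [y /= y0 <-].
have yexp : y <= expR y by rewrite (le_trans _ (expR_ge1Dx y))// lerDr.
rewrite le_max /psi; have [eT|Te] := leP (expR y) T; apply/orP; [right|left].
  apply: lerB.
    by apply: ler_wpM2l => //; exact: le_trans eT.
  by apply: (wf_nondecreasing hphi) => //; exact: expR_ge0.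
rewrite subr_le0; have /hM : M < expR y.
  by apply: le_lt_trans Te; rewrite le_max lexx.
rewrite ler_pdivlMr ?expR_gt0// => /(le_trans _); apply.
exact: ler_wpM2l.
Qed.

Lemma young_psi_le m : exists C, forall x, 0 <= x ->
  young (psi (phi m.+1)) x <= young (psi (phi m)) x + C.
Proof.
have [C C0 hC] := weight_le m; exists C => x x0.
apply: ge_sup; first by exists (x * 0 - psi (phi m.+1) 0), 0 => /=.
move=> _ [y /= y0 <-]; rewrite -lerBlDr.
apply: (@le_trans _ _ (x * y - psi (phi m) y)).
  rewrite -addrA lerD2l -opprD lerN2 /psi; apply: hC; exact: expR_ge0.
by apply: ub_le_sup; [exact: young_psi_ub|exists y].
Qed.
End weights.

Section E_space.
Context (R : realType) (n : nat).

Definition enorm (x : 'rV[R]_n) : R := Num.sqrt (\sum_i x 0 i ^+ 2).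
Definition cnorm (z : 'rV[Cx R]_n) : R := Num.sqrt (\sum_i modC (z 0 i) ^+ 2).
Definition imvec (z : 'rV[Cx R]_n) : 'rV[R]_n := map_mx (@ImC R) z.

Definition Enorm (phi : R -> R) (k : nat) (f : 'rV[Cx R]_n -> Cx R) : \bar R :=
  ereal_sup [set (modC (f z) * (1 + cnorm z) ^+ k / expR (phi (enorm (imvec z))))%:E
            | z in [set: 'rV[Cx R]_n]].

(* On 'rV[Cx R]_n, differentiable is complex Frechet differentiability, so the
   first component says that f is entire. *)
Definition E_k (phi : R -> R) (k : nat) : set ('rV[Cx R]_n -> Cx R) :=
  [set f | (forall z, differentiable f z) /\ (Enorm phi k f < +oo)%E].

Definition E_step (phi : R -> R) : set ('rV[Cx R]_n -> Cx R) := \bigcap_k E_k phi k.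

Let wt phi k z := (1 + cnorm z) ^+ k / expR (phi (enorm (imvec z))).

Let wt_ge0 phi k z : 0 <= wt phi k z.
Proof. by rewrite divr_ge0 ?expR_ge0// exprn_ge0// addr_ge0// sqrtr_ge0. Qed.

Let EnormE phi k f : Enorm phi k f = wsup setT (fun z => wt phi k z * modC (f z)).
Proof.
by rewrite /Enorm /wsup /wt; congr ereal_sup; apply: eq_imagel => z _;
  rewrite -mulrA mulrC.
Qed.

Let T0 : [set: 'rV[Cx R]_n] !=set0. Proof. by exists 0. Qed.

Lemma Enorm_fin phi k f : E_step phi f -> Enorm phi k f \is a fin_num.
Proof. by move=> /(_ k I)[_]; rewrite EnormE; exact: wsup_fin. Qed.

Lemma EnormZ phi k a f : Enorm phi k (a *: f) = ((modC a)%:E * Enorm phi k f)%E.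
Proof.
rewrite !EnormE; apply: wsupZ => //; first exact: modC_ge0.
by move=> z _; rewrite /= modCM mulrCA.
Qed.

Lemma EnormD phi k f g :
  (Enorm phi k (f + g)%R <= Enorm phi k f + Enorm phi k g)%E.
Proof.
rewrite !EnormE; apply: wsupD => z _; rewrite -mulrDr ler_wpM2l//.
exact: modCD.
Qed.

Lemma E_step0 phi : E_step phi 0.
Proof.
move=> k _; split; first by move=> z; exact: differentiable_cst.
by rewrite -(scale0r 0) EnormZ (_ : modC 0 = 0) ?mul0e// /modC /ReC /ImC /=
  expr0n addr0 sqrtr0.
Qed.

Lemma E_step_lin phi a f g : E_step phi f -> E_step phi g -> E_step phi (a *: f + g).
Proof.
move=> Ef Eg k _; have [df nf] := Ef k I; have [dg ng] := Eg k I; split.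
  move=> z; have da : differentiable (a *: f) z := differentiableZ a (df z).
  exact: differentiableD da (dg z).
apply: le_lt_trans (EnormD _ _ _ _) _; rewrite EnormZ lte_add_pinfty//.
by rewrite -(fineK (Enorm_fin k Ef)) -EFinM ltry.
Qed.

Lemma Enorm_le (phi phi' : R -> R) C :
  (forall x, 0 <= x -> phi x <= phi' x + C) ->
  forall k f, (Enorm phi' k f <= (expR C)%:E * Enorm phi k f)%E.
Proof.
move=> h k f; rewrite !EnormE; apply: wsup_le; first exact: expR_ge0.
move=> z _; rewrite mulrA ler_wpM2r ?modC_ge0// /wt mulrCA.
rewrite ler_wpM2l ?exprn_ge0 ?addr_ge0 ?sqrtr_ge0// -!expRN -expRD ler_expR.
by rewrite lerNl opprD opprK addrC lerBlDr h// sqrtr_ge0.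
Qed.

Variables (phi : nat -> R -> R) (hphi : weight_family phi).

Lemma E_incr m : E_step (phi m) `<=` E_step (phi m.+1).
Proof.
have [C _ hC] := weight_le hphi m.
move=> f Ef k _; have [df nf] := Ef k I; split; first exact: df.
apply: le_lt_trans (Enorm_le hC _ _) _.
by rewrite -(fineK (Enorm_fin k Ef)) -EFinM ltry.
Qed.

Lemma E_cts nu k : exists l (c : R), forall f, E_step (phi nu) f ->
  (Enorm (phi nu.+1) k f <= c%:E * Enorm (phi nu) l f)%E.
Proof.
have [C _ hC] := weight_le hphi nu.
by exists k, (expR C) => f _; exact: Enorm_le.
Qed.

Definition E_spectrum : lc_spectrum ('rV[Cx R]_n -> Cx R) :=
  @LCSpectrum R ('rV[Cx R]_n -> Cx R)
    (fun nu => E_step (phi nu)) (fun nu => Enorm (phi nu))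
    (fun nu => @E_step0 (phi nu)) (fun nu => @E_step_lin (phi nu)) E_incr
    (fun nu => @Enorm_fin (phi nu)) (fun nu k a f _ => EnormZ (phi nu) k a f)
    (fun nu k f g _ _ => EnormD (phi nu) k f g) E_cts.

Definition E_lim := indlim E_spectrum.
End E_space.

Section G_space.
Context (R : realType) (n : nat).

Definition monom (x : 'rV[R]_n) (b : 'I_n -> nat) : R := \prod_i x 0 i ^+ b i.

Definition Gnorm (m : nat) (g : R -> R) (f : 'rV[R]_n -> Cx R) : \bar R :=
  ereal_sup [set r | exists x a b, (msize a <= m)%N /\
    r = (`|monom x b| * modC (mderivC a f x) /
         ((msize b)`!%:R * expR (- g (msize b)%:R)))%:E].

Definition G_m (m : nat) (g : R -> R) : set ('rV[R]_n -> Cx R) :=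
  [set f | CkC m f /\ (Gnorm m g f < +oo)%E].

Definition G_step (g : R -> R) : set ('rV[R]_n -> Cx R) := \bigcap_m G_m m g.

Let J := ('rV[R]_n * ('I_n -> nat) * ('I_n -> nat))%type.
Let D m : set J := [set p | (msize p.1.2 <= m)%N].
Let wt (g : R -> R) (p : J) :=
  `|monom p.1.1 p.2| / ((msize p.2)`!%:R * expR (- g (msize p.2)%:R)).

Let wt_ge0 g p : 0 <= wt g p.
Proof. by rewrite divr_ge0// mulr_ge0// expR_ge0. Qed.

Let GnormE m g f :
  Gnorm m g f = wsup (D m) (fun p => wt g p * modC (mderivC p.1.2 f p.1.1)).
Proof.
rewrite /Gnorm /wsup; congr ereal_sup; apply/seteqP; split.
  by move=> _ [x [a [b [am ->]]]]; exists (x, a, b) => //; rewrite /wt /= mulrAC.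
by move=> _ [[[x a] b] am <-]; exists x, a, b; split=> //; rewrite /wt /= mulrAC.
Qed.

Let D0 m : D m !=set0.
Proof. by exists (0, fun=> 0%N, fun=> 0%N); rewrite /D/= /msize big1. Qed.

Lemma Gnorm_fin m g f : G_step g f -> Gnorm m g f \is a fin_num.
Proof. by move=> /(_ m I)[_]; rewrite GnormE; exact: wsup_fin. Qed.

Lemma CkC0 m : CkC m (0 : 'rV[R]_n -> Cx R).
Proof.
have c0 : continuous (fun _ : 'rV[R]_n => 0 : R).
  by move=> x; exact: cst_continuous.
have H : Ck m (fun _ : 'rV[R]_n => 0 : R).
  elim: m => [//|m IH] /=; split=> //.
  move=> i; split; first by move=> x; exact: derivable_cst.
  rewrite (_ : partial _ _ = fun=> 0)//; apply/funext => x.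
  by rewrite /partial derive_cst.
by split; rewrite (_ : _ \o _ = fun=> 0).
Qed.

Lemma CkC_le m m' (f : 'rV[R]_n -> Cx R) : (m <= m')%N -> CkC m' f -> CkC m f.
Proof. by move=> mm' [? ?]; split; exact: Ck_le mm' _. Qed.

Lemma mderivC0 a (x : 'rV[R]_n) : mderivC a 0 x = 0.
Proof.
have := @mderivC_lin R n (-1) a 0 0 x (CkC0 _) (CkC0 _).
by rewrite scaler0 addr0 mulN1r addNr.
Qed.

Lemma GnormZ m g a f : CkC m f ->
  Gnorm m g (a *: f) = ((modC a)%:E * Gnorm m g f)%E.
Proof.
move=> Cf; rewrite !GnormE; apply: wsupZ => //; first exact: modC_ge0.
move=> p pm; rewrite -[a *: f]addr0 mderivC_lin; last exact: CkC0.
  by rewrite mderivC0 addr0 modCM mulrCA.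
exact: CkC_le Cf.
Qed.

Lemma GnormD m g f h : CkC m f -> CkC m h ->
  (Gnorm m g (f + h)%R <= Gnorm m g f + Gnorm m g h)%E.
Proof.
move=> Cf Ch; rewrite !GnormE; apply: wsupD => p pm.
rewrite -mulrDr ler_wpM2l// -[f]scale1r mderivC_lin; last 2 first.
- exact: CkC_le Cf.
- exact: CkC_le Ch.
by rewrite mul1r scale1r; exact: modCD.
Qed.

Lemma G_step0 g : G_step g 0.
Proof.
move=> m _; split; first exact: CkC0.
rewrite -(scale0r 0) GnormZ; last exact: CkC0.
by rewrite (_ : modC 0 = 0) ?mul0e// /modC /ReC /ImC /= expr0n addr0 sqrtr0.
Qed.

Lemma G_step_lin g a f h : G_step g f -> G_step g h -> G_step g (a *: f + h).
Proof.
move=> Gf Gh m _; have [Cf nf] := Gf m I; have [Ch nh] := Gh m I.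
have Caf : CkC m (a *: f) by rewrite -[a *: f]addr0; apply: CkC_lin => //; exact: CkC0.
split; first exact: CkC_lin.
apply: le_lt_trans (GnormD _ Caf Ch) _; rewrite GnormZ// lte_add_pinfty//.
by rewrite -(fineK (Gnorm_fin m Gf)) -EFinM ltry.
Qed.

Lemma Gnorm_le (g g' : R -> R) C :
  (forall x, 0 <= x -> g' x <= g x + C) ->
  forall m f, (Gnorm m g' f <= (expR C)%:E * Gnorm m g f)%E.
Proof.
move=> h m f; rewrite !GnormE; apply: wsup_le; first exact: expR_ge0.
move=> p _; rewrite mulrA ler_wpM2r ?modC_ge0// /wt mulrCA.
rewrite ler_wpM2l// !invfM mulrCA ler_wpM2l ?invr_ge0//.
by rewrite -!expRN !opprK -expRD ler_expR addrC h.
Qed.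

Variables (phi : nat -> R -> R) (hphi : weight_family phi).

Definition psi_star (nu : nat) : R -> R := young (psi (phi nu)).

Lemma G_incr nu : G_step (psi_star nu) `<=` G_step (psi_star nu.+1).
Proof.
have [C hC] := young_psi_le hphi nu.
move=> f Gf k _; have [df nf] := Gf k I; split; first exact: df.
apply: le_lt_trans (Gnorm_le hC _ _) _.
by rewrite -(fineK (Gnorm_fin k Gf)) -EFinM ltry.
Qed.

Lemma G_cts nu m : exists l (c : R), forall f, G_step (psi_star nu) f ->
  (Gnorm m (psi_star nu.+1) f <= c%:E * Gnorm l (psi_star nu) f)%E.
Proof.
have [C hC] := young_psi_le hphi nu.
by exists m, (expR C) => f _; exact: Gnorm_le.
Qed.

Definition G_spectrum : lc_spectrum ('rV[R]_n -> Cx R) :=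
  @LCSpectrum R ('rV[R]_n -> Cx R)
    (fun nu => G_step (psi_star nu)) (fun nu m => Gnorm m (psi_star nu))
    (fun nu => @G_step0 (psi_star nu)) (fun nu => @G_step_lin (psi_star nu)) G_incr
    (fun nu m => @Gnorm_fin m (psi_star nu))
    (fun nu m a f Gf => GnormZ _ a (proj1 (Gf m I)))
    (fun nu m f h Gf Gh => GnormD _ (proj1 (Gf m I)) (proj1 (Gh m I))) G_cts.

Definition G_lim := indlim G_spectrum.
End G_space.

Section fourier.
Context (R : realType).

(* Lebesgue measure on R^n, as the n-fold product measure. *)
Fixpoint lebesgue_tuple (n : nat) : set (n.-tuple (measurableTypeR R)) -> \bar R :=
  match n with
  | 0 => \d_ [tuple]
  | n'.+1 => pushforward (product_measure1 lebesgue_measure (@lebesgue_tuple n'))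
      (fun p => [the n'.+1.-tuple (measurableTypeR R) of p.1 :: p.2])
  end.

Definition cintegral (n : nat) (f : 'rV[R]_n -> Cx R) : Cx R :=
  let f' (t : n.-tuple (measurableTypeR R)) := f (\row_i tnth t i) in
  mkC (fine (\int[@lebesgue_tuple n]_t (ReC (f' t))%:E)%E)
      (fine (\int[@lebesgue_tuple n]_t (ImC (f' t))%:E)%E).

Definition rdot (n : nat) (x y : 'rV[R]_n) : R := \sum_i x 0 i * y 0 i.

Definition realpt (n : nat) (x : 'rV[R]_n) : 'rV[Cx R]_n :=
  map_mx (fun r => mkC r 0) x.

Definition fourier (n : nat) (f : 'rV[Cx R]_n -> Cx R) (x : 'rV[R]_n) : Cx R :=
  cintegral (fun xi => f (realpt xi) * mkC (cos (rdot x xi)) (- sin (rdot x xi))).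
End fourier.

Definition tvs_isomorphism (K : numDomainType) (X Y : tvsType K) (T : X -> Y) :=
  linear T /\ continuous T /\
  exists T' : Y -> X, [/\ cancel T T', cancel T' T & continuous T'].

(* Main.v *)
Require Import Defs.
From HB Require Import structures.
From mathcomp Require Import all_boot all_order all_algebra complex.
From mathcomp Require Import all_classical all_reals all_analysis.
From mathcomp Require Import measurable_realfun ring lra.
Set Implicit Arguments. Unset Strict Implicit. Unset Printing Implicit Defensive.
Import Order.TTheory GRing.Theory Num.Theory.
Import numFieldNormedType.Exports.
Local Open Scope classical_set_scope.
Local Open Scope ring_scope.

(* Write f^ for the Fourier transform of f and [invF g z] for the integral of
   g(x) e^{i<x,z>}.

   If f is in E(phi), Cauchy's theorem in each coordinate moves the domain of
   integration from R^n to R^n + iv, which multiplies the kernel by e^{<x,v>}.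
   With v = -t sgn(x_i) e_i this bounds |x_i|^N |D^a f^(x)| by a constant times
   N! e^{phi(t)} t^{-N}; the infimum over t = e^y, y >= 0, is N! e^{-psi^*(N)}.

   Conversely, summing the exponential series, the bounds defining G(psi^* )
   give |D^a g(x)| <= C e^{phi(2s)} e^{-s|x_j|} for all s >= 1.  Hence [invF g]
   is entire, and with s = n(r + 1), r = ||Im z||, and integrations by parts it
   is O((1 + ||z||)^{-k} e^{phi(2n(r + 1))}) for every k.  By (i_3) the last
   weight is dominated by a later member of the family.

   The two maps are inverse to each other up to the factor (2 pi)^n, by Fourier
   inversion, obtained from Abel summation with the factor e^{-e|x_j|}, whose
   transform is a Poisson kernel.  Moving the contour once more gives the
   inversion formula at every z, not only at real points. *)

(** A single majorant carries the analysis: the product of the 1/(1 + x_j^2), of mass pi^n. Being a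
    product it restricts to lines, so Cauchy's theorem, integration by parts and affine substitution
    are proved in one variable and lifted one coordinate at a time; being integrable it justifies
    Fubini and dominated convergence. It is also, up to scale, the Poisson kernel. Hence the choice
    of e^{-e|x_j|}: its transform needs only elementary antiderivatives, and the mass of the
    resulting kernel is already known.

    One coordinate also suffices for the estimates. A monomial x^b is at most |x_i|^{|b|} for the
    largest coordinate, so a shift along e_i alone serves every b; likewise (1 + ||z||)^k is
    controlled by 1 + |z_i|^k for the largest |z_i|, so only pure derivatives are integrated by
    parts.

    In phi(2n(r + 1)) the 2 leaves a convergent geometric series, n comes from passing from |x_j| to
    the l^1 norm, and the 1 leaves room for integrability.

    The forward map stays in its step and spends 2n extra orders of polynomial decay; the inverse
    keeps the order and moves to a later step. Continuity on the inductive limits is then formal. *)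

Section tuple_measure.
Context (R : realType).
Local Notation RT := (measurableTypeR R).

Definition consT n (p : RT * n.-tuple RT) : n.+1.-tuple RT :=
  [the n.+1.-tuple RT of p.1 :: p.2].

Lemma measurable_consT n : measurable_fun setT (@consT n).
Proof. exact: measurable_cons. Qed.

Section cons_measure.
Variables (n : nat) (m : {sigma_finite_measure set (n.-tuple RT) -> \bar R}).
Local Notation m1 := (product_measure1 (@lebesgue_measure R) m).
Let m1s : {measure set _ -> \bar R} := m1.

(** One step of the recursion defining [lebesgue_tuple], with the lower-dimensional measure made
    abstract so that the measure structure can be attached to it. *)
Definition cons_measure : set (n.+1.-tuple RT) -> \bar R := pushforward m1 (@consT n).

Let cons_measure0 : cons_measure set0 = 0%E.
Proof. by rewrite /cons_measure /pushforward preimage_set0 measure0. Qed.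

Let mpre A : measurable A -> measurable (@consT n @^-1` A).
Proof. by move=> mA; rewrite -[X in measurable X]setTI; exact: measurable_consT. Qed.

Let cons_measure_ge0 A : (0 <= cons_measure A)%E.
Proof. exact: (measure_ge0 m1s). Qed.

Let cons_measure_sigma_additive : semi_sigma_additive cons_measure.
Proof.
move=> F mF tF mUF; rewrite /cons_measure /pushforward preimage_bigcup.
apply: (measure_semi_sigma_additive (s := m1s)).
- by move=> k; exact: mpre.
- apply/trivIsetP => /= i j _ _ ij; rewrite -preimage_setI.
  by move/trivIsetP : tF => /(_ _ _ _ _ ij) ->//; rewrite preimage_set0.
- by rewrite -preimage_bigcup; exact: mpre.
Qed.

HB.instance Definition _ := isMeasure.Build _ _ _
  cons_measure cons_measure0 cons_measure_ge0 cons_measure_sigma_additive.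

Let cons_measure_sigma_finite : sigma_finite setT cons_measure.
Proof.
have /sigma_finiteP[F [TF ndF Foo]] := sigma_finiteT (@lebesgue_measure R).
have /sigma_finiteP[G [TG ndG Goo]] := sigma_finiteT m.
pose bt (t : n.+1.-tuple RT) : n.-tuple RT := [tuple of behead t].
(* Both exhaustions are nondecreasing, so the index [maxn i j] captures the head and the tail of a
   tuple at once. *)
exists (fun k => (fun t => thead t) @^-1` F k `&` bt @^-1` G k).
  apply/seteqP; split => // t _.
  have : setT (thead t) by []. have : setT (bt t) by [].
  rewrite {1}TF {1}TG => -[i _ Gi] [j _ Fj]; exists (maxn i j) => //; split.
    by have /subsetPset := ndF _ _ (leq_maxr i j); exact.
  by have /subsetPset := ndG _ _ (leq_maxl i j); exact.
move=> k; have [mF Fk] := Foo k; have [mG Gk] := Goo k; split.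
  apply: measurableI; rewrite -[X in measurable X]setTI.
    exact: (measurable_tnth ord0).
  exact: measurable_behead.
rewrite /cons_measure /pushforward [X in m1 X](_ : _ = F k `*` G k).
  by rewrite product_measure1E// lte_mul_pinfty// ge0_fin_numE.
apply/seteqP; split => -[x t] /=;
  rewrite /consT /bt /= theadE /= (_ : [tuple of behead (x :: t)] = t) //;
  exact: val_inj.
Qed.

HB.instance Definition _ := Measure_isSigmaFinite.Build _ _ _ cons_measure
  cons_measure_sigma_finite.
End cons_measure.

(** The recursion yields a bare set function. Sigma-finiteness has to travel through the induction
    together with the measure axioms, because the product with one more factor requires it. *)
Lemma lebesgue_tuple_ex n :
  exists m : {sigma_finite_measure set (n.-tuple RT) -> \bar R},
    @lebesgue_tuple R n = m.
Proof.
elim: n => [|n [m IH]].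
  by exists (dirac [tuple] : {sigma_finite_measure set (0.-tuple RT) -> \bar R}).
by exists (cons_measure m : {sigma_finite_measure set _ -> \bar R}); rewrite /= IH.
Qed.

Section lebesgue_tuple_instance.
Variable n : nat.
Local Notation leb := (@lebesgue_tuple R n).

Let leb0 : leb set0 = 0%E.
Proof. by have [m ->] := lebesgue_tuple_ex n; exact: measure0. Qed.
Let leb_ge0 A : (0 <= leb A)%E.
Proof. by have [m ->] := lebesgue_tuple_ex n; exact: measure_ge0. Qed.
Let leb_sigma_additive : semi_sigma_additive leb.
Proof.
by have [m ->] := lebesgue_tuple_ex n; exact: measure_semi_sigma_additive.
Qed.
HB.instance Definition _ := isMeasure.Build _ _ _
  leb leb0 leb_ge0 leb_sigma_additive.
Let leb_sigma_finite : sigma_finite setT leb.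
Proof. by have [m ->] := lebesgue_tuple_ex n; exact: sigma_finiteT. Qed.
HB.instance Definition _ := Measure_isSigmaFinite.Build _ _ _ leb leb_sigma_finite.
End lebesgue_tuple_instance.

End tuple_measure.

Lemma cvg_rowP (K : numFieldType) T (F : set_system T) (FF : Filter F) n
    (g : T -> 'rV[K]_n) (l : 'rV[K]_n) :
  (forall i, (fun t => g t 0 i) @ F --> l 0 i) -> g @ F --> l.
Proof.
move=> gl A [P lP PA]; rewrite /nbhs /=.
have := @filter_forall _ _ (fun i => [set t | P 0 i (g t 0 i)]) _ FF
  (fun i => gl i _ (lP 0 i)).
by apply: filterS => t tP; apply: PA => i j; rewrite ord1; exact: tP.
Qed.

(** * Integration on R^n *)

Section rint.
Context (R : realType).
Local Notation RT := (measurableTypeR R).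
Local Notation leb n := (@lebesgue_tuple R n).

Definition trow n (t : n.-tuple RT) : 'rV[R]_n := \row_i tnth t i.

(** Tuples carry the product sigma-algebra, rows the product topology. [F] is the pointwise limit of
    its values at coordinates rounded down to the grid of mesh 1/(k + 1); a rounded function factors
    through the countable set of integer tuples, and each fibre is a box of half-open intervals. *)
Lemma measurable_trow n (F : 'rV[R]_n -> R) : continuous F ->
  measurable_fun [set: n.-tuple RT] (F \o @trow n).
Proof.
move=> cF.
pose fl (k : nat) (x : R) : int := Num.floor (x * k.+1%:R).
pose G (k : nat) (v : n.-tuple int) : R := F (\row_i ((tnth v i)%:~R / k.+1%:R)).
pose h k (t : n.-tuple RT) : R := G k [tuple fl k (tnth t i) | i < n].
apply: (@measurable_fun_cvg _ _ _ _ h).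
  move=> k _ Y mY; rewrite setTI.
  have -> : h k @^-1` Y = \bigcup_(v : n.-tuple int)
      (if `[< Y (G k v) >] then
         \bigcap_(i in [set: 'I_n]) ((@tnth n RT)^~ i @^-1` (fl k @^-1` [set tnth v i]))
       else set0).
    apply/seteqP; split => t.
      move=> Yt; exists [tuple fl k (tnth t i) | i < n] => //.
      rewrite asboolT// => i _ /=; by rewrite tnth_mktuple.
    move=> [v _]; case: asboolP => // Yv H.
    suff e : [tuple fl k (tnth t i) | i < n] = v by rewrite /preimage /= /h e.
    by apply: eq_from_tnth => i; rewrite tnth_mktuple; exact: H.
  apply: countable_bigcupT_measurable; first exact: countableP.
  move=> v; case: ifP => // _.
  apply: fin_bigcap_measurable => // i _.
  rewrite -[X in measurable X]setTI; apply: measurable_tnth => //.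
  rewrite (_ : _ @^-1` _ = `[(tnth v i)%:~R / k.+1%:R, (tnth v i + 1)%:~R / k.+1%:R[%classic).
    exact: measurable_itv.
  apply/seteqP; split=> x /=; rewrite in_itv /= /fl.
    move=> <-; rewrite ler_pdivrMr// ltr_pdivlMr//.
    exact: real_floor_itv (num_real _).
  rewrite ler_pdivrMr// ltr_pdivlMr// => h1; apply: floor_def => //.
move=> t _.
suff H : (fun k => \row_i ((tnth [tuple fl k (tnth t i) | i < n] i)%:~R / k.+1%:R) : 'rV[R]_n)
   @ \oo --> trow t by exact: (cvg_comp _ _ H (cF _)).
apply: cvg_rowP => i; rewrite mxE.
apply/cvgrPdist_lt => e e0; near=> k; rewrite mxE tnth_mktuple.
set x := tnth t i.
have k0 : 0 < k.+1%:R :> R by [].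
have /andP[h1 h2] := real_floor_itv (num_real (x * k.+1%:R)).
rewrite ger0_norm ?subr_ge0 ?ler_pdivrMr//.
rewrite ltrBlDl -(mulfK (lt0r_neq0 k0) e) -mulrDl ltr_pdivlMr//.
apply: (lt_le_trans h2); rewrite intrD lerD2l.
rewrite -ler_pdivrMr// mul1r; apply: ltW.
near: k; exact: near_infty_natSinv_lt (PosNum e0).
Unshelve. all: by end_near. Qed.

Definition weight n (x : 'rV[R]_n) : R := \prod_i (1 + x 0 i ^+ 2)^-1.

Definition tame n (F : 'rV[R]_n -> R) :=
  continuous F /\ exists C, forall x, `|F x| <= C * weight x.

Definition rint n (F : 'rV[R]_n -> R) : R := \int[leb n]_t F (trow t).

Definition vcons n (x : R) (v : 'rV[R]_n) : 'rV[R]_n.+1 :=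
  \row_i oapp (v 0) x (unlift ord0 i).

Lemma vcons0 n x (v : 'rV[R]_n) : vcons x v 0 ord0 = x.
Proof. by rewrite mxE unlift_none. Qed.

Lemma vconsS n x (v : 'rV[R]_n) i : vcons x v 0 (lift ord0 i) = v 0 i.
Proof. by rewrite mxE liftK. Qed.

Lemma trow_consT n x (t : n.-tuple RT) : trow (consT (x, t)) = vcons x (trow t).
Proof.
apply/rowP => i; case: (unliftP ord0 i) => [j ->|->].
  by rewrite vconsS !mxE tnthS.
by rewrite vcons0 mxE tnth0.
Qed.

Lemma weight_gt0 n (x : 'rV[R]_n) : 0 < weight x.
Proof. by apply: prodr_gt0 => i _; rewrite invr_gt0 ltr_pwDl// sqr_ge0. Qed.

Lemma weight_vcons n x (v : 'rV[R]_n) :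
  weight (vcons x v) = (1 + x ^+ 2)^-1 * weight v.
Proof.
rewrite /weight big_ord_recl vcons0; congr (_ * _).
by apply: eq_bigr => i _; rewrite vconsS.
Qed.

Section cont_ops.
Variable T : topologicalType.
Implicit Types f g : T -> R.
Lemma contD f g : continuous f -> continuous g -> continuous (fun x => f x + g x).
Proof. by move=> cf cg x; apply: cvgD; [exact: cf|exact: cg]. Qed.
Lemma contB f g : continuous f -> continuous g -> continuous (fun x => f x - g x).
Proof. by move=> cf cg x; apply: cvgB; [exact: cf|exact: cg]. Qed.
Lemma contM f g : continuous f -> continuous g -> continuous (fun x => f x * g x).
Proof. by move=> cf cg x; apply: cvgM; [exact: cf|exact: cg]. Qed.
Lemma contN f : continuous f -> continuous (fun x => - f x).
Proof. by move=> cf x; apply: cvgN; exact: cf. Qed.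
Lemma contV f : (forall x, f x != 0) -> continuous f -> continuous (fun x => (f x)^-1).
Proof. by move=> f0 cf x; apply: cvgV => //; exact: cf. Qed.
Lemma cont_cst (c : R) : continuous (fun _ : T => c).
Proof. by move=> x; exact: cvg_cst. Qed.
Lemma cont_comp (U : topologicalType) (h : R -> U) f :
  continuous h -> continuous f -> continuous (fun x => h (f x)).
Proof. by move=> ch cf x; apply: continuous_comp; [exact: cf|exact: ch]. Qed.
Lemma cont_prod (I : Type) (s : seq I) (F : I -> T -> R) :
  (forall i, continuous (F i)) -> continuous (fun x => \prod_(i <- s) F i x).
Proof.
move=> cF; elim: s => [|i s IH] x.
  by under eq_fun do rewrite big_nil; exact: cvg_cst.
rewrite /continuous_at big_cons; under eq_fun do rewrite big_cons.
by apply: cvgM; [exact: cF|exact: IH].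
Qed.
Lemma cont_sum (I : Type) (s : seq I) (F : I -> T -> R) :
  (forall i, continuous (F i)) -> continuous (fun x => \sum_(i <- s) F i x).
Proof.
move=> cF; elim: s => [|i s IH] x.
  by under eq_fun do rewrite big_nil; exact: cvg_cst.
rewrite /continuous_at big_cons; under eq_fun do rewrite big_cons.
by apply: cvgD; [exact: cF|exact: IH].
Qed.
End cont_ops.

Lemma cont_row (T : topologicalType) n (g : T -> 'rV[R]_n) :
  (forall i, continuous (fun t => g t 0 i)) -> continuous g.
Proof. by move=> cg x; apply: cvg_rowP => i; exact: cg. Qed.

Lemma continuous_coord n i : continuous (fun x : 'rV[R]_n => x 0 i).
Proof. exact: coord_continuous. Qed.

Lemma continuous_weight n : continuous (@weight n).
Proof.
apply: cont_prod => i; apply: contV.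
  by move=> x; apply: lt0r_neq0; rewrite ltr_pwDl// sqr_ge0.
apply: contD; first exact: cont_cst.
by apply: contM; exact: continuous_coord.
Qed.

Lemma integral_oneDsqrV : (\int[@lebesgue_measure R]_x ((1 + x ^+ 2)^-1)%:E = pi%:E)%E.
Proof.
have := @ge0_symfun_integralT R (fun x => (oneDsqr x)^-1).
rewrite -set_itvcy integral0y_oneDsqr => ->.
- by rewrite -EFinM mulrC divfK.
- by move=> x; rewrite invr_ge0 (le_trans _ (oneDsqr_ge1 _)).
- exact: continuous_oneDsqrV.
- by move=> x; rewrite /= /oneDsqr sqrrN.
Qed.

Lemma integral_cons n (F : 'rV[R]_n.+1 -> R) : continuous F -> (forall x, 0 <= F x) ->
  (\int[leb n.+1]_t (F (trow t))%:E =
   \int[@lebesgue_measure R]_x \int[leb n]_t (F (vcons x (trow t)))%:E)%E.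
Proof.
move=> cF F0.
have mF : measurable_fun [set: n.+1.-tuple RT] (EFin \o (F \o @trow n.+1)).
  by apply/measurable_EFinP; exact: measurable_trow.
transitivity (\int[product_measure1 (@lebesgue_measure R) (leb n)]_p
   (F (trow (consT p)))%:E)%E.
  rewrite -(preimage_setT (@consT R n)).
  rewrite -(@ge0_integral_pushforward _ _ _ _ R _ (@measurable_consT R n)
    (product_measure1 (@lebesgue_measure R) (leb n)) setT (EFin \o (F \o @trow n.+1))) //.
  by move=> y _; rewrite lee_fin; exact: F0.
have mG : measurable_fun setT (fun p => (F (trow (@consT R n p)))%:E).
  by apply: (measurableT_comp mF); exact: measurable_consT.
apply: etrans (@fubini_tonelli1 _ _ _ _ R (@lebesgue_measure R) (leb n) _ mG _) _.
  by move=> p; rewrite lee_fin; exact: F0.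
apply: eq_integral => x _; apply: eq_integral => t _ /=.
by rewrite trow_consT.
Qed.

Lemma integral_weight n : (\int[leb n]_t (weight (trow t))%:E = (pi ^+ n)%:E)%E.
Proof.
elim: n => [|n IH].
  rewrite /= integral_dirac//; last by apply/measurable_EFinP; apply: measurable_trow; exact: continuous_weight.
  by rewrite diracE mem_set// mul1e /weight big_ord0.
rewrite integral_cons; [|exact: continuous_weight|by move=> x; rewrite ltW ?weight_gt0].
transitivity (\int[@lebesgue_measure R]_x ((pi ^+ n)%:E * ((1 + x ^+ 2)^-1)%:E))%E.
  apply: eq_integral => x _.
  under eq_integral do rewrite weight_vcons EFinM.
  rewrite ge0_integralZl_EFin//.
  - by rewrite IH muleC.
  - by move=> t _; rewrite lee_fin ltW ?weight_gt0.
  - by apply/measurable_EFinP; apply: measurable_trow; exact: continuous_weight.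
  - by rewrite invr_ge0 addr_ge0 ?sqr_ge0.
rewrite ge0_integralZl_EFin//.
- by rewrite integral_oneDsqrV -EFinM exprSr.
- by move=> t _; rewrite lee_fin invr_ge0 addr_ge0 ?sqr_ge0.
- by apply/measurable_EFinP; apply: continuous_measurable_fun; exact: continuous_oneDsqrV.
- by rewrite exprn_ge0// pi_ge0.
Qed.

Lemma tame_integrable n (F : 'rV[R]_n -> R) : tame F ->
  (leb n).-integrable setT (EFin \o (F \o @trow n)).
Proof.
move=> [cF [C hC]].
have mF : measurable_fun [set: n.-tuple RT] (EFin \o (F \o @trow n)).
  by apply/measurable_EFinP; exact: measurable_trow.
apply/integrableP; split => //.
apply: (@le_lt_trans _ _ (\int[leb n]_t (`|C|%:E * (weight (trow t))%:E))%E).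
  apply: ge0_le_integral => //.
  - by apply: measurableT_comp.
  - under eq_fun do rewrite -EFinM.
    apply/measurable_EFinP; apply: measurable_funM => //.
    by apply: measurable_trow; exact: continuous_weight.
  - move=> t _ /=; rewrite -EFinM lee_fin (le_trans (hC _))//.
    by rewrite ler_wpM2r ?ler_norm// ltW// weight_gt0.
rewrite ge0_integralZl_EFin//.
- by rewrite integral_weight -EFinM ltry.
- by move=> t _; rewrite lee_fin ltW// weight_gt0.
- by apply/measurable_EFinP; apply: measurable_trow; exact: continuous_weight.
Qed.

Lemma tame_lin n (c : R) (F G : 'rV[R]_n -> R) : tame F -> tame G ->
  tame (fun x => c * F x + G x).
Proof.
move=> [cF [C hC]] [cG [D hD]]; split.
  by apply: contD => //; apply: contM => //; exact: cont_cst.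
exists (`|c| * C + D) => x; rewrite (le_trans (ler_normD _ _))// mulrDl.
by rewrite lerD// normrM -mulrA ler_wpM2l.
Qed.

Lemma tame0 n : tame (fun _ : 'rV[R]_n => 0).
Proof.
split; first exact: cont_cst.
by exists 0 => x; rewrite normr0 mul0r.
Qed.

Lemma tame_weight n : tame (@weight n).
Proof.
split; first exact: continuous_weight.
by exists 1 => x; rewrite mul1r ger0_norm// ltW// weight_gt0.
Qed.

Lemma rintE n (F : 'rV[R]_n -> R) : rint F = fine (\int[leb n]_t (F (trow t))%:E)%E.
Proof. by []. Qed.

Lemma rintZ n (c : R) (F : 'rV[R]_n -> R) : tame F ->
  rint (fun x => c * F x) = c * rint F.
Proof. by move=> tF; rewrite /rint RintegralZl//; exact: tame_integrable tF. Qed.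

Lemma rintD n (F G : 'rV[R]_n -> R) : tame F -> tame G ->
  rint (fun x => F x + G x) = rint F + rint G.
Proof.
move=> tF tG; rewrite /rint RintegralD//;
  [exact: tame_integrable tF|exact: tame_integrable tG].
Qed.

Lemma rint_lin n (c : R) (F G : 'rV[R]_n -> R) : tame F -> tame G ->
  rint (fun x => c * F x + G x) = c * rint F + rint G.
Proof.
move=> tF tG; rewrite -rintZ// -rintD//.
by have := tame_lin c tF (tame0 n); under eq_fun do rewrite addr0.
Qed.

Lemma rint_weight n : rint (@weight n) = pi ^+ n.
Proof. by rewrite rintE integral_weight. Qed.

Lemma rint_bound n C (F : 'rV[R]_n -> R) : tame F ->
  (forall x, `|F x| <= C * weight x) -> `|rint F| <= C * pi ^+ n.
Proof.
move=> tF hC; rewrite -rint_weight -rintZ; last exact: tame_weight.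
have tCw : tame (fun x : 'rV[R]_n => C * weight x).
  by have := tame_lin C (tame_weight n) (tame0 n); under eq_fun do rewrite addr0.
apply: le_trans (le_normr_Rintegral _ (tame_integrable tF)) _ => //.
apply: le_Rintegral => //.
- apply: integrable_norm; exact: (tame_integrable tF).
- exact: (tame_integrable tCw).
- by move=> t _; exact: hC.
Qed.

Definition rint1 (h : R -> R) : R := \int[@lebesgue_measure R]_x h x.

Definition tame1 (h : R -> R) :=
  continuous h /\ exists C, forall x, `|h x| <= C * (1 + x ^+ 2)^-1.

Lemma oneDsqrV_ge0 (x : R) : 0 <= (1 + x ^+ 2)^-1.
Proof. by rewrite invr_ge0 addr_ge0 ?sqr_ge0. Qed.

Lemma cont_oneDsqrV : continuous (fun x : R => (1 + x ^+ 2)^-1).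
Proof. exact: continuous_oneDsqrV. Qed.

Lemma integrable_oneDsqrV : (@lebesgue_measure R).-integrable setT
  (EFin \o (fun x : R => (1 + x ^+ 2)^-1)).
Proof.
apply/integrableP; split.
  by apply/measurable_EFinP; apply: continuous_measurable_fun; exact: cont_oneDsqrV.
under eq_integral do rewrite /= ger0_norm ?oneDsqrV_ge0//.
by rewrite integral_oneDsqrV ltry.
Qed.

Lemma tame1_integrable h : tame1 h ->
  (@lebesgue_measure R).-integrable setT (EFin \o h).
Proof.
move=> [ch [C hC]].
apply: (@le_integrable _ _ R (@lebesgue_measure R) setT measurableT (EFin \o h)
  (fun x => `|C|%:E * ((1 + x ^+ 2)^-1)%:E)%E).
- by apply/measurable_EFinP; exact: continuous_measurable_fun.
- move=> x _; rewrite lee_fin [leRHS]ger0_norm ?mulr_ge0 ?oneDsqrV_ge0//.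
  by rewrite (le_trans (hC _))// ler_wpM2r ?ler_norm// oneDsqrV_ge0.
- by apply: integrableZl => //; exact: integrable_oneDsqrV.
Qed.

Section slices.
Variables (n : nat) (F : 'rV[R]_n.+1 -> R).
Hypothesis tF : tame F.

Lemma cont_vconsr x : continuous (fun v : 'rV[R]_n => vcons x v).
Proof.
apply: cont_row => i; case: (unliftP ord0 i) => [j ->|->].
  by under eq_fun do rewrite vconsS; exact: continuous_coord.
by under eq_fun do rewrite vcons0; exact: cont_cst.
Qed.

Lemma cont_vconsl v : continuous (fun x : R => @vcons n x v).
Proof.
apply: cont_row => i; case: (unliftP ord0 i) => [j ->|->].
  by under eq_fun do rewrite vconsS; exact: cont_cst.
by under eq_fun do rewrite vcons0; move=> x; exact: cvg_id.
Qed.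

Lemma tame_vcons x : tame (fun v => F (vcons x v)).
Proof.
have [cF [C hC]] := tF; split.
  by move=> v; apply: continuous_comp; [exact: cont_vconsr|exact: cF].
exists (C * (1 + x ^+ 2)^-1) => v; apply: le_trans (hC _) _.
by rewrite weight_vcons mulrA.
Qed.

Lemma weight_le1 k (v : 'rV[R]_k) : weight v <= 1.
Proof.
apply: prodr_ile1 => i _; rewrite oneDsqrV_ge0 invf_le1 ?ltr_pwDl ?sqr_ge0//.
by rewrite lerDl sqr_ge0.
Qed.

Lemma tame1_vcons v : tame1 (fun x => F (vcons x v)).
Proof.
have [cF [C hC]] := tF; split.
  by move=> x; apply: continuous_comp; [exact: cont_vconsl|exact: cF].
exists `|C| => x; rewrite (le_trans (hC _))// weight_vcons mulrA.
rewrite (@le_trans _ _ (`|C| * (1 + x ^+ 2)^-1 * weight v))//.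
  by rewrite !ler_wpM2r ?oneDsqrV_ge0 ?ler_norm// ltW// weight_gt0.
by rewrite ler_piMr ?weight_le1// mulr_ge0 ?oneDsqrV_ge0.
Qed.

Let phi p := (F (trow (@consT R n p)))%:E.

Let int_phi : (product_measure1 (@lebesgue_measure R) (leb n)).-integrable setT phi.
Proof.
have [cF [C hC]] := tF.
have mF : measurable_fun [set: n.+1.-tuple RT] (EFin \o (F \o @trow n.+1)).
  by apply/measurable_EFinP; exact: measurable_trow.
have mphi : measurable_fun setT phi.
  by apply: (measurableT_comp mF); exact: measurable_consT.
apply/integrableP; split => //.
have /integrableP[_] := tame_integrable tF; apply: le_lt_trans.
rewrite -(preimage_setT (@consT R n)).
rewrite (@ge0_integral_pushforward _ _ _ _ R _ (@measurable_consT R n)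
  (product_measure1 (@lebesgue_measure R) (leb n)) setT
  (fun t => `|(F (trow t))%:E|%E)) //.
by apply: measurableT_comp.
Qed.

Let rintEphi : rint F = fine (\int[product_measure1 (@lebesgue_measure R) (leb n)]_p phi p)%E.
Proof.
have [cF [C hC]] := tF.
have mF : measurable_fun [set: n.+1.-tuple RT] (EFin \o (F \o @trow n.+1)).
  by apply/measurable_EFinP; exact: measurable_trow.
rewrite rintE; congr fine.
exact: (@integral_pushforward _ _ _ _ R _ (@measurable_consT R n)
  (product_measure1 (@lebesgue_measure R) (leb n)) setT _ mF int_phi).
Qed.

Lemma rint_consl : rint F = rint1 (fun x => rint (fun v => F (vcons x v))).
Proof.
rewrite rintEphi -(@integral12_prod_meas1 _ _ _ _ _ _ _ _ int_phi) /rint1 /Rintegral.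
congr fine; apply: eq_integral => x _.
rewrite rintE fineK; last exact: integrable_fin_num (tame_integrable (tame_vcons x)).
by apply: eq_integral => t _; rewrite /phi trow_consT.
Qed.

Lemma rint_consr : rint F = rint (fun v => rint1 (fun x => F (vcons x v))).
Proof.
rewrite rintEphi -(@integral21_prod_meas1 _ _ _ _ _ _ _ _ int_phi) rintE /rint1.
congr fine; apply: eq_integral => t _.
rewrite /Rintegral fineK; last first.
  exact: integrable_fin_num (tame1_integrable (tame1_vcons (trow t))).
by apply: eq_integral => x _; rewrite /phi trow_consT.
Qed.
End slices.
End rint.

(** * Complex exponential and integrals *)

Section complex.
Context (R : realType).
Local Notation C := (Cx R).
Local Notation Re := (@ReC R).
Local Notation Im := (@ImC R).

Lemma ReCE (a b : R) : Re (mkC a b) = a. Proof. by []. Qed.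
Lemma ImCE (a b : R) : Im (mkC a b) = b. Proof. by []. Qed.
Lemma mkC_eta (z : C) : z = mkC (Re z) (Im z). Proof. by case: z. Qed.
Lemma eqCx (z w : C) : Re z = Re w -> Im z = Im w -> z = w.
Proof. by move=> h1 h2; rewrite (mkC_eta z) (mkC_eta w) h1 h2. Qed.
Lemma ReCD (z w : C) : Re (z + w) = Re z + Re w. Proof. by case: z w => [? ?] [? ?]. Qed.
Lemma ImCD (z w : C) : Im (z + w) = Im z + Im w. Proof. by case: z w => [? ?] [? ?]. Qed.
Lemma ReCN (z : C) : Re (- z) = - Re z. Proof. by case: z. Qed.
Lemma ImCN (z : C) : Im (- z) = - Im z. Proof. by case: z. Qed.
Lemma ReCB (z w : C) : Re (z - w) = Re z - Re w. Proof. by rewrite ReCD ReCN. Qed.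
Lemma ImCB (z w : C) : Im (z - w) = Im z - Im w. Proof. by rewrite ImCD ImCN. Qed.
Lemma ReCM (z w : C) : Re (z * w) = Re z * Re w - Im z * Im w.
Proof. by case: z w => [? ?] [? ?]. Qed.
Lemma ImCM (z w : C) : Im (z * w) = Re z * Im w + Im z * Re w.
Proof. by case: z w => [? ?] [? ?]. Qed.
Lemma ReC0 : Re 0 = 0. Proof. by []. Qed.
Lemma ImC0 : Im 0 = 0. Proof. by []. Qed.
Lemma ReC1 : Re 1 = 1. Proof. by []. Qed.
Lemma ImC1 : Im 1 = 0. Proof. by []. Qed.
Definition iC : C := mkC 0 1.
Definition ofR (x : R) : C := mkC x 0.
Definition CE := (ReCE, ImCE, ReCD, ImCD, ReCN, ImCN, ReCM, ImCM, ReC0, ImC0, ReC1, ImC1).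

Lemma ReC_sum (I : Type) (s : seq I) (F : I -> C) :
  Re (\sum_(i <- s) F i) = \sum_(i <- s) Re (F i).
Proof.
by elim: s => [|i s IH]; rewrite ?big_nil ?ReC0// !big_cons ReCD IH.
Qed.
Lemma ImC_sum (I : Type) (s : seq I) (F : I -> C) :
  Im (\sum_(i <- s) F i) = \sum_(i <- s) Im (F i).
Proof.
by elim: s => [|i s IH]; rewrite ?big_nil ?ImC0// !big_cons ImCD IH.
Qed.

Lemma normCE (z : C) : `|z| = ofR (modC z). Proof. by rewrite -modCE. Qed.
Lemma ofR_le (x y : R) : (ofR x <= ofR y) = (x <= y). Proof. exact: lecR. Qed.
Lemma ofR_lt (x y : R) : (ofR x < ofR y) = (x < y). Proof. exact: ltcR. Qed.
Lemma ofRM (x y : R) : ofR (x * y) = ofR x * ofR y.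
Proof. by apply: eqCx; rewrite !CE; ring. Qed.
Lemma ofRD (x y : R) : ofR (x + y) = ofR x + ofR y.
Proof. by apply: eqCx; rewrite !CE; ring. Qed.

Lemma modCN (z : C) : modC (- z) = modC z.
Proof. by rewrite /modC !CE !sqrrN. Qed.
Lemma modCB (z w : C) : modC (z - w) <= modC z + modC w.
Proof. by rewrite -(modCN w) modCD. Qed.
Lemma modC_ofR (x : R) : modC (ofR x) = `|x|.
Proof. by rewrite /modC !CE expr0n addr0 sqrtr_sqr. Qed.
Lemma modC0 : modC (0 : C) = 0.
Proof. by rewrite -[0 in LHS](_ : ofR 0 = 0) // modC_ofR normr0. Qed.
Lemma modC1 : modC (1 : C) = 1.
Proof. by rewrite -[1 in LHS](_ : ofR 1 = 1) // modC_ofR normr1. Qed.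
Lemma modC_i : modC iC = 1.
Proof. by rewrite /modC !CE expr0n add0r expr1n sqrtr1. Qed.
Lemma modCX (z : C) k : modC (z ^+ k) = modC z ^+ k.
Proof. by elim: k => [|k IH]; rewrite ?expr0 ?modC1// !exprS modCM IH. Qed.
Lemma modC_eq0 (z : C) : modC z = 0 -> z = 0.
Proof. by move=> z0; apply/eqP; rewrite -normr_eq0 normCE z0. Qed.
Lemma Re_le (z : C) : `|Re z| <= modC z.
Proof. by rewrite -sqrtr_sqr ler_wsqrtr// lerDl sqr_ge0. Qed.
Lemma Im_le (z : C) : `|Im z| <= modC z.
Proof. by rewrite -sqrtr_sqr ler_wsqrtr// lerDr sqr_ge0. Qed.
Lemma modC_le (z : C) : modC z <= `|Re z| + `|Im z|.
Proof.
rewrite -[leRHS]ger0_norm ?addr_ge0// -sqrtr_sqr ler_wsqrtr// sqrrD.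
rewrite !real_normK ?num_real// mulr2n.
by have := mulr_ge0 (normr_ge0 (Re z)) (normr_ge0 (Im z)); lra.
Qed.
Lemma modC_sum (I : Type) (s : seq I) (F : I -> C) :
  modC (\sum_(i <- s) F i) <= \sum_(i <- s) modC (F i).
Proof.
elim: s => [|i s IH]; rewrite ?big_nil ?modC0// !big_cons.
by apply: le_trans (modCD _ _) _; rewrite lerD2l.
Qed.

Definition cexp (z : C) : C := mkC (expR (Re z) * cos (Im z)) (expR (Re z) * sin (Im z)).

Lemma cexpD (z w : C) : cexp (z + w) = cexp z * cexp w.
Proof.
by apply: eqCx; rewrite /cexp !CE expRD ?cosD ?sinD; ring.
Qed.
Lemma modC_cexp z : modC (cexp z) = expR (Re z).
Proof.
rewrite /modC /cexp !CE !exprMn -mulrDr cos2Dsin2 mulr1 sqrtr_sqr.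
by rewrite ger0_norm ?expR_ge0.
Qed.

Section cexp_taylor.
(** The mean value theorem applied to [u], then to [u1] on [0, c]; since c <= 1 the second increment
    is at most [M]. *)
Lemma taylor2 (u u1 u2 : R -> R) (M : R) :
  (forall s : R, is_derive s 1 u (u1 s)) -> (forall s : R, is_derive s 1 u1 (u2 s)) ->
  (forall s, 0 <= s <= 1 -> `|u2 s| <= M) -> `|u 1 - u 0 - u1 0| <= M.
Proof.
move=> du du1 hM.
have cont (v v1 : R -> R) (a b : R) : (forall s : R, is_derive s 1 v (v1 s)) ->
    {within `[a, b], continuous v}.
  move=> dv; apply: derivable_within_continuous => x _.
  exact: (@ex_derive _ _ _ _ _ _ _ (dv x)).
have [c] := MVT_segment (@ltW _ _ 0 1 ltr01 : 0 <= 1 :> R) (fun x _ => du x) (cont _ _ _ _ du).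
rewrite in_itv /= => /andP[c0 c1] ->.
have [d] := MVT_segment c0 (fun x _ => du1 x) (cont _ _ _ _ du1).
rewrite in_itv /= => /andP[d0 dc]; rewrite !subr0 mulr1 => ->.
rewrite normrM (ger0_norm c0) (le_trans (ler_piMr _ c1))// hM// d0/=.
exact: le_trans c1.
Qed.

(** Second-order Taylor along the segment from 0 to w, for the real and the imaginary part
    separately, whence the 2. Having |Re w| and not |w| in the exponent matters: for the Fourier
    kernel at real points w is purely imaginary and the error is purely quadratic. *)
Lemma cexp_taylor (w : C) :
  modC (cexp w - 1 - w) <= 2 * modC w ^+ 2 * expR `|Re w|.
Proof.
pose a := Re w; pose b := Im w.
pose K := modC w ^+ 2 * expR `|Re w|.
(* [w ^+ 2 * cexp (ofR s * w)] is the second derivative of the exponential along the segment; the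
   two functions [u2] below are its components. *)
have bnd (z : C) s : 0 <= s <= 1 -> z = w ^+ 2 * cexp (ofR s * w) -> modC z <= K.
  move=> /andP[s0 s1] ->; rewrite modCM modCX modC_cexp ler_wpM2l ?sqr_ge0//.
  rewrite ler_expR !CE mul0r subr0 (le_trans (ler_norm _))//.
  by rewrite normrM (ger0_norm s0) ler_piMl.
have hRe : `|Re (cexp w - 1 - w)| <= K.
  pose u s := expR (s * a) * cos (s * b).
  pose u1 s := expR (s * a) * (a * cos (s * b) - b * sin (s * b)).
  pose u2 s := expR (s * a) * ((a ^+ 2 - b ^+ 2) * cos (s * b) - 2 * a * b * sin (s * b)).
  have -> : Re (cexp w - 1 - w) = u 1 - u 0 - u1 0.
    rewrite /cexp !CE /u /u1 !mul1r !mul0r expR0 cos0 sin0 -/a -/b; ring.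
  apply: (@taylor2 u u1 u2).
  - move=> s; apply: is_derive_eq; rewrite /u1 /GRing.scale /=; ring.
  - move=> s; apply: is_derive_eq; rewrite /u2 /GRing.scale /=; ring.
  - move=> s s01; apply: le_trans (bnd _ s s01 (erefl _)).
    apply: le_trans _ (Re_le _); rewrite le_eqVlt; apply/orP; left; apply/eqP.
    congr `|_|; rewrite /cexp expr2 !CE !mul0r !subr0 !addr0 -/a -/b /u2; ring.
have hIm : `|Im (cexp w - 1 - w)| <= K.
  pose u s := expR (s * a) * sin (s * b).
  pose u1 s := expR (s * a) * (a * sin (s * b) + b * cos (s * b)).
  pose u2 s := expR (s * a) * ((a ^+ 2 - b ^+ 2) * sin (s * b) + 2 * a * b * cos (s * b)).
  have -> : Im (cexp w - 1 - w) = u 1 - u 0 - u1 0.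
    rewrite /cexp !CE /u /u1 !mul1r !mul0r expR0 cos0 sin0 -/a -/b; ring.
  apply: (@taylor2 u u1 u2).
  - move=> s; apply: is_derive_eq; rewrite /u1 /GRing.scale /=; ring.
  - move=> s; apply: is_derive_eq; rewrite /u2 /GRing.scale /=; ring.
  - move=> s s01; apply: le_trans (bnd _ s s01 (erefl _)).
    apply: le_trans _ (Im_le _); rewrite le_eqVlt; apply/orP; left; apply/eqP.
    congr `|_|; rewrite /cexp expr2 !CE !mul0r !subr0 !addr0 -/a -/b /u2; ring.
apply: le_trans (modC_le _) _; rewrite -mulrA -/K; lra.
Qed.
End cexp_taylor.
End complex.
Arguments iC {R}.

Section cintegral.
Context (R : realType).
Local Notation C := (Cx R).
Local Notation Re := (@ReC R).
Local Notation Im := (@ImC R).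

Section ccont.
Variable T : topologicalType.
Implicit Types f g : T -> C.

(* Continuity is stated on the two real components because the integral and the
   derivatives are taken componentwise; see [ccont_continuous]. *)
Definition ccont f := continuous (fun x => Re (f x)) /\ continuous (fun x => Im (f x)).

Lemma ccontD f g : ccont f -> ccont g -> ccont (fun x => f x + g x).
Proof.
move=> [f1 f2] [g1 g2]; split; [under eq_fun do rewrite ReCD|under eq_fun do rewrite ImCD];
  exact: contD.
Qed.
Lemma ccontN f : ccont f -> ccont (fun x => - f x).
Proof.
move=> [f1 f2]; split; [under eq_fun do rewrite ReCN|under eq_fun do rewrite ImCN];
  exact: contN.
Qed.
Lemma ccontB f g : ccont f -> ccont g -> ccont (fun x => f x - g x).
Proof. by move=> cf /ccontN; exact: ccontD. Qed.
Lemma ccontM f g : ccont f -> ccont g -> ccont (fun x => f x * g x).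
Proof.
move=> [f1 f2] [g1 g2]; split.
  by under eq_fun do rewrite ReCM; apply: contB; exact: contM.
by under eq_fun do rewrite ImCM; apply: contD; exact: contM.
Qed.
Lemma ccont_cst (c : C) : ccont (fun _ : T => c).
Proof. by split; exact: cont_cst. Qed.
Lemma ccont_cexp f : ccont f -> ccont (fun x => cexp (f x)).
Proof.
move=> [f1 f2]; split; rewrite /cexp /=; apply: contM.
- by apply: (@cont_comp _ _ _ (@expR R)) => //; exact: continuous_expR.
- by apply: (@cont_comp _ _ _ (@cos R)) => //; exact: continuous_cos.
- by apply: (@cont_comp _ _ _ (@expR R)) => //; exact: continuous_expR.
- by apply: (@cont_comp _ _ _ (@sin R)) => //; exact: continuous_sin.
Qed.
Lemma ccont_sum (I : Type) (s : seq I) (F : I -> T -> C) :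
  (forall i, ccont (F i)) -> ccont (fun x => \sum_(i <- s) F i x).
Proof.
move=> cF; elim: s => [|i s IH].
  by under eq_fun do rewrite big_nil; exact: ccont_cst.
by under eq_fun do rewrite big_cons; exact: ccontD.
Qed.
End ccont.

Lemma ccont_comp (T U : topologicalType) (f : U -> C) (g : T -> U) :
  ccont f -> continuous g -> ccont (fun x => f (g x)).
Proof.
move=> [f1 f2] cg; split=> x.
  by apply: (@continuous_comp _ _ _ g (fun y => Re (f y))); [exact: cg|exact: f1].
by apply: (@continuous_comp _ _ _ g (fun y => Im (f y))); [exact: cg|exact: f2].
Qed.

Definition ctame n (F : 'rV[R]_n -> C) :=
  tame (fun x => Re (F x)) /\ tame (fun x => Im (F x)).

Lemma ctameP n (F : 'rV[R]_n -> C) K :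
  ccont F -> (forall x, modC (F x) <= K * weight x) -> ctame F.
Proof.
move=> [c1 c2] hK; split; split=> //; exists K => x.
  exact: le_trans (Re_le _) (hK x).
exact: le_trans (Im_le _) (hK x).
Qed.

Lemma ctame_cont n (F : 'rV[R]_n -> C) : ctame F -> ccont F.
Proof. by move=> [[? _] [? _]]. Qed.

Lemma ctame_bound n (F : 'rV[R]_n -> C) : ctame F ->
  exists K, 0 <= K /\ forall x, modC (F x) <= K * weight x.
Proof.
move=> [[_ [K hK]] [_ [L hL]]]; exists (`|K| + `|L|); split; first by rewrite addr_ge0.
move=> x; apply: le_trans (modC_le _) _; rewrite mulrDl.
have w0 := weight_gt0 x.
apply: lerD; [apply: le_trans (hK x) _|apply: le_trans (hL x) _];
  by rewrite ler_wpM2r ?ler_norm// ltW.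
Qed.

Lemma ctame_lin n (c : C) (F G : 'rV[R]_n -> C) : ctame F -> ctame G ->
  ctame (fun x => c * F x + G x).
Proof.
move=> tF tG; have [K [K0 hK]] := ctame_bound tF; have [L [L0 hL]] := ctame_bound tG.
apply: (@ctameP _ _ (modC c * K + L)).
  apply: ccontD; last exact: ctame_cont.
  by apply: ccontM; [exact: ccont_cst|exact: ctame_cont].
move=> x; apply: le_trans (modCD _ _) _; rewrite mulrDl lerD// modCM -mulrA.
by rewrite ler_wpM2l ?modC_ge0.
Qed.

Lemma ctame0 n : ctame (fun _ : 'rV[R]_n => 0).
Proof. by split; exact: tame0. Qed.

Lemma ctameZ n c (F : 'rV[R]_n -> C) : ctame F -> ctame (fun x => c * F x).
Proof. by move=> tF; have := ctame_lin c tF (ctame0 n); under eq_fun do rewrite addr0. Qed.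

Lemma cintegralE n (F : 'rV[R]_n -> C) :
  cintegral F = mkC (rint (fun x => Re (F x))) (rint (fun x => Im (F x))).
Proof. by []. Qed.

Lemma eq_cintegral n (F G : 'rV[R]_n -> C) : F =1 G -> cintegral F = cintegral G.
Proof. by move=> FG; congr cintegral; apply/funext. Qed.

Lemma cintegral_lin n (c : C) (F G : 'rV[R]_n -> C) : ctame F -> ctame G ->
  cintegral (fun x => c * F x + G x) = c * cintegral F + cintegral G.
Proof.
move=> [F1 F2] [G1 G2].
have lin3 (a b : R) (u v w : 'rV[R]_n -> R) : tame u -> tame v -> tame w ->
    rint (fun x => a * u x + (b * v x + w x)) = a * rint u + (b * rint v + rint w).
  by move=> tu tv tw; rewrite (rint_lin a tu (tame_lin b tv tw)) (rint_lin b tv tw).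
rewrite [LHS]cintegralE (mkC_eta (c * _ + _)); congr mkC.
  rewrite ReCD ReCM !cintegralE !CE -mulNr -addrA -lin3//.
  congr rint; apply/funext => x; by rewrite /= !CE mulNr addrA.
rewrite ImCD ImCM !cintegralE !CE -addrA -lin3//.
congr rint; apply/funext => x; by rewrite /= !CE addrA.
Qed.

Lemma cintegral0 n : cintegral (fun _ : 'rV[R]_n => 0 : C) = 0.
Proof.
rewrite cintegralE [X in mkC X _](_ : _ = 0) ?[X in mkC _ X](_ : _ = 0)//;
  by rewrite rintE integral0_eq.
Qed.

Lemma cintegralZ n (c : C) (F : 'rV[R]_n -> C) : ctame F ->
  cintegral (fun x => c * F x) = c * cintegral F.
Proof.
move=> tF; have := cintegral_lin c tF (ctame0 n).
under eq_cintegral do rewrite addr0.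
by move=> ->; rewrite cintegral0 addr0.
Qed.

Lemma cintegralB n (F G : 'rV[R]_n -> C) : ctame F -> ctame G ->
  cintegral (fun x => F x - G x) = cintegral F - cintegral G.
Proof.
move=> tF tG; have := cintegral_lin (-1) tG tF; rewrite mulN1r addrC => <-.
by apply: eq_cintegral => x; rewrite mulN1r addrC.
Qed.

Lemma cintegral_bound n K (F : 'rV[R]_n -> C) : ccont F ->
  (forall x, modC (F x) <= K * weight x) -> modC (cintegral F) <= 2 * K * pi ^+ n.
Proof.
move=> cF hK; have [tF1 tF2] := ctameP cF hK.
apply: le_trans (modC_le _) _; rewrite cintegralE !CE.
have h1 := rint_bound tF1 (fun x => le_trans (Re_le _) (hK x)).
have h2 := rint_bound tF2 (fun x => le_trans (Im_le _) (hK x)).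
by move: h1 h2; rewrite -!mulrA; lra.
Qed.

Definition cint1 (h : R -> C) : C :=
  mkC (rint1 (fun x => Re (h x))) (rint1 (fun x => Im (h x))).

Definition ctame1 (h : R -> C) :=
  tame1 (fun x => Re (h x)) /\ tame1 (fun x => Im (h x)).

Lemma eq_cint1 (F G : R -> C) : F =1 G -> cint1 F = cint1 G.
Proof. by move=> FG; congr cint1; apply/funext. Qed.

Lemma cintegral_consl n (F : 'rV[R]_n.+1 -> C) : ctame F ->
  cintegral F = cint1 (fun x => cintegral (fun v => F (vcons x v))).
Proof. by move=> [F1 F2]; rewrite cintegralE !rint_consl. Qed.

Lemma cintegral_consr n (F : 'rV[R]_n.+1 -> C) : ctame F ->
  cintegral F = cintegral (fun v => cint1 (fun x => F (vcons x v))).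
Proof. by move=> [F1 F2]; rewrite cintegralE !rint_consr. Qed.

Lemma ctame_vcons n (F : 'rV[R]_n.+1 -> C) x : ctame F -> ctame (fun v => F (vcons x v)).
Proof. by move=> [F1 F2]; split; [exact: tame_vcons F1 _|exact: tame_vcons F2 _]. Qed.

Definition upd n (x : 'rV[R]_n) (i : 'I_n) (s : R) : 'rV[R]_n :=
  \row_j if j == i then s else x 0 j.

Lemma upd_vcons0 n a (v : 'rV[R]_n) s : upd (vcons a v) ord0 s = vcons s v.
Proof.
apply/rowP => j; rewrite mxE; case: (unliftP ord0 j) => [k ->|->].
  by rewrite !vconsS -(inj_eq val_inj).
by rewrite eqxx vcons0.
Qed.

Lemma upd_vconsS n a (v : 'rV[R]_n) i s :
  upd (vcons a v) (lift ord0 i) s = vcons a (upd v i s).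
Proof.
apply/rowP => j; rewrite mxE; case: (unliftP ord0 j) => [k ->|->].
  by rewrite !vconsS mxE (inj_eq lift_inj).
by rewrite !vcons0 -(inj_eq val_inj).
Qed.

(** Fubini in a chosen coordinate: it lifts contour shifts, integration by parts and affine
    substitutions from one variable to n. The first coordinate is integrated innermost when it is
    the chosen one and outermost otherwise, which is why both orders of iterated integration were
    prepared. *)
Lemma cintegral_coord n (F G : 'rV[R]_n -> C) (i : 'I_n) : ctame F -> ctame G ->
  (forall x, cint1 (fun s => F (upd x i s)) = cint1 (fun s => G (upd x i s))) ->
  cintegral F = cintegral G.
Proof.
elim: n F G i => [F G []//|n IH F G i] tF tG FG.
case: (unliftP ord0 i) FG => [j ->|->] FG.
  rewrite (cintegral_consl tF) (cintegral_consl tG); apply: eq_cint1 => a.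
  apply: (IH _ _ j); [exact: ctame_vcons|exact: ctame_vcons|] => x.
  have := FG (vcons a x).
  under eq_cint1 do rewrite upd_vconsS.
  by under [RHS]eq_cint1 do rewrite upd_vconsS.
rewrite (cintegral_consr tF) (cintegral_consr tG); apply: eq_cintegral => v.
have := FG (vcons 0 v).
under eq_cint1 do rewrite upd_vcons0.
by under [RHS]eq_cint1 do rewrite upd_vcons0.
Qed.
End cintegral.

(** * Integrals over the line *)

Section interval.
Context (R : realType).
Local Notation C := (Cx R).
Local Notation mu := (@lebesgue_measure R).

Definition iint (a b : R) (u : R -> R) : R := \int[mu]_(x in `[a, b]) u x.

Lemma cont_integrable (a b : R) (u : R -> R) : continuous u ->
  mu.-integrable `[a, b] (EFin \o u).
Proof.
move=> cu; apply: continuous_compact_integrable; first exact: segment_compact.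
exact: continuous_subspaceT.
Qed.
Arguments cont_integrable {a b u}.

Lemma iint_FTC (a b : R) (U u : R -> R) : a < b -> continuous u ->
  (forall x : R, is_derive x 1 U (u x)) -> iint a b u = U b - U a.
Proof.
move=> ab cu dU.
have cU : continuous U.
  move=> x; apply: differentiable_continuous; apply/derivable1_diffP.
  exact: (@ex_derive _ _ _ _ _ _ _ (dU x)).
rewrite /iint /Rintegral (@continuous_FTC2 _ u U a b)//.
- exact: continuous_subspaceT.
- split.
  + by move=> x _; exact: (@ex_derive _ _ _ _ _ _ _ (dU x)).
  + by apply: cvg_at_right_filter; exact: cU.
  + by apply: cvg_at_left_filter; exact: cU.
- by move=> x _; rewrite derive1E (@derive_val _ _ _ _ _ _ _ (dU x)).
Qed.

Lemma iint_add (a b c : R) u : a <= b -> b <= c -> continuous u ->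
  iint a c u = iint a b u + iint b c u.
Proof.
move=> ab bc cu; rewrite /iint.
have := @Rintegral_itvB R u (BLeft a) (BRight c) b (cont_integrable cu).
rewrite !bnd_simp => /(_ ab bc) /eqP; rewrite subr_eq => /eqP ->.
rewrite addrC; congr (_ + _); rewrite Rintegral_itv_obnd_cbnd//.
apply: integrableS (cont_integrable cu) => //.
by apply: subset_itvr; rewrite bnd_simp.
Qed.

Lemma iint_lin (a b c : R) u v : continuous u -> continuous v ->
  iint a b (fun x => c * u x + v x) = c * iint a b u + iint a b v.
Proof.
move=> cu cv; rewrite /iint RintegralD//; last 2 first.
- apply: cont_integrable; apply: contM => //; exact: cont_cst.
- exact: cont_integrable.
by rewrite RintegralZl//; exact: cont_integrable.
Qed.

Lemma iint_cst (a b c : R) : a <= b -> iint a b (fun=> c) = c * (b - a).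
Proof.
move=> ab; rewrite /iint Rintegral_cst//; congr (_ * _).
have /(congr1 fine) H := @lebesgue_measure_itv R (Interval (BLeft a) (BRight b)).
apply: etrans H _; rewrite /= lte_fin.
move: ab; rewrite le_eqVlt => /predU1P[->|ab]; first by rewrite ltxx subrr.
by rewrite ab.
Qed.

Lemma iint_bound (a b M : R) u : a <= b -> continuous u ->
  (forall x, a <= x <= b -> `|u x| <= M) -> `|iint a b u| <= M * (b - a).
Proof.
move=> ab cu hM; rewrite -iint_cst//.
apply: le_trans (le_normr_Rintegral _ (cont_integrable cu)) _ => //.
apply: le_Rintegral => //.
- by apply: integrable_norm; exact: cont_integrable.
- by apply: cont_integrable; exact: cont_cst.
Qed.

(** Arbitrary endpoints are allowed because an affine substitution turns [-k, k] into an interval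
    that is no longer symmetric. *)
Lemma iint_cvg (h : R -> R) (a b : nat -> R) : tame1 h ->
  a @ \oo --> -oo -> b @ \oo --> +oo ->
  (fun k => iint (a k) (b k) h) @ \oo --> rint1 h.
Proof.
move=> th ca cb; have ih := tame1_integrable th.
pose f_ k (x : R) := (h \_ `[a k, b k]) x.
have mh : measurable_fun setT h by apply: continuous_measurable_fun; have [] := th.
have [] := @dominated_convergence _ _ _ mu setT measurableT
  (fun k => EFin \o f_ k) (EFin \o h) (fun x => `|(h x)%:E|%E).
- move=> k; apply/measurable_EFinP; apply/measurable_restrict => //.
  exact: measurable_funS mh.
- exact/measurable_EFinP.
- apply/nearW => x _; apply: cvg_near_cst.
  have h1 : \forall k \near \oo, a k <= x by move/cvgrNyPle : ca; exact.
  have h2 : \forall k \near \oo, x <= b k by move/cvgryPge : cb; exact.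
  near=> k; rewrite /f_ /= patchT// mem_set//= in_itv/=; apply/andP; split.
    by near: k.
  by near: k.
- exact: integrable_abse.
- apply/nearW => x k _ /=; rewrite lee_fin /f_ patchE; case: ifP => // _.
  by rewrite normr0.
move=> _ _ H.
have -> : (fun k => iint (a k) (b k) h) = fine \o (fun k => \int[mu]_x (f_ k x)%:E)%E.
  by apply/funext => k; rewrite /iint Rintegral_mkcond.
apply: fine_cvg; rewrite /rint1 /Rintegral fineK//; exact: integrable_fin_num ih.
Unshelve. all: by end_near. Qed.

Lemma iint_subst (e c : R) (u : R -> R) (a b : R) : 0 < e -> a <= b -> continuous u ->
  e * iint a b (fun s => u (c + e * s)) = iint (c + e * a) (c + e * b) u.
Proof.
move=> e0 ab cu; pose F (s : R) := c + e * s.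
have dF (s : R) : is_derive s 1 F e.
  by rewrite /F; apply: is_derive_eq; rewrite /GRing.scale /=; ring.
have F' : (F^`())%classic = cst e.
  by apply/funext => s; rewrite derive1E (@derive_val _ _ _ _ _ _ _ (dF s)).
have cF : continuous F.
  by apply: contD; [exact: cont_cst|apply: contM; [exact: cont_cst|move=> x; exact: cvg_id]].
have := @integration_by_substitution_increasing R F u a b ab.
rewrite F' => H; rewrite {2}/iint /Rintegral H.
- rewrite -/(Rintegral _ _ _) /iint -RintegralZl//; last first.
    by apply: cont_integrable; apply: (@cont_comp _ _ _ u F).
  by apply: eq_Rintegral => x _; rewrite mulrC.
- by move=> x y _ _ xy; rewrite /F ltrD2l ltr_pM2l.
- by move=> x _; exact: cvg_cst.
- exact: is_cvg_cst.
- exact: is_cvg_cst.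
- split.
  + by move=> x _; exact: (@ex_derive _ _ _ _ _ _ _ (dF x)).
  + by apply: cvg_at_right_filter; exact: cF.
  + by apply: cvg_at_left_filter; exact: cF.
- exact: continuous_subspaceT.
Qed.

Lemma natSpinfty : (fun k : nat => k%:R : R) @ \oo --> +oo.
Proof. exact: cvgr_idn. Qed.

Lemma natNinfty : (fun k : nat => - (k%:R : R)) @ \oo --> -oo.
Proof.
apply/cvgrNyPle => A; near=> k; rewrite lerNl.
by near: k; have /cvgryPge := natSpinfty; exact.
Unshelve. all: by end_near. Qed.

Lemma rint1_uniq (h : R -> R) l : tame1 h ->
  (fun k : nat => iint (- k%:R) k%:R h) @ \oo --> l -> rint1 h = l.
Proof.
move=> th hl; apply/esym; apply: cvg_unique hl _ => //.
by apply: iint_cvg => //; [exact: natNinfty|exact: natSpinfty].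
Qed.

(** With y = c + e s one has s^2 = (y - c)^2 / e^2 <= (2 y^2 + 2 c^2) / e^2; every other term of the
    expanded product is nonnegative. It makes the integrable class stable under affine
    substitution. *)
Lemma oneDsqrV_subst (e c s : R) : 0 < e ->
  (1 + (c + e * s) ^+ 2)^-1 <= 2 * (1 + c ^+ 2) * (1 + (e ^+ 2)^-1) * (1 + s ^+ 2)^-1.
Proof.
move=> e0; have e20 : 0 < e ^+ 2 by rewrite exprn_gt0.
have d0 : 0 < 1 + (c + e * s) ^+ 2 by rewrite ltr_pwDl ?sqr_ge0.
have s0 : 0 < 1 + s ^+ 2 by rewrite ltr_pwDl ?sqr_ge0.
rewrite ler_pdivlMr// ler_pdivrMl//.
pose y := c + e * s; pose E := (e ^+ 2)^-1.
have E0 : 0 < E by rewrite invr_gt0.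
have -> : s ^+ 2 = E * (y - c) ^+ 2.
  by rewrite /y addrC addKr exprMn mulrA mulVf ?mul1r// lt0r_neq0.
rewrite -/y -/E.
have h1 : (y - c) ^+ 2 <= 2 * y ^+ 2 + 2 * c ^+ 2
  by rewrite -subr_ge0 (_ : _ - _ = (y + c) ^+ 2) ?sqr_ge0//; ring.
have h2 : E * (y - c) ^+ 2 <= E * (2 * y ^+ 2 + 2 * c ^+ 2) by rewrite ler_wpM2l// ltW.
apply: (@le_trans _ _ (1 + E * (2 * y ^+ 2 + 2 * c ^+ 2))); first by rewrite lerD2l.
have h3 : 0 <= y ^+ 2 * c ^+ 2 by rewrite mulr_ge0 ?sqr_ge0.
have h4 := sqr_ge0 y; have h5 := sqr_ge0 c.
have -> : (1 + y ^+ 2) * (2 * (1 + c ^+ 2) * (1 + E)) =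
  (1 + E * (2 * y ^+ 2 + 2 * c ^+ 2)) + (1 + 2 * E + 2 * y ^+ 2 + 2 * c ^+ 2 +
   2 * (y ^+ 2 * c ^+ 2) + 2 * E * (y ^+ 2 * c ^+ 2)) by ring.
have h6 : 0 <= 2 * E * (y ^+ 2 * c ^+ 2) by apply: mulr_ge0 => //; rewrite pmulr_rge0// ltW.
rewrite lerDl; lra.
Qed.

Lemma tame1_subst (e c : R) (u : R -> R) : 0 < e -> tame1 u ->
  tame1 (fun s => u (c + e * s)).
Proof.
move=> e0 [cu [K hK]]; split.
  apply: (@cont_comp _ _ _ u (fun s => c + e * s)) => //.
  by apply: contD; [exact: cont_cst|apply: contM; [exact: cont_cst|move=> x; exact: cvg_id]].
exists (`|K| * (2 * (1 + c ^+ 2) * (1 + (e ^+ 2)^-1))) => s; apply: le_trans (hK _) _.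
apply: (@le_trans _ _ (`|K| * (1 + (c + e * s) ^+ 2)^-1)).
  by rewrite ler_wpM2r ?ler_norm// oneDsqrV_ge0.
by rewrite -[leRHS]mulrA ler_wpM2l// oneDsqrV_subst.
Qed.

Lemma rint1_subst (e c : R) (u : R -> R) : 0 < e -> tame1 u ->
  e * rint1 (fun s => u (c + e * s)) = rint1 u.
Proof.
move=> e0 tu; have tv := tame1_subst c e0 tu.
have h1 := iint_cvg tv natNinfty natSpinfty.
have h2 : (fun k : nat => iint (c + e * - k%:R) (c + e * k%:R) u) @ \oo --> rint1 u.
  have ce : (fun k : nat => c + e * (k%:R : R)) @ \oo --> +oo.
    apply/cvgryPge => A; near=> k; rewrite -lerBlDl -ler_pdivrMl//.
    near: k; have /cvgryPge := natSpinfty; exact.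
  apply: iint_cvg => //.
  apply/cvgrNyPle => A; near=> k; rewrite mulrN lerBlDr -lerBlDl -ler_pdivrMl//.
  near: k; have /cvgryPge := natSpinfty; exact.
apply: cvg_unique h2 => //.
have -> : (fun k : nat => iint (c + e * - k%:R) (c + e * k%:R) u) =
    (fun k : nat => e * iint (- k%:R) k%:R (fun s => u (c + e * s))).
  apply/funext => k; rewrite iint_subst//; first by rewrite ge0_cp.
  by case: tu.
by apply: cvgM => //; exact: cvg_cst.
Unshelve. all: by end_near. Qed.

Lemma oneDsqrV_cvg0 (K : R) : (fun k : nat => K * (1 + (k%:R : R) ^+ 2)^-1) @ \oo --> 0.
Proof.
rewrite -[X in _ --> X](mulr0 K); apply: cvgM; first exact: cvg_cst.
apply/gtr0_cvgV0; first by apply/nearW => k; rewrite ltr_pwDl ?sqr_ge0.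
apply/cvgryPge => A; near=> k.
apply: (@le_trans _ _ k%:R); first by near: k; have /cvgryPge := natSpinfty; exact.
have := sqr_ge0 (k%:R - 1 : R); have : 0 <= k%:R :> R by [].
rewrite sqrrB expr1n mulr1 mulr2n; lra.
Unshelve. all: by end_near. Qed.

(** The fundamental theorem on [-k, k], with boundary values O(1/(1 + k^2)). Applied to a product
    [U], it is integration by parts on the line. *)
Lemma rint1_deriv0 (U u : R -> R) (K : R) : tame1 u ->
  (forall x : R, is_derive x 1 U (u x)) ->
  (forall x, `|U x| <= K * (1 + x ^+ 2)^-1) -> rint1 u = 0.
Proof.
move=> tu dU hK; apply: rint1_uniq => //; apply/cvgr0Pnorm_le => e e0.
near=> k.
have k0 : (0 < k)%N by near: k; exact: nbhs_infty_gt.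
rewrite (iint_FTC (U := U))//; last 2 first.
- by rewrite (@lt_trans _ _ 0)// ?oppr_lt0 ltr0n.
- by case: tu.
apply: le_trans (ler_normB _ _) _.
apply: (@le_trans _ _ ((2 * K) * (1 + k%:R ^+ 2)^-1)).
  have := hK k%:R; have := hK (- k%:R); rewrite sqrrN; lra.
apply: le_trans (ler_norm _) _.
near: k; have /cvgr0Pnorm_le := oneDsqrV_cvg0 (2 * K); exact.
Unshelve. all: by end_near. Qed.
End interval.

(** * Cauchy's theorem on rectangles and contour shift *)

Section goursat.
Context (R : realType).
Local Notation C := (Cx R).
Local Notation Re := (@ReC R).
Local Notation Im := (@ImC R).

Lemma small_dyadic (p d : R) : 0 < d -> exists N, forall k, (N <= k)%N -> p / 2 ^+ k < d.
Proof.
move=> d0; exists (Num.bound `|p / d|) => k Nk.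
rewrite ltr_pdivrMr ?exprn_gt0// mulrC -ltr_pdivrMr//.
apply: le_lt_trans (ler_norm _) _; apply: lt_le_trans (archi_boundP _) _ => //.
rewrite -natrX ler_nat; apply: (leq_trans Nk).
by apply: ltnW; exact: ltn_expl.
Qed.

(** The left ends increase and the right ends [x k + p / 2 ^+ k] decrease, so the supremum of the
    left ends lies in every interval. *)
Lemma nested_point (p : R) (x : nat -> R) :
  (forall k, x k <= x k.+1 <= x k + p / 2 ^+ k.+1) ->
  exists x0, forall k, x k <= x0 <= x k + p / 2 ^+ k.
Proof.
move=> hx.
have x_mono k j : x k <= x (k + j)%N.
  elim: j => [|j IH]; first by rewrite addn0.
  by rewrite addnS; case/andP: (hx (k + j)%N) => + _; exact: le_trans.
have half k : p / 2 ^+ k = p / 2 ^+ k.+1 + p / 2 ^+ k.+1.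
  by rewrite exprS; field; rewrite expf_neq0.
have up_mono k j : x (k + j)%N + p / 2 ^+ (k + j) <= x k + p / 2 ^+ k.
  elim: j => [|j IH]; first by rewrite addn0.
  apply: le_trans IH; rewrite addnS (half (k + j)%N).
  by case/andP: (hx (k + j)%N) => _; rewrite addrA lerD2r.
have p0 k : 0 <= p / 2 ^+ k.
  suff : 0 <= p by move=> ?; rewrite divr_ge0// exprn_ge0.
  have /andP[h1 h2] := hx 0%N; have := le_trans h1 h2.
  by rewrite lerDl pmulr_lge0// invr_gt0 exprn_gt0.
have x_le k j : x j <= x k + p / 2 ^+ k.
  have [kj|/ltnW jk] := leqP k j.
    have h := up_mono k (j - k)%N; rewrite subnKC// in h.
    by apply: le_trans h; rewrite lerDl.
  have h := x_mono j (k - j)%N; rewrite subnKC// in h.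
  by apply: le_trans h _; rewrite lerDl.
exists (sup (range x)) => k; apply/andP; split.
  apply: ub_le_sup; last by exists k.
  by exists (x 0%N + p / 2 ^+ 0) => _ [j _ <-].
by apply: ge_sup; [exists (x 0%N); exists 0%N|move=> _ [j _ <-]].
Qed.

(** Goursat's bisection as an induction principle; [P x y k] speaks of the rectangle with lower left
    corner (x, y) and sides p / 2^k, q / 2^k. If [P] failed at level 0 it would fail on some quarter
    at each level, and these rectangles shrink to a point, against the local hypothesis. *)
Lemma quad_bisect (P : R -> R -> nat -> Prop) (p q : R) : 0 < p -> 0 < q ->
  (forall x y k, P x y k.+1 -> P (x + p / 2 ^+ k.+1) y k.+1 ->
     P x (y + q / 2 ^+ k.+1) k.+1 -> P (x + p / 2 ^+ k.+1) (y + q / 2 ^+ k.+1) k.+1 ->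
     P x y k) ->
  (forall x0 y0, exists N, forall x y k, (N <= k)%N -> x <= x0 <= x + p / 2 ^+ k ->
     y <= y0 <= y + q / 2 ^+ k -> P x y k) ->
  forall x y, P x y 0%N.
Proof.
move=> p0 q0 hquad hloc x y; apply: contrapT => nP.
(* The failure of [P] is kept as a premise under the existential, so that [choice] gives a total map
   from rectangles to quarters. *)
have step (t : R * R * nat) : exists u : R * R, ~ P t.1.1 t.1.2 t.2 ->
    [/\ t.1.1 <= u.1 <= t.1.1 + p / 2 ^+ t.2.+1,
        t.1.2 <= u.2 <= t.1.2 + q / 2 ^+ t.2.+1 & ~ P u.1 u.2 t.2.+1].
  move: t => [[a b] k] /=.
  have pk : 0 <= p / 2 ^+ k.+1 by rewrite divr_ge0 ?ltW ?exprn_gt0.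
  have qk : 0 <= q / 2 ^+ k.+1 by rewrite divr_ge0 ?ltW ?exprn_gt0.
  have [P1|?] := pselect (P a b k.+1); last by exists (a, b); rewrite /= !lexx !lerDl ?pk ?qk.
  have [P2|?] := pselect (P (a + p / 2 ^+ k.+1) b k.+1); last first.
    by exists (a + p / 2 ^+ k.+1, b); rewrite /= !lexx !lerDl ?pk ?qk.
  have [P3|?] := pselect (P a (b + q / 2 ^+ k.+1) k.+1); last first.
    by exists (a, b + q / 2 ^+ k.+1); rewrite /= !lexx !lerDl ?pk ?qk.
  have [P4|?] := pselect (P (a + p / 2 ^+ k.+1) (b + q / 2 ^+ k.+1) k.+1); last first.
    by exists (a + p / 2 ^+ k.+1, b + q / 2 ^+ k.+1); rewrite /= !lexx !lerDl ?pk ?qk.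
  by exists (a, b) => nPk; case: nPk; exact: hquad.
have [f hf] := choice step.
pose s := fix s k : R * R := if k is k'.+1 then f (s k', k') else (x, y).
have sP k : ~ P (s k).1 (s k).2 k.
  by elim: k => [//|k IH] /=; have [] := hf (s k, k) IH.
have [x0 hx0] := @nested_point p (fun k => (s k).1) (fun k => let: And3 h _ _ := hf (s k, k) (sP k) in h).
have [y0 hy0] := @nested_point q (fun k => (s k).2) (fun k => let: And3 _ h _ := hf (s k, k) (sP k) in h).
have [N hN] := hloc x0 y0.
by apply: (sP N); apply: hN.
Qed.

(** Complex differentiability as approximation by an affine map, which is the form consumed by
    Goursat's argument. *)
Definition cdiff (h : C -> C) (z0 : C) := exists c : C, forall e, 0 < e ->
  exists2 d, 0 < d & forall z, modC (z - z0) < d ->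
    modC (h z - h z0 - c * (z - z0)) <= e * modC (z - z0).

Definition cint (a b : R) (u : R -> C) : C :=
  mkC (iint a b (fun x => Re (u x))) (iint a b (fun x => Im (u x))).

Lemma cint_lin a b (c : C) u v : ccont u -> ccont v ->
  cint a b (fun x => c * u x + v x) = c * cint a b u + cint a b v.
Proof.
move=> [u1 u2] [v1 v2].
have lin3 (k l : R) (f g w : R -> R) : continuous f -> continuous g -> continuous w ->
    iint a b (fun x => k * f x + (l * g x + w x)) =
    k * iint a b f + (l * iint a b g + iint a b w).
  move=> cf cg cw; rewrite iint_lin ?iint_lin//.
  by apply: contD => //; apply: contM => //; exact: cont_cst.
rewrite /cint (mkC_eta (c * _ + _)); congr mkC; rewrite !CE -?mulNr -addrA -lin3//;
  congr iint; apply/funext => x; rewrite !CE; ring.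
Qed.

Lemma cint_add a b c u : a <= b -> b <= c -> ccont u ->
  cint a c u = cint a b u + cint b c u.
Proof.
move=> ab bc [u1 u2]; rewrite /cint (iint_add ab bc u1) (iint_add ab bc u2).
by apply: eqCx; rewrite !CE.
Qed.

Lemma cint_bound a b M u : a <= b -> ccont u ->
  (forall x, a <= x <= b -> modC (u x) <= M) -> modC (cint a b u) <= 2 * M * (b - a).
Proof.
move=> ab [u1 u2] hM; apply: le_trans (modC_le _) _; rewrite /cint !CE.
have := iint_bound ab u1 (fun x hx => le_trans (Re_le _) (hM x hx)).
have := iint_bound ab u2 (fun x hx => le_trans (Im_le _) (hM x hx)).
rewrite -!mulrA; lra.
Qed.

Lemma cint_affine a b (c d : C) : a < b ->
  cint a b (fun x => c * ofR x + d) =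
  c * ofR ((b ^+ 2 - a ^+ 2) / 2) + d * ofR (b - a).
Proof.
move=> ab.
have cid : continuous (fun x : R => x) by move=> x; exact: cvg_id.
have e2 : cint a b (fun=> d) = d * ofR (b - a).
  by rewrite /cint !iint_cst ?ltW//; apply: eqCx; rewrite !CE; ring.
rewrite cint_lin; last 2 first.
- by split; [exact: cid|exact: cont_cst].
- exact: ccont_cst.
rewrite e2; congr (_ * _ + _); rewrite /cint /ofR /=.
have -> : iint a b (fun x => x) = (b ^+ 2 - a ^+ 2) / 2.
  have dU (x : R) : is_derive x 1 (fun x : R => x ^+ 2 / 2) x.
    by apply: is_derive_eq; rewrite /GRing.scale /=; field.
  by rewrite (@iint_FTC R a b _ _ ab cid dU) mulrBl.
by rewrite iint_cst ?ltW// mul0r.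
Qed.

(** The counterclockwise integral along the boundary of [a, b] x [c, d]: bottom minus top, plus i
    times right minus left. *)
Definition rect_int (h : C -> C) (a b c d : R) : C :=
  cint a b (fun x => h (mkC x c)) - cint a b (fun x => h (mkC x d))
  + iC * (cint c d (fun y => h (mkC b y)) - cint c d (fun y => h (mkC a y))).

Definition slicewise (h : C -> C) :=
  (forall y, ccont (fun x => h (mkC x y))) /\ (forall x, ccont (fun y => h (mkC x y))).

Lemma rect_int_affine (k l : C) (a b c d : R) : a < b -> c < d ->
  rect_int (fun z => k * z + l) a b c d = 0.
Proof.
move=> ab cd; rewrite /rect_int.
have E1 y : (fun x => k * mkC x y + l) = (fun x => k * ofR x + (k * mkC 0 y + l)).
  by apply/funext => x; apply: eqCx; rewrite !CE; ring.
have E2 x : (fun y => k * mkC x y + l) = (fun y => (k * iC) * ofR y + (k * ofR x + l)).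
  by apply/funext => y; apply: eqCx; rewrite !CE; ring.
rewrite !E1 !E2.
rewrite !cint_affine//; apply: eqCx; rewrite !CE; field => //.
Qed.

Lemma rect_int_lin (c0 : C) (h g : C -> C) (a b c d : R) : slicewise h -> slicewise g ->
  rect_int (fun z => c0 * h z + g z) a b c d =
  c0 * rect_int h a b c d + rect_int g a b c d.
Proof.
by move=> [h1 h2] [g1 g2]; rewrite /rect_int !cint_lin//; ring.
Qed.

Lemma rect_int_bound (h : C -> C) (a b c d M : R) : slicewise h -> a <= b -> c <= d ->
  (forall x y, a <= x <= b -> c <= y <= d -> modC (h (mkC x y)) <= M) ->
  modC (rect_int h a b c d) <= 4 * M * ((b - a) + (d - c)).
Proof.
move=> [h1 h2] ab cd hM; rewrite /rect_int.
have b1 := cint_bound ab (h1 c) (fun x hx => hM x c hx (_ : c <= c <= d)).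
have b2 := cint_bound ab (h1 d) (fun x hx => hM x d hx (_ : c <= d <= d)).
have b3 := cint_bound cd (h2 b) (fun y hy => hM b y (_ : a <= b <= b) hy).
have b4 := cint_bound cd (h2 a) (fun y hy => hM a y (_ : a <= a <= b) hy).
move: b1 b2 b3 b4; rewrite !lexx ab cd => /(_ isT) b1 /(_ isT) b2 /(_ isT) b3 /(_ isT) b4.
apply: le_trans (modCD _ _) _; rewrite modCM modC_i mul1r.
apply: le_trans (lerD (modCB _ _) (modCB _ _)) _; lra.
Qed.

Lemma rect_int_splitx h a m b c d : slicewise h -> a <= m -> m <= b ->
  rect_int h a b c d = rect_int h a m c d + rect_int h m b c d.
Proof.
by move=> [h1 h2] am mb; rewrite /rect_int !(cint_add am mb)//; ring.
Qed.

Lemma rect_int_splity h a b c m d : slicewise h -> c <= m -> m <= d ->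
  rect_int h a b c d = rect_int h a b c m + rect_int h a b m d.
Proof.
by move=> [h1 h2] cm md; rewrite /rect_int !(cint_add cm md)//; ring.
Qed.

Lemma goursat (h : C -> C) (x y p q : R) : slicewise h -> (forall z, cdiff h z) ->
  0 < p -> 0 < q -> rect_int h x (x + p) y (y + q) = 0.
Proof.
move=> sh dh p0 q0; apply: modC_eq0; apply/eqP; rewrite eq_le modC_ge0 andbT.
apply/ler_addgt0Pl => e e0; rewrite addr0.
have pk (k : nat) : 0 < p / 2 ^+ k by rewrite divr_gt0 ?exprn_gt0.
have qk (k : nat) : 0 < q / 2 ^+ k by rewrite divr_gt0 ?exprn_gt0.
(* The allowance is divided by 4 at each level, so that those of the four quarters add up to that of
   the whole. *)
pose P x y k := modC (rect_int h x (x + p / 2 ^+ k) y (y + q / 2 ^+ k)) <= e / 4 ^+ k.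
suff : P x y 0%N by rewrite /P expr0 !divr1.
apply: (@quad_bisect P p q p0 q0) => {x y}.
  move=> x y k; rewrite /P => h1 h2 h3 h4.
  have half (r : R) : r / 2 ^+ k = r / 2 ^+ k.+1 + r / 2 ^+ k.+1.
    by rewrite exprS; field; rewrite expf_neq0.
  have -> : e / 4 ^+ k = e / 4 ^+ k.+1 + e / 4 ^+ k.+1 + (e / 4 ^+ k.+1 + e / 4 ^+ k.+1).
    by rewrite exprS; field; rewrite expf_neq0.
  rewrite (half p) (half q) !addrA.
  have p1 := ltW (pk k.+1); have q1 := ltW (qk k.+1).
  rewrite (@rect_int_splitx _ _ (x + p / 2 ^+ k.+1)) ?lerDl//.
  have sy a b := @rect_int_splity h a b y (y + q / 2 ^+ k.+1)
    (y + q / 2 ^+ k.+1 + q / 2 ^+ k.+1) sh.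
  rewrite (sy x) ?lerDl// (sy (x + p / 2 ^+ k.+1)) ?lerDl// -[X in _ <= X]addrA.
  apply: le_trans (modCD _ _) _; apply: lerD.
    by apply: le_trans (modCD _ _) _; exact: lerD.
  by apply: le_trans (modCD _ _) _; exact: lerD.
move=> x0 y0; have [c hc] := dh (mkC x0 y0).
(* On a rectangle of level k the remainder is at most e/K times (p + q)/2^k, and [rect_int_bound]
   multiplies this by 4 (p + q)/2^k. The product is exactly e / 4^k for this [K]. *)
pose K := 4 * (p + q) ^+ 2.
have K0 : 0 < K by rewrite mulr_gt0// exprn_gt0// addr_gt0.
have [d d0 hd] := hc (e / K) (divr_gt0 e0 K0).
have [N hN] := small_dyadic (p + q) d0.
exists N => x y k Nk /andP[x1 x2] /andP[y1 y2]; rewrite /P.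
pose z0 := mkC x0 y0.
(* The affine approximation at z0 integrates to 0 over the boundary, so it may be subtracted. *)
have -> : rect_int h x (x + p / 2 ^+ k) y (y + q / 2 ^+ k) =
   rect_int (fun z => h z - h z0 - c * (z - z0)) x (x + p / 2 ^+ k) y (y + q / 2 ^+ k).
  have -> : (fun z => h z - h z0 - c * (z - z0)) =
            (fun z => 1 * h z + ((- c) * z + (c * z0 - h z0))).
    by apply/funext => z; ring.
  rewrite rect_int_lin ?rect_int_affine ?ltrDl//; first by ring.
  have cid : continuous (fun x : R => x) by move=> ?; exact: cvg_id.
  split=> u; (apply: ccontD; last exact: ccont_cst); (apply: ccontM; first exact: ccont_cst).
    by split; [exact: cid|exact: cont_cst].
  by split; [exact: cont_cst|exact: cid].
apply: le_trans (rect_int_bound (M := e / K * ((p + q) / 2 ^+ k)) _ _ _ _) _.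
- have [s1 s2] := sh.
  have cid : continuous (fun x : R => x) by move=> ?; exact: cvg_id.
  split=> u; (apply: ccontB; first by (apply: ccontB; last exact: ccont_cst));
    (apply: ccontM; first exact: ccont_cst); (apply: ccontB; last exact: ccont_cst).
    by split; [exact: cid|exact: cont_cst].
  by split; [exact: cont_cst|exact: cid].
- by rewrite lerDl ltW.
- by rewrite lerDl ltW.
- move=> a b /andP[a1 a2] /andP[b1 b2].
  have hz : modC (mkC a b - z0) <= (p + q) / 2 ^+ k.
    apply: le_trans (modC_le _) _; rewrite !CE mulrDl; apply: lerD; rewrite ler_norml; lra.
  apply: le_trans (hd _ (le_lt_trans hz (hN k Nk))) _.
  by rewrite ler_wpM2l// divr_ge0 ?ltW.
rewrite le_eqVlt; apply/orP; left; apply/eqP.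
have -> : (4 : R) ^+ k = 2 ^+ k * 2 ^+ k by rewrite -exprMn; congr (_ ^+ _); ring.
rewrite /K; field; rewrite expf_neq0//= gt_eqF// addr_gt0//.
Qed.

(** Goursat on [-k, k] x [c, d]: the vertical sides have fixed length d - c, and the integrand on
    them is O(1/(1 + k^2)). *)
Lemma contour_shift (h : C -> C) (K c d : R) : slicewise h -> (forall z, cdiff h z) ->
  c < d -> (forall x y, c <= y <= d -> modC (h (mkC x y)) <= K * (1 + x ^+ 2)^-1) ->
  cint1 (fun x => h (mkC x c)) = cint1 (fun x => h (mkC x d)).
Proof.
move=> sh dh cd hK; have [s1 s2] := sh.
have tm y : c <= y <= d -> ctame1 (fun x => h (mkC x y)).
  move=> hy; have [c1 c2] := s1 y; split; split => //; exists K => x.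
    exact: le_trans (Re_le _) (hK _ _ hy).
  exact: le_trans (Im_le _) (hK _ _ hy).
have [tc1 tc2] : ctame1 (fun x => h (mkC x c)) by apply: tm; rewrite lexx ltW.
have [td1 td2] : ctame1 (fun x => h (mkC x d)) by apply: tm; rewrite lexx ltW.
have key (k : nat) : (0 < k)%N -> modC (cint (- k%:R) k%:R (fun x => h (mkC x c))
    - cint (- k%:R) k%:R (fun x => h (mkC x d))) <=
    (4 * K * (d - c)) * (1 + (k%:R : R) ^+ 2)^-1.
  move=> k0; have kR : 0 < k%:R :> R by rewrite ltr0n.
  have := @goursat h (- k%:R) c (k%:R + k%:R) (d - c) sh dh (addr_gt0 kR kR).
  rewrite subr_gt0 => /(_ cd); rewrite addKr addrCA subrr addr0 /rect_int => /eqP.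
  rewrite addr_eq0 => /eqP ->; rewrite modCN modCM modC_i mul1r.
  apply: le_trans (modCB _ _) _.
  have b1 := cint_bound (ltW cd) (s2 k%:R) (hK k%:R).
  have b2 := cint_bound (ltW cd) (s2 (- k%:R)) (hK (- k%:R)).
  move: b1 b2; rewrite sqrrN; lra.
(* The passage to the limit is made once, for a functional [F] that stands for either component. *)
have lim (F : C -> R) (F_iint : forall a b u, F (cint a b u) = iint a b (fun x => F (u x)))
   (FB : forall u v : C, F (u - v) = F u - F v) (Fle : forall u, `|F u| <= modC u) :
   tame1 (fun x => F (h (mkC x c))) -> tame1 (fun x => F (h (mkC x d))) ->
   rint1 (fun x => F (h (mkC x c))) = rint1 (fun x => F (h (mkC x d))).
  move=> t1 t2; apply/eqP; rewrite -subr_eq0; apply/eqP.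
  have l1 := iint_cvg t1 (@natNinfty R) (@natSpinfty R).
  have l2 := iint_cvg t2 (@natNinfty R) (@natSpinfty R).
  have l := cvgB l1 l2.
  suff l0 : (fun k : nat => iint (- k%:R) k%:R (fun x => F (h (mkC x c)))) -
     (fun k : nat => iint (- k%:R) k%:R (fun x => F (h (mkC x d)))) @ \oo --> 0.
    by apply: cvg_unique (l _) l0.
  apply/cvgr0Pnorm_le => e e0; near=> k.
  have k0 : (0 < k)%N by near: k; exact: nbhs_infty_gt.
  rewrite /= !fctE -!F_iint -FB; apply: le_trans (Fle _) _; apply: le_trans (key k k0) _.
  apply: le_trans (ler_norm _) _.
  near: k; have /cvgr0Pnorm_le := oneDsqrV_cvg0 (4 * K * (d - c)); exact.
rewrite /cint1; congr mkC; [apply: (lim Re)|apply: (lim Im)] => //.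
- exact: ReCB.
- exact: Re_le.
- exact: ImCB.
- exact: Im_le.
Unshelve. all: by end_near. Qed.
End goursat.

(** * Componentwise calculus and complex differentiability *)

Section bridge.
Context (R : realType).
Local Notation C := (Cx R).
Local Notation Re := (@ReC R).
Local Notation Im := (@ImC R).

Lemma Cx_pos (e : C) : 0 < e -> exists2 r : R, 0 < r & e = ofR r.
Proof.
move=> e0; exists (modC e).
  by rewrite modC_gt0// lt0r_neq0.
by rewrite -normCE gtr0_norm.
Qed.

(** A quadratic remainder on the unit ball suffices for a Frechet derivative. Both the complex
    exponential and the inverse transform are shown to be differentiable in this way. *)
Lemma differentiable_quad (V : normedModType C) (f : V -> C) (L : {linear V -> C})
  (x : V) (M : C) : continuous L -> 0 < M ->
  (forall h, `|h| <= 1 -> `|f (h + x) - f x - L h| <= M * `|h| ^+ 2) ->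
  differentiable f x.
Proof.
move=> cL M0 hM.
have H : f \o shift x = cst (f x) + L +o_ 0 id.
  apply/eqaddoP => e e0; near=> h.
  have h1 : `|h| <= 1.
    near: h; apply/nbhs_ballP; exists 1 => //= y; rewrite -ball_normE /= sub0r normrN.
    exact: ltW.
  have h2 : `|h| <= e / M.
    near: h; apply/nbhs_ballP; exists (e / M) => /=; first by rewrite divr_gt0.
    move=> y; rewrite -ball_normE /= sub0r normrN; exact: ltW.
  have := hM h h1; rewrite !fctE /= opprD addrA => /le_trans; apply.
  by rewrite expr2 mulrA ler_wpM2r// mulrC -ler_pdivlMr.
by apply/diff_locallyP; rewrite (diff_unique cL H).
Unshelve. all: by end_near. Qed.

Lemma continuous_ReC : continuous Re.
Proof.
move=> z; have Fz : Filter (nbhs z) := nbhs_filter z.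
apply/(@cvgrPdist_lt _ _ _ (nbhs z) Fz) => e e0; apply/nbhs_ballP.
exists (ofR e); first by rewrite /= -[0]/(ofR 0) ofR_lt.
move=> w; rewrite -ball_normE /= normCE ofR_lt => /(le_lt_trans _); apply.
by rewrite -ReCB Re_le.
Qed.

Lemma continuous_ImC : continuous Im.
Proof.
move=> z; have Fz : Filter (nbhs z) := nbhs_filter z.
apply/(@cvgrPdist_lt _ _ _ (nbhs z) Fz) => e e0; apply/nbhs_ballP.
exists (ofR e); first by rewrite /= -[0]/(ofR 0) ofR_lt.
move=> w; rewrite -ball_normE /= normCE ofR_lt => /(le_lt_trans _); apply.
by rewrite -ImCB Im_le.
Qed.

Lemma ccont_continuous (T : topologicalType) (f : T -> C) : ccont f <-> continuous f.
Proof.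
split=> [[f1 f2] x|cf]; last first.
  split=> x; apply: continuous_comp; try exact: cf;
    [exact: continuous_ReC|exact: continuous_ImC].
apply/cvgrPdist_lt => e /Cx_pos[r r0 ->].
have r2 : 0 < r / 2 by rewrite divr_gt0.
have /cvgrPdist_lt /(_ _ r2) n1 := f1 x; have /cvgrPdist_lt /(_ _ r2) n2 := f2 x.
near=> y; rewrite normCE ofR_lt; apply: le_lt_trans (modC_le _) _.
rewrite ReCB ImCB [r]splitr; apply: ltrD; [near: y; exact: n1|near: y; exact: n2].
Unshelve. all: by end_near. Qed.

Lemma differentiable_ccont n (f : 'rV[C]_n -> C) :
  (forall z, differentiable f z) -> ccont f.
Proof. by move=> df; apply/ccont_continuous => z; exact: differentiable_continuous. Qed.

Lemma differentiable_cdiff (g : C -> C) (w : C) : differentiable g w -> cdiff g w.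
Proof.
move=> /derivable1_diffP dg.
have : h^-1 *: (g (h *: (1 : C) + w) - g w) @[h --> 0^'] --> 'D_1 g w by exact: dg.
move=> /cvgrPdist_le H.
exists ('D_1 g w) => e e0.
have e0C : 0 < ofR e by rewrite -[0]/(ofR 0) ofR_lt.
have /nbhs_ballP[d /Cx_pos[r r0 ->] hd] := H _ e0C.
exists r => // z zr; have [->|zw] := eqVneq z w.
  by rewrite !subrr mulr0 subr0 modC0 mulr0.
have zw0 : z - w != 0 by rewrite subr_eq0.
have := hd (z - w); rewrite -ball_normE /= sub0r normrN normCE ofR_lt zr.
move=> /(_ isT zw0); rewrite -[_ *: 1]/(_ * 1) mulr1 subrK.
rewrite -[_ *: _]/(_ * _) normCE ofR_le => h.
have -> : g z - g w - 'D_1 g w * (z - w) =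
    - ('D_1 g w - (z - w)^-1 * (g z - g w)) * (z - w).
  by rewrite opprB mulrBl mulrAC mulVf// mul1r.
by rewrite modCM modCN ler_wpM2r// modC_ge0.
Qed.
End bridge.

(** * Shifting the domain of integration in n variables *)

Section tube.
Context (R : realType) (n : nat).
Local Notation C := (Cx R).
Local Notation Re := (@ReC R).
Local Notation Im := (@ImC R).
Local Notation rV := 'rV[R]_n.
Local Notation cV := 'rV[C]_n.

Definition cpt (u v : rV) : cV := \row_i mkC (u 0 i) (v 0 i).

Lemma realptE (u : rV) : realpt u = cpt u 0.
Proof. by apply/rowP => i; rewrite !mxE. Qed.

Lemma cpt_eta (z : cV) : z = cpt (map_mx Re z) (map_mx Im z).
Proof. by apply/rowP => i; rewrite !mxE -mkC_eta. Qed.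

Lemma cont_crow (T : topologicalType) (g : T -> cV) :
  (forall i, ccont (fun t => g t 0 i)) -> continuous g.
Proof.
move=> cg x; apply: cvg_rowP => i.
by have /ccont_continuous H := cg i; exact: H.
Qed.

Lemma cont_cpt (T : topologicalType) (u v : T -> rV) :
  (forall i, continuous (fun t => u t 0 i)) -> (forall i, continuous (fun t => v t 0 i)) ->
  continuous (fun t => cpt (u t) (v t)).
Proof.
move=> cu cv; apply: cont_crow => i; rewrite /ccont; split.
  by under eq_fun do rewrite mxE; exact: cu.
by under eq_fun do rewrite mxE; exact: cv.
Qed.

(** The class in which the domain of integration may be moved: the integrable majorant in the real
    part is uniform as long as the imaginary part stays bounded. *)
Definition tube (H : cV -> C) := (forall z, differentiable H z) /\
  forall B : R, exists K : R, 0 <= K /\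
    forall u v : rV, (forall i, `|v 0 i| <= B) -> modC (H (cpt u v)) <= K * weight u.

Lemma tube_ctame H v : tube H -> ctame (fun u => H (cpt u v)).
Proof.
move=> [dH bH]; have [K [K0 hK]] := bH (\sum_i `|v 0 i|).
apply: (@ctameP _ _ _ K).
  apply: (ccont_comp (differentiable_ccont dH)); apply: cont_cpt => i.
    exact: continuous_coord.
  exact: cont_cst.
move=> u; apply: hK => i; rewrite (bigD1 i)//= lerDl; exact: sumr_ge0.
Qed.

Lemma weight_upd (x : rV) i s : weight (upd x i s) <= (1 + s ^+ 2)^-1.
Proof.
rewrite /weight (bigD1 i)//= mxE eqxx ler_piMr ?oneDsqrV_ge0//.
apply: prodr_ile1 => j _; rewrite oneDsqrV_ge0 invf_le1 ?ltr_pwDl ?sqr_ge0//.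
by rewrite lerDl sqr_ge0.
Qed.

Lemma upd_id (x : rV) i : upd x i (x 0 i) = x.
Proof. by apply/rowP => j; rewrite mxE; case: eqP => [->|]. Qed.

Lemma shift_coord H v i t : tube H ->
  cintegral (fun u => H (cpt u v)) = cintegral (fun u => H (cpt u (upd v i t))).
Proof.
move=> tH; apply: (cintegral_coord (i := i)); [exact: tube_ctame|exact: tube_ctame|] => x.
have [dH bH] := tH.
(* The i-th coordinate is cleared, so that [h] is the restriction of [H] to a complex line on which
   w is that very coordinate. *)
pose z0 := cpt (upd x i 0) (upd v i 0).
pose h (w : C) := H (w *: delta_mx 0 i + z0).
have hE s y : h (mkC s y) = H (cpt (upd x i s) (upd v i y)).
  congr H; apply/rowP => j; rewrite !mxE eqxx /=.
  by case: eqP => _; rewrite ?mulr1 ?mulr0 ?add0r ?addr0.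
have dh z : cdiff h z.
  apply: differentiable_cdiff; apply: (@differentiable_comp _ _ _ _
    (fun w : C => w *: (delta_mx 0 i : cV) + z0) H); last exact: dH.
  apply: differentiableD; last exact: differentiable_cst.
  by apply: differentiableZl.
have ch := differentiable_ccont dH.
have sh : slicewise h.
  split=> a; under eq_fun do rewrite hE; apply: (ccont_comp ch); apply: cont_cpt => j;
   (under eq_fun do rewrite mxE); case: eqP => _; try exact: cont_cst;
   by move=> ?; exact: cvg_id.
have key c d : c < d -> cint1 (fun s => h (mkC s c)) = cint1 (fun s => h (mkC s d)).
  move=> cd.
  have [K [K0 hK]] := bH (`|c| + `|d| + \sum_i `|v 0 i|).
  apply: (contour_shift (K := K) sh dh cd) => s y /andP[cy yd]; rewrite hE.
  apply: le_trans (hK _ _ _) _; last by rewrite ler_wpM2l// weight_upd.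
  move=> j; rewrite mxE; case: eqP => _.
    apply: (@le_trans _ _ (`|c| + `|d|)); last by rewrite lerDl sumr_ge0.
    have := ler_norm c; have := ler_norm (- c); rewrite normrN.
    have := ler_norm d; have := ler_norm (- d); rewrite normrN => *.
    rewrite ler_norml; apply/andP; split; lra.
  rewrite (bigD1 j)//= addrCA lerDl; apply: addr_ge0; [exact: addr_ge0|exact: sumr_ge0].
transitivity (cint1 (fun s => h (mkC s (v 0 i)))).
  by apply: eq_cint1 => s; rewrite hE upd_id.
transitivity (cint1 (fun s => h (mkC s t))); last by apply: eq_cint1 => s; rewrite hE.
case: (ltgtP (v 0 i) t) => [vt|tv|-> //].
  exact: key vt.
exact/esym/(key _ _ tv).
Qed.

Lemma shift_all H v : tube H ->
  cintegral (fun u => H (cpt u v)) = cintegral (fun u => H (cpt u 0)).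
Proof.
(* [vk k] has its first k coordinates already moved back to 0. *)
move=> tH; pose vk (k : nat) : rV := \row_j if (j < k)%N then 0 else v 0 j.
have step k : (k <= n)%N ->
    cintegral (fun u => H (cpt u v)) = cintegral (fun u => H (cpt u (vk k))).
  elim: k => [_|k IH kn]; first by congr cintegral; apply/funext => u;
    congr (H (cpt _ _)); apply/rowP => j; rewrite mxE.
  rewrite IH ?(ltnW kn)// (shift_coord (vk k) (Ordinal kn) 0 tH).
  congr cintegral; apply/funext => u; congr (H (cpt _ _)); apply/rowP => j.
  rewrite !mxE ltnS [in RHS]leq_eqVlt -val_eqE /=.
  by case: (_ == _ :> nat).
rewrite (step n)//; congr cintegral; apply/funext => u; congr (H (cpt _ _)).
by apply/rowP => j; rewrite !mxE ltn_ord.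
Qed.
End tube.

Section differentiable_cexp.
Context (R : realType).
Local Notation C := (Cx R).

Lemma differentiable_cexp (w : C) : differentiable (@cexp R) w.
Proof.
pose L : {linear C -> C} := [the {linear C -> C} of *:%R (cexp w)].
apply: (@differentiable_quad _ _ _ L w (ofR (expR (ReC w) * (2 * expR 1)))).
- exact: scaler_continuous.
- by rewrite -[0]/(ofR 0) ofR_lt !mulr_gt0 ?expR_gt0.
move=> h; rewrite -[1]/(ofR 1) !normCE -[ofR _ ^+ 2]ofRM -ofRM !ofR_le => h1.
have -> : cexp (h + w) - cexp w - L h = cexp w * (cexp h - 1 - h).
  by rewrite cexpD /L /= -[_ *: _]/(_ * _); ring.
rewrite modCM modC_cexp -mulrA ler_wpM2l ?expR_ge0//.
apply: le_trans (cexp_taylor _) _; rewrite expr2 mulrAC ler_wpM2r ?mulr_ge0 ?modC_ge0//.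
by rewrite ler_wpM2l// ler_expR (le_trans (Re_le _)).
Qed.
End differentiable_cexp.

(** * The Fourier transform of an entire function *)

Section rapid.
Context (R : realType) (n : nat).
Local Notation C := (Cx R).
Local Notation Re := (@ReC R).
Local Notation Im := (@ImC R).
Local Notation rV := 'rV[R]_n.
Local Notation cV := 'rV[C]_n.

Lemma cnorm_ge0 (z : cV) : 0 <= cnorm z. Proof. exact: sqrtr_ge0. Qed.

Lemma cnorm_ge (z : cV) i : modC (z 0 i) <= cnorm z.
Proof.
rewrite -[leLHS]ger0_norm ?modC_ge0// -sqrtr_sqr ler_wsqrtr//.
by rewrite (bigD1 i)//= lerDl sumr_ge0// => j _; exact: sqr_ge0.
Qed.

Lemma cnorm1_gt0 (z : cV) : 0 < 1 + cnorm z.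
Proof. by rewrite ltr_pwDl// cnorm_ge0. Qed.

(** Each factor satisfies 1 + u_i^2 <= (1 + ||z||)^2. Integrability therefore costs 2n orders of
    polynomial decay, the source of every 2n in the seminorm indices. *)
Lemma weight_cnorm (z : cV) (u : rV) : (forall i, `|u 0 i| <= modC (z 0 i)) ->
  ((1 + cnorm z) ^+ (2 * n))^-1 <= weight u.
Proof.
move=> hu; rewrite /weight prodfV lef_pV2 ?posrE ?exprn_gt0 ?cnorm1_gt0//; last first.
  by apply: prodr_gt0 => i _; rewrite ltr_pwDl ?sqr_ge0.
have -> : (1 + cnorm z) ^+ (2 * n) = \prod_(i < n) (1 + cnorm z) ^+ 2.
  by rewrite prodr_const card_ord exprM.
apply: ler_prod => i _; rewrite addr_ge0 ?sqr_ge0//=.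
have h : `|u 0 i| <= cnorm z := le_trans (hu i) (cnorm_ge z i).
have h2 : u 0 i ^+ 2 <= cnorm z ^+ 2.
  by rewrite -[u 0 i ^+ 2]real_normK ?num_real// lerXn2r// nnegrE ?cnorm_ge0.
rewrite sqrrD expr1n mul1r mulr2n; have := cnorm_ge0 z; lra.
Qed.

(** All that the calculus of the transform uses of membership in E(phi). The weight phi is
    forgotten, and the class is stable under multiplication by coordinates and by the kernel. *)
Definition rapid (f : cV -> C) := (forall z, differentiable f z) /\
  forall (B : R) k, exists K : R, 0 <= K /\
    forall z : cV, (forall i, `|Im (z 0 i)| <= B) -> modC (f z) * (1 + cnorm z) ^+ k <= K.

Lemma rapid_tube f : rapid f -> tube f.
Proof.
move=> [df bf]; split=> // B; have [K [K0 hK]] := bf B (2 * n)%N.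
exists K; split=> // u v hv.
have := hK (cpt u v); rewrite -ler_pdivlMr ?exprn_gt0 ?cnorm1_gt0//.
have hI : forall i, `|Im (cpt u v 0 i)| <= B by move=> i; rewrite mxE; exact: hv.
move=> /(_ hI) /le_trans; apply; rewrite ler_wpM2l// weight_cnorm// => i.
by rewrite mxE; exact: Re_le (mkC (u 0 i) (v 0 i)).
Qed.

(** The factor -i z_i is what differentiation in x_i brings down from e^{-i<x,z>}. *)
Definition mulX (i : 'I_n) (f : cV -> C) : cV -> C := fun z => (- iC * z 0 i) * f z.

Lemma differentiable_coordC (i : 'I_n) (z : cV) : differentiable (fun z : cV => z 0 i) z.
Proof. exact: differentiable_coord. Qed.

Lemma rapid_mulX i f : rapid f -> rapid (mulX i f).
Proof.
move=> [df bf]; split=> [z|B k].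
  apply: (@differentiableM _ _ (fun z : cV => - iC * z 0 i) f); last exact: df.
  apply: (@differentiableM _ _ (fun z : cV => - iC) (fun z : cV => z 0 i)).
    exact: differentiable_cst.
  exact: differentiable_coordC.
have [K [K0 hK]] := bf B k.+1; exists K; split=> // z /hK; apply: le_trans.
rewrite /mulX !modCM modCN modC_i mul1r exprS mulrAC [leLHS]mulrC ler_wpM2l ?modC_ge0//.
rewrite ler_wpM2r ?exprn_ge0 ?(ltW (cnorm1_gt0 z))//.
by apply: le_trans (cnorm_ge z i) _; rewrite lerDr.
Qed.

Definition cdot (x : rV) (z : cV) : C := \sum_j ofR (x 0 j) * z 0 j.

Definition kerf (x : rV) (z : cV) : C := cexp (- iC * cdot x z).

Lemma differentiable_cdot x (z : cV) : differentiable (cdot x) z.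
Proof.
have -> : cdot x = \sum_(j < n) (fun z : cV => ofR (x 0 j) * z 0 j).
  by apply/funext => w; rewrite fct_sumE.
apply: differentiable_sum => j.
apply: (@differentiableM _ _ (fun z : cV => ofR (x 0 j)) (fun z : cV => z 0 j)).
  exact: differentiable_cst.
exact: differentiable_coordC.
Qed.

Lemma differentiable_kerf x (z : cV) : differentiable (kerf x) z.
Proof.
apply: (@differentiable_comp _ _ _ _ (fun z => - iC * cdot x z) (@cexp R));
  last exact: differentiable_cexp.
apply: (@differentiableM _ _ (fun z : cV => - iC) (cdot x)).
  exact: differentiable_cst.
exact: differentiable_cdot.
Qed.

Lemma Re_cdot x z : Re (cdot x z) = \sum_j x 0 j * Re (z 0 j).
Proof. by rewrite ReC_sum; apply: eq_bigr => j _; rewrite !CE mul0r subr0. Qed.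

Lemma Im_cdot x z : Im (cdot x z) = \sum_j x 0 j * Im (z 0 j).
Proof. by rewrite ImC_sum; apply: eq_bigr => j _; rewrite !CE mul0r addr0. Qed.

Lemma modC_kerf x z : modC (kerf x z) = expR (\sum_j x 0 j * Im (z 0 j)).
Proof. by rewrite modC_cexp -Im_cdot !CE; congr expR; ring. Qed.

Lemma modC_kerf_cpt x u v : modC (kerf x (cpt u v)) = expR (rdot x v).
Proof.
by rewrite modC_kerf; congr expR; apply: eq_bigr => j _; rewrite mxE.
Qed.

Lemma rapid_ker x f : rapid f -> rapid (fun z => f z * kerf x z).
Proof.
move=> [df bf]; split=> [z|B k].
  by apply: (@differentiableM _ _ f (kerf x)) => //; exact: differentiable_kerf.
have [K [K0 hK]] := bf B k.
exists (K * expR (\sum_j `|x 0 j| * B)); split; first by rewrite mulr_ge0 ?expR_ge0.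
move=> z hz; rewrite modCM mulrAC ler_pM ?mulr_ge0 ?modC_ge0 ?hK//.
  by rewrite exprn_ge0// ltW// cnorm1_gt0.
rewrite modC_kerf ler_expR; apply: ler_sum => j _.
by rewrite (le_trans (ler_norm _))// normrM ler_wpM2l.
Qed.

Lemma fourierE f x : fourier f x = cintegral (fun u => f (cpt u 0) * kerf x (cpt u 0)).
Proof.
rewrite /fourier; congr cintegral; apply/funext => u; rewrite realptE; congr (_ * _).
have h : cdot x (cpt u 0) = ofR (rdot x u).
  apply: eqCx; rewrite ?Re_cdot ?Im_cdot !CE.
    by apply: eq_bigr => j _; rewrite mxE.
  by rewrite big1// => j _; rewrite !mxE mulr0.
rewrite /kerf h /cexp !CE.
have -> : - 0 * rdot x u - - 1 * 0 = 0 :> R by ring.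
by rewrite expR0 !mul1r; have -> : - 0 * 0 + - 1 * rdot x u = - rdot x u by [ring];
  rewrite cosN sinN.
Qed.

Lemma fourier_shift f x v : rapid f ->
  fourier f x = cintegral (fun u => f (cpt u v) * kerf x (cpt u v)).
Proof.
by move=> rf; rewrite fourierE -(shift_all v (rapid_tube (rapid_ker x rf))).
Qed.
End rapid.

Section real_derivative.
Context (R : realType).

Lemma derive_quad (V : normedModType R) (g : V -> R) (x v : V) (l M : R) :
  (forall h : R, `|g (h *: v + x) - g x - h * l| <= M * h ^+ 2) ->
  derivable g x v /\ 'D_v g x = l.
Proof.
move=> hM; suff H : h^-1 *: (g (h *: v + x) - g x) @[h --> 0^'] --> l.
  by split; [apply/cvg_ex; exists l|exact: cvg_lim].
apply/cvgrPdist_le => e e0.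
have M0 : 0 <= M.
  by have := le_trans (normr_ge0 _) (hM 1); rewrite expr1n mulr1.
near=> h.
have h0 : h != 0 by near: h; exact: nbhs_dnbhs_neq.
rewrite -[_ *: _]/(_ * _) -{1}[l](mulKf h0) -mulrBr normrM distrC.
rewrite normfV ler_pdivrMl ?normr_gt0//; apply: le_trans (hM h) _.
rewrite -[h ^+ 2]real_normK ?num_real// expr2 mulrCA ler_wpM2l//.
rewrite (@le_trans _ _ ((M + 1) * `|h|))// ?ler_wpM2r ?lerDl//.
rewrite mulrC -ler_pdivlMr ?ltr_pwDr//.
near: h; apply: cvg_within; apply/nbhs_ballP; exists (e / (M + 1)) => /=.
  by rewrite divr_gt0// ltr_pwDr.
by move=> y; rewrite -ball_normE /= sub0r normrN => /ltW.
Unshelve. all: by end_near. Qed.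
End real_derivative.

Section fourier_calculus.
Context (R : realType) (n : nat).
Local Notation C := (Cx R).
Local Notation Re := (@ReC R).
Local Notation Im := (@ImC R).
Local Notation rV := 'rV[R]_n.
Local Notation cV := 'rV[C]_n.

Lemma ccont_cpt0 (F : cV -> C) : ccont F -> ccont (fun u : rV => F (cpt u 0)).
Proof.
move=> cF; apply: (ccont_comp cF); apply: cont_cpt => i.
  exact: continuous_coord.
exact: cont_cst.
Qed.

(** One constant for all x and all factors [q] of at most quadratic growth: 2n orders of decay pay
    for integrability and 2 for [q]. Continuity and differentiability of the transform are two
    instances, with [q] the first-order and the second-order remainder of the kernel. *)
Lemma rapid_cint_bound f : rapid f -> exists K : R, 0 <= K /\
  forall (x : rV) (q : rV -> C) (A : R), ccont q -> 0 <= A ->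
    (forall u, modC (q u) <= A * (1 + cnorm (cpt u 0)) ^+ 2) ->
    ctame (fun u => f (cpt u 0) * kerf x (cpt u 0) * q u) /\
    modC (cintegral (fun u => f (cpt u 0) * kerf x (cpt u 0) * q u)) <= A * K.
Proof.
move=> [df bf]; have [K [K0 hK]] := bf 0 (2 * n + 2)%N.
exists (2 * K * pi ^+ n); split; first by rewrite !mulr_ge0 ?exprn_ge0 ?pi_ge0.
move=> x q A cq A0 hq.
have bnd u : modC (f (cpt u 0) * kerf x (cpt u 0) * q u) <= A * K * weight u.
  have c0 := cnorm1_gt0 (cpt u 0).
  have e1 : modC (kerf x (cpt u 0)) = 1.
    by rewrite modC_kerf_cpt /rdot big1 ?expR0// => j _; rewrite mxE mulr0.
  rewrite !modCM e1 mulr1.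
  have hw : ((1 + cnorm (cpt u 0)) ^+ (2 * n))^-1 <= weight u.
    by apply: weight_cnorm => i; rewrite mxE; exact: Re_le (mkC (u 0 i) _).
  have hI : forall i, `|Im (cpt u 0 0 i)| <= 0 by move=> i; rewrite !mxE /= normr0.
  have := hK _ hI; rewrite exprD mulrA -ler_pdivlMr ?exprn_gt0//.
  rewrite -ler_pdivlMr ?exprn_gt0// => h.
  apply: le_trans (ler_pM (modC_ge0 _) (modC_ge0 _) h (hq u)) _.
  have -> : K / (1 + cnorm (cpt u 0)) ^+ 2 / (1 + cnorm (cpt u 0)) ^+ (2 * n) *
      (A * (1 + cnorm (cpt u 0)) ^+ 2) = A * K * ((1 + cnorm (cpt u 0)) ^+ (2 * n))^-1.
    by field; rewrite !expf_neq0// gt_eqF.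
  by rewrite ler_wpM2l// mulr_ge0.
have cc : ccont (fun u => f (cpt u 0) * kerf x (cpt u 0) * q u).
  apply: ccontM => //; apply: ccontM; apply: ccont_cpt0; apply: differentiable_ccont => //.
  exact: differentiable_kerf.
split; first exact: ctameP cc bnd.
apply: le_trans (cintegral_bound cc bnd) _; rewrite le_eqVlt; apply/orP; left; apply/eqP; ring.
Qed.

Lemma kerfD x y (z : cV) : kerf (x + y) z = kerf x z * kerf y z.
Proof.
rewrite /kerf -cexpD -mulrDr; congr (cexp (_ * _)); rewrite /cdot -big_split /=.
by apply: eq_bigr => j _; rewrite mxE ofRD mulrDl.
Qed.

Lemma cdot_cpt0 x (u : rV) : cdot x (cpt u 0) = ofR (rdot x u).
Proof.
apply: eqCx; rewrite ?Re_cdot ?Im_cdot !CE.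
  by apply: eq_bigr => j _; rewrite mxE.
by rewrite big1// => j _; rewrite !mxE mulr0.
Qed.

Lemma cnorm_cpt0_ge (u : rV) i : `|u 0 i| <= cnorm (cpt u 0).
Proof.
apply: le_trans (cnorm_ge (cpt u 0) i); rewrite mxE.
exact: Re_le (mkC (u 0 i) _).
Qed.

Lemma fourier_quad f (i : 'I_n) x : rapid f -> exists M : R, forall s : R,
  modC (fourier f (s *: delta_mx 0 i + x) - fourier f x - ofR s * fourier (mulX i f) x)
   <= M * s ^+ 2.
Proof.
move=> rf; have [K [K0 hK]] := rapid_cint_bound rf.
have rX := rapid_mulX i rf.
exists (2 * K) => s.
pose e := s *: (delta_mx 0 i : rV).
have tf y : ctame (fun u => f (cpt u 0) * kerf y (cpt u 0)).
  exact: (tube_ctame 0 (rapid_tube (rapid_ker y rf))).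
have tX y : ctame (fun u => mulX i f (cpt u 0) * kerf y (cpt u 0)).
  exact: (tube_ctame 0 (rapid_tube (rapid_ker y rX))).
have re u : rdot e u = s * u 0 i.
  rewrite /rdot (bigD1 i)//= big1 ?addr0 => [|j ji].
    by rewrite !mxE !eqxx mulr1.
  by rewrite !mxE (negPf ji) andbF mulr0 mul0r.
(* The second-order remainder of the kernel in the direction e_i; its exponent is purely imaginary,
   so [cexp_taylor] gives a bound without exponential growth. *)
pose q u : C := kerf e (cpt u 0) - 1 - (- iC * ofR (s * u 0 i)).
have -> : fourier f (e + x) - fourier f x - ofR s * fourier (mulX i f) x =
    cintegral (fun u => f (cpt u 0) * kerf x (cpt u 0) * q u).
  rewrite !fourierE -cintegralB//.
  rewrite -cintegralZ// -cintegralB//; last 2 first.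
  - by have := ctame_lin (-1) (tf x) (tf (e + x)); under eq_fun do rewrite mulN1r addrC.
  - exact: ctameZ.
  apply: eq_cintegral => u; rewrite /q kerfD /mulX mxE ofRM.
  have -> : mkC (u 0 i) ((0 : rV) 0 i) = ofR (u 0 i) by rewrite mxE.
  ring.
have s0 : 0 <= 2 * s ^+ 2 by rewrite pmulr_rge0// sqr_ge0.
have hq u : modC (q u) <= 2 * s ^+ 2 * (1 + cnorm (cpt u 0)) ^+ 2.
  rewrite /q /kerf cdot_cpt0 re; apply: le_trans (cexp_taylor _) _.
  have -> : Re (- iC * ofR (s * u 0 i)) = 0 by rewrite !CE; ring.
  rewrite normr0 expR0 mulr1 modCM modCN modC_i mul1r modC_ofR normrM exprMn.
  rewrite real_normK ?num_real// mulrA ler_wpM2l//.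
  rewrite lerXn2r ?nnegrE ?(ltW (cnorm1_gt0 _))//.
  by apply: le_trans (cnorm_cpt0_ge u i) _; rewrite lerDr.
have cq : ccont q.
  apply: ccontB; first (apply: ccontB; last exact: ccont_cst).
    by apply: ccont_cpt0; apply: differentiable_ccont; exact: differentiable_kerf.
  apply: ccontM; first exact: ccont_cst.
  split; last exact: cont_cst.
  by apply: contM; [exact: cont_cst|exact: continuous_coord].
have [_] := hK x q (2 * s ^+ 2) cq s0 hq; by rewrite mulrAC.
Qed.

Lemma fourier_partial f (i : 'I_n) : rapid f ->
  [/\ forall x, derivable (fun y => Re (fourier f y)) x (delta_mx 0 i),
      forall x, derivable (fun y => Im (fourier f y)) x (delta_mx 0 i),
      partial i (fun y => Re (fourier f y)) = (fun y => Re (fourier (mulX i f) y)) &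
      partial i (fun y => Im (fourier f y)) = (fun y => Im (fourier (mulX i f) y))].
Proof.
move=> rf.
have h x : (derivable (fun y => Re (fourier f y)) x (delta_mx 0 i) /\
      partial i (fun y => Re (fourier f y)) x = Re (fourier (mulX i f) x)) /\
     (derivable (fun y => Im (fourier f y)) x (delta_mx 0 i) /\
      partial i (fun y => Im (fourier f y)) x = Im (fourier (mulX i f) x)).
  have [M hM] := fourier_quad i x rf.
  split; apply: (derive_quad (M := M)) => s; apply: le_trans (hM s).
    apply: le_trans (Re_le _); rewrite !CE mul0r subr0//.
  apply: le_trans (Im_le _); rewrite !CE mul0r addr0//.
split=> [x|x||].
- exact: (proj1 (proj1 (h x))).
- exact: (proj1 (proj2 (h x))).
- by apply/funext => x; exact: (proj2 (proj1 (h x))).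
by apply/funext => x; exact: (proj2 (proj2 (h x))).
Qed.

Lemma rdot_bound (y u : rV) d : (forall j, `|y 0 j| <= d) ->
  `|rdot y u| <= n%:R * d * cnorm (cpt u 0).
Proof.
move=> hd; apply: le_trans (ler_norm_sum _ _ _) _.
apply: (@le_trans _ _ (\sum_(j < n) d * cnorm (cpt u 0))).
  by apply: ler_sum => j _; rewrite normrM ler_pM ?cnorm_cpt0_ge.
by rewrite sumr_const card_ord -[leLHS]mulr_natl mulrA.
Qed.

Lemma fourier_continuous (f : cV -> C) : rapid f -> ccont (fun x : rV => fourier f x).
Proof.
move=> rf; have [K [K0 hK]] := rapid_cint_bound rf.
(* With t = <y,u> and |t| <= n d ||u||, the linear term of the kernel contributes n and the Taylor
   remainder 2 t^2 contributes 2 n^2; the condition d <= 1 is used to replace d^2 by d. *)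
pose N : R := n%:R + 2 * n%:R ^+ 2.
have N0 : 0 <= N by rewrite addr_ge0// mulr_ge0// sqr_ge0.
have key (x y : rV) (d : R) : 0 <= d -> d <= 1 -> (forall j, `|y 0 j| <= d) ->
    modC (fourier f (y + x) - fourier f x) <= N * K * d.
  move=> d0 d1 hd.
  have tf w : ctame (fun u => f (cpt u 0) * kerf w (cpt u 0)).
    exact: (tube_ctame 0 (rapid_tube (rapid_ker w rf))).
  pose q u : C := kerf y (cpt u 0) - 1.
  have -> : fourier f (y + x) - fourier f x =
      cintegral (fun u => f (cpt u 0) * kerf x (cpt u 0) * q u).
    rewrite !fourierE -cintegralB//; apply: eq_cintegral => u; rewrite /q kerfD; ring.
  have hq u : modC (q u) <= N * d * (1 + cnorm (cpt u 0)) ^+ 2.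
    have c0 := cnorm_ge0 (cpt u 0); have c1 := cnorm1_gt0 (cpt u 0).
    rewrite /q /kerf cdot_cpt0; set t := rdot y u; set w := - iC * ofR t.
    have -> : cexp w - 1 = (cexp w - 1 - w) + w by ring.
    apply: le_trans (modCD _ _) _.
    have mw : modC w = `|t| by rewrite modCM modCN modC_i mul1r modC_ofR.
    have ht : `|t| <= n%:R * d * cnorm (cpt u 0) := rdot_bound u hd.
    apply: le_trans (lerD (cexp_taylor _) (lexx _)) _.
    have -> : Re w = 0 by rewrite !CE; ring.
    rewrite normr0 expR0 mulr1 mw.
    set c := cnorm (cpt u 0) in c0 c1 ht *.
    have e2 : `|t| ^+ 2 <= n%:R ^+ 2 * d * (1 + c) ^+ 2.
      apply: (@le_trans _ _ ((n%:R * d * c) ^+ 2)).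
        by rewrite lerXn2r// nnegrE ?mulr_ge0.
      rewrite !exprMn; apply: ler_pM; rewrite ?mulr_ge0 ?sqr_ge0//.
        by rewrite ler_wpM2l ?sqr_ge0// expr2 ler_piMl.
      by rewrite lerXn2r ?nnegrE// ?(ltW c1)// lerDr.
    have e1 : `|t| <= n%:R * d * (1 + c) ^+ 2.
      apply: le_trans ht _; rewrite ler_wpM2l ?mulr_ge0//.
      rewrite sqrrD expr1n mul1r mulr2n; have := sqr_ge0 c; lra.
    rewrite /N; move: e1 e2; lra.
  have cq : ccont q.
    apply: ccontB; last exact: ccont_cst.
    by apply: ccont_cpt0; apply: differentiable_ccont; exact: differentiable_kerf.
  have [_] := hK x q (N * d) cq (mulr_ge0 N0 d0) hq; by rewrite mulrAC.
have main (F : C -> R) : (forall u v, F (u - v) = F u - F v) -> (forall u, `|F u| <= modC u) ->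
    continuous (fun x => F (fourier f x)).
  move=> FB Fle x; have Fx : Filter (nbhs x) := nbhs_filter x.
  apply/(@cvgrPdist_le _ _ _ (nbhs x) Fx) => e e0.
  pose d := Num.min 1 (e / (N * K + 1)).
  have NK : 0 < N * K + 1 by rewrite ltr_pwDr// mulr_ge0.
  have d0 : 0 < d by rewrite lt_min ltr01 divr_gt0.
  apply/nbhs_ballP; exists d => // y xy.
  have hyx j : `|(y - x) 0 j| <= d.
    have [_ /(_ 0 j)] := xy; rewrite -ball_normE /= !mxE distrC; exact: ltW.
  rewrite distrC -FB; apply: le_trans (Fle _) _.
  rewrite -{1}(subrK x y); apply: le_trans (key _ _ _ (ltW d0) _ hyx) _.
    by rewrite ge_min lexx.
  apply: (@le_trans _ _ ((N * K + 1) * (e / (N * K + 1)))).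
    apply: ler_pM => //; rewrite ?mulr_ge0 ?(ltW d0) ?lerDl//.
    by rewrite ge_min lexx orbT.
  by rewrite mulrCA divff ?mulr1// gt_eqF.
split; [apply: (main Re) => *; rewrite ?ReCB ?Re_le//|apply: (main Im) => *; rewrite ?ImCB ?Im_le//].
Qed.
End fourier_calculus.

(** * The forward estimate *)

Section forward.
Context (R : realType) (n : nat).
Local Notation C := (Cx R).
Local Notation Re := (@ReC R).
Local Notation Im := (@ImC R).
Local Notation rV := 'rV[R]_n.
Local Notation cV := 'rV[C]_n.

Lemma expR_ge_pow (s : R) k : 0 <= s -> s ^+ k / k`!%:R <= expR s.
Proof.
move=> s0; case: k => [|k].
  by rewrite expr0 fact0 divr1 -expR0 ler_expR.
by apply: le_trans (expR_ge1Dxn k s0); rewrite lerDr.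
Qed.

(* Minimizing the bound [N! e^{psi y - N y}] over y >= 0 gives [N! e^{-psi^* N}]. *)
Lemma young_le (g : R -> R) (x A Q : R) : 0 <= Q ->
  (forall y, 0 <= y -> A <= Q * expR (g y - x * y)) ->
  A <= Q * expR (- young g x).
Proof.
move=> Q0 hA; have [A0|A0] := leP A 0.
  by apply: le_trans A0 _; rewrite mulr_ge0 ?expR_ge0.
have Q1 : 0 < Q.
  rewrite lt_neqAle Q0 andbT; apply/eqP => Q00.
  by have := hA 0 (lexx _); rewrite -Q00 mul0r leNgt A0.
have hQA : 0 < Q / A by rewrite divr_gt0.
rewrite expRN -ler_pdivrMr ?invr_gt0 ?expR_gt0// invrK mulrC -ler_pdivlMr//.
rewrite -[leRHS]lnK ?posrE// ler_expR.
apply: ge_sup; first by exists (x * 0 - g 0), 0 => /=.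
move=> _ [y /= y0 <-]; rewrite -ler_expR lnK ?posrE// ler_pdivlMr//.
have := hA y y0; rewrite -opprB expRN -ler_pdivrMr ?expR_gt0//; last first.
  by rewrite invr_gt0 expR_gt0.
by rewrite invrK mulrC.
Qed.

(** The same fold over [enum 'I_n] as in [mderiv], so that factors and derivatives correspond one by
    one. *)
Definition mulXs (a : 'I_n -> nat) (f : cV -> C) : cV -> C :=
  foldr (fun i => iter (a i) (mulX i)) f (enum 'I_n).

Lemma rapid_iter i k (f : cV -> C) : rapid f -> rapid (iter k (mulX i) f).
Proof. by move=> rf; elim: k => [//|k IH] /=; exact: rapid_mulX. Qed.

Lemma rapid_mulXs a (f : cV -> C) : rapid f -> rapid (mulXs a f).
Proof.
by move=> rf; rewrite /mulXs; elim: (enum _) => [//|i s IH] /=; exact: rapid_iter.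
Qed.

Lemma Ck_fourier m (f : cV -> C) : rapid f ->
  Ck m (fun x : rV => Re (fourier f x)) /\ Ck m (fun x : rV => Im (fourier f x)).
Proof.
elim: m f => [|m IH] f rf; first exact: fourier_continuous.
have [c1 c2] := fourier_continuous rf.
split; (split; first by []) => i; have [d1 d2 e1 e2] := fourier_partial i rf.
  by split; [exact: d1|rewrite e1; exact: (proj1 (IH _ (rapid_mulX i rf)))].
by split; [exact: d2|rewrite e2; exact: (proj2 (IH _ (rapid_mulX i rf)))].
Qed.

Lemma mderivC_fourier a (f : cV -> C) (x : rV) : rapid f ->
  mderivC a (fun x => fourier f x) x = fourier (mulXs a f) x.
Proof.
move=> rf.
have it i k (h : cV -> C) : rapid h ->
    iter k (partial i) (fun x : rV => Re (fourier h x)) =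
      (fun x => Re (fourier (iter k (mulX i) h) x)) /\
    iter k (partial i) (fun x : rV => Im (fourier h x)) =
      (fun x => Im (fourier (iter k (mulX i) h) x)).
  move=> rh; elim: k => [//|k [IH1 IH2]] /=.
  by have [_ _ e1 e2] := fourier_partial i (rapid_iter i k rh); rewrite IH1 IH2 e1 e2.
have all (s : seq 'I_n) :
    foldr (fun i => iter (a i) (partial i)) (fun x : rV => Re (fourier f x)) s =
      (fun x => Re (fourier (foldr (fun i => iter (a i) (mulX i)) f s) x)) /\
    foldr (fun i => iter (a i) (partial i)) (fun x : rV => Im (fourier f x)) s =
      (fun x => Im (fourier (foldr (fun i => iter (a i) (mulX i)) f s) x)) /\
    rapid (foldr (fun i => iter (a i) (mulX i)) f s).
  elim: s => [//|i s [IH1 [IH2 rs]]] /=.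
  have [e1 e2] := it i (a i) _ rs.
  by rewrite IH1 IH2 e1 e2; split=> //; split=> //; exact: rapid_iter.
have [e1 [e2 _]] := all (enum 'I_n).
rewrite /mderivC /mderiv [X in mkC (X x) _]e1 [X in mkC _ (X x)]e2.
by rewrite [RHS]mkC_eta.
Qed.

Lemma modC_mulXs a (f : cV -> C) z :
  modC (mulXs a f z) <= (1 + cnorm z) ^+ msize a * modC (f z).
Proof.
have c1 := ltW (cnorm1_gt0 z).
have it i k (h : cV -> C) : modC (iter k (mulX i) h z) <= (1 + cnorm z) ^+ k * modC (h z).
  elim: k => [|k IH]; first by rewrite expr0 mul1r.
  rewrite /= {1}/mulX !modCM modCN modC_i mul1r exprS -mulrA.
  apply: ler_pM; rewrite ?modC_ge0//.
  by apply: le_trans (cnorm_ge z i) _; rewrite lerDr.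
rewrite /mulXs /msize -big_enum/=; elim: (enum _) => [|i s IH] /=.
  by rewrite big_nil expr0 mul1r.
rewrite big_cons exprD -mulrA; apply: le_trans (it _ _ _) _.
by rewrite ler_wpM2l// exprn_ge0.
Qed.

Section weight.
Variable phi : R -> R.
Hypothesis phi_nd : forall x y, 0 <= x -> x <= y -> phi x <= phi y.

Lemma Enorm_ge0 k (f : cV -> C) : E_step phi f -> 0 <= fine (Enorm phi k f).
Proof.
move=> Ef; rewrite -lee_fin fineK ?(Enorm_fin k Ef)//.
apply: (@le_trans _ _ (modC (f 0) * (1 + cnorm (0 : cV)) ^+ k /
    expR (phi (enorm (imvec (0 : cV)))))%:E).
  by rewrite lee_fin !mulr_ge0 ?modC_ge0 ?invr_ge0 ?expR_ge0// exprn_ge0// ltW ?cnorm1_gt0.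
by apply: ereal_sup_ubound; exists 0.
Qed.

Lemma Enorm_bound k (f : cV -> C) (z : cV) : E_step phi f ->
  modC (f z) * (1 + cnorm z) ^+ k <= fine (Enorm phi k f) * expR (phi (enorm (imvec z))).
Proof.
move=> Ef; rewrite -ler_pdivrMr ?expR_gt0// -lee_fin fineK ?(Enorm_fin k Ef)//.
by apply: ereal_sup_ubound; exists z.
Qed.

Lemma E_step_rapid (f : cV -> C) : E_step phi f -> rapid f.
Proof.
move=> Ef; split; first by move=> z; have [df _] := Ef 0%N I; exact: df.
move=> B k; pose r := Num.sqrt (\sum_(i < n) B ^+ 2).
exists (fine (Enorm phi k f) * expR (phi r)); split.
  by rewrite mulr_ge0 ?Enorm_ge0 ?expR_ge0.
move=> z hz; apply: le_trans (Enorm_bound k z Ef) _.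
rewrite ler_wpM2l ?Enorm_ge0// ler_expR phi_nd ?sqrtr_ge0//.
rewrite ler_wsqrtr//; apply: ler_sum => i _; rewrite mxE.
rewrite -[leLHS]real_normK ?num_real// lerXn2r ?nnegrE//.
exact: le_trans (hz i).
Qed.

(** Of the m + 2n powers of 1 + ||z|| in the seminorm, m absorb the monomial coming from the
    derivatives and 2n are traded for the integrable weight. *)
Lemma fourier_bound (f : cV -> C) a m (x : rV) i t : E_step phi f -> (msize a <= m)%N ->
  0 <= t -> modC (fourier (mulXs a f) x) <=
    2 * pi ^+ n * fine (Enorm phi (m + 2 * n) f) * (expR (phi t) * expR (- (t * `|x 0 i|))).
Proof.
move=> Ef am t0; have rf := E_step_rapid Ef.
(* At x_i = 0 the shift still has length t, so [enorm v = t] holds in every case. *)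
pose v : rV := upd 0 i (if 0 <= x 0 i then - t else t).
have rg := rapid_mulXs a rf.
rewrite (fourier_shift x v rg).
have ev : enorm v = t.
  rewrite /enorm (bigD1 i)//= big1 ?addr0 => [|j ji].
    by rewrite mxE eqxx; case: ifP => _; rewrite ?sqrrN sqrtr_sqr ger0_norm.
  by rewrite mxE (negPf ji) mxE expr0n.
have rv : rdot x v = - (t * `|x 0 i|).
  rewrite /rdot (bigD1 i)//= big1 ?addr0 => [|j ji].
    rewrite mxE eqxx; case: (leP 0 (x 0 i)) => x0.
      by rewrite ger0_norm// mulrN mulrC.
    by rewrite ltr0_norm// mulrN opprK mulrC.
  by rewrite mxE (negPf ji) mxE mulr0.
have Iv u : imvec (cpt u v) = v by apply/rowP => j; rewrite !mxE.
set P := fine _; have P0 : 0 <= P := Enorm_ge0 _ Ef.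
have bnd u : modC (mulXs a f (cpt u v) * kerf x (cpt u v)) <=
    P * (expR (phi t) * expR (- (t * `|x 0 i|))) * weight u.
  have c1 := cnorm1_gt0 (cpt u v).
  rewrite modCM modC_kerf_cpt rv mulrA mulrAC ler_wpM2r ?expR_ge0//.
  apply: le_trans (modC_mulXs _ _ _) _.
  apply: (@le_trans _ _ ((1 + cnorm (cpt u v)) ^+ m * modC (f (cpt u v)))).
    by rewrite ler_wpM2r ?modC_ge0// ler_weXn2l// lerDl cnorm_ge0.
  have := Enorm_bound (m + 2 * n) (cpt u v) Ef.
  rewrite -/P Iv ev exprD mulrA -ler_pdivlMr ?exprn_gt0// mulrC => /le_trans; apply.
  rewrite ler_wpM2l ?mulr_ge0 ?expR_ge0// weight_cnorm// => j.
  by rewrite mxE; exact: Re_le (mkC (u 0 j) _).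
have tg := tube_ctame v (rapid_tube (rapid_ker x rg)).
apply: le_trans (cintegral_bound (ctame_cont tg) bnd) _.
by rewrite le_eqVlt; apply/orP; left; apply/eqP; ring.
Qed.
End weight.

Lemma monom_le (x : rV) b i : (forall j, `|x 0 j| <= `|x 0 i|) ->
  `|monom x b| <= `|x 0 i| ^+ msize b.
Proof.
move=> hi; rewrite /monom normr_prod /msize -prodrXr.
apply: ler_prod => j _; rewrite normr_ge0 normrX /=.
by rewrite lerXn2r ?nnegrE.
Qed.

Lemma max_coord (x : rV) : (0 < n)%N -> exists i, forall j, `|x 0 j| <= `|x 0 i|.
Proof.
move=> n0; have i0 : 'I_n by exact: Ordinal n0.
have [i _ hi] := @Order.TotalTheory.arg_maxP _ _ _ i0 xpredT (fun j => `|x 0 j|) isT.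
by exists i => j; exact: hi.
Qed.

(** For the largest coordinate x_i every monomial of degree N is at most |x_i|^N, and the bound by
    one-directional shifts applies. The existence of such a coordinate is where n > 0 enters. *)
Lemma fourier_Gnorm (phi : R -> R) (f : cV -> C) m : (0 < n)%N ->
  (forall x y, 0 <= x -> x <= y -> phi x <= phi y) -> E_step phi f ->
  (Gnorm m (young (psi phi)) (fun x : rV => fourier f x) <=
    (2 * pi ^+ n)%:E * Enorm phi (m + 2 * n) f)%E.
Proof.
move=> n0 phi_nd Ef; have rf := E_step_rapid phi_nd Ef.
rewrite -(fineK (Enorm_fin (m + 2 * n) Ef)) -EFinM.
apply: ge_ereal_sup => _ [x [a [b [am ->]]]]; rewrite lee_fin.
rewrite mderivC_fourier//; set N := msize b.
have [i hi] := max_coord x n0.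
have N0 : 0 < N`!%:R :> R by rewrite ltr0n fact_gt0.
rewrite ler_pdivrMr ?mulr_gt0 ?expR_gt0// mulrA.
set Q := _ * fine _; have Q0 : 0 <= Q.
  by rewrite !mulr_ge0 ?exprn_ge0 ?pi_ge0 ?Enorm_ge0.
apply: young_le; first by rewrite mulr_ge0// ltW.
(* The shift has length t = e^y, so that phi(t) = psi(y) and t^{-N} = e^{-Ny}. *)
move=> y y0; have t0 : 0 < expR y := expR_gt0 y.
have hF := fourier_bound phi_nd x i Ef am (ltW t0).
rewrite -/Q in hF.
apply: (@le_trans _ _ (`|x 0 i| ^+ N * (Q * (expR (psi phi y) * expR (- (expR y * `|x 0 i|)))))).
  by apply: ler_pM => //; [exact: modC_ge0|exact: monom_le].
rewrite [leLHS]mulrCA -[leRHS]mulrA ler_wpM2l// [leLHS]mulrCA expRB [leRHS]mulrCA.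
rewrite ler_wpM2l ?expR_ge0//.
(* A single term of the exponential series gives |x_i|^N e^{-t|x_i|} <= N! t^{-N}. *)
have := @expR_ge_pow (expR y * `|x 0 i|) N; rewrite mulr_ge0 ?(ltW t0)// => /(_ isT) h.
rewrite expRN ler_pdivrMr ?expR_gt0//.
apply: (@le_trans _ _ (N`!%:R / expR y ^+ N * ((expR y * `|x 0 i|) ^+ N / N`!%:R))).
  rewrite exprMn le_eqVlt; apply/orP; left; apply/eqP; field.
  by rewrite !gt_eqF// exprn_gt0.
by rewrite expRM_natl ler_wpM2l// divr_ge0 ?exprn_ge0 ?ltW.
Qed.

Lemma fourier_G_step (phi : R -> R) (f : cV -> C) : (0 < n)%N ->
  (forall x y, 0 <= x -> x <= y -> phi x <= phi y) -> E_step phi f ->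
  G_step (young (psi phi)) (fun x : rV => fourier f x).
Proof.
move=> n0 phi_nd Ef m _; have rf := E_step_rapid phi_nd Ef; split.
  exact: Ck_fourier.
apply: le_lt_trans (fourier_Gnorm m n0 phi_nd Ef) _.
by rewrite -(fineK (Enorm_fin (m + 2 * n) Ef)) -EFinM ltry.
Qed.
End forward.

Lemma coord_le_mx_norm (K : numFieldType) m n (x : 'M[K]_(m, n)) i j : `|x i j| <= `|x|.
Proof.
have h : forall (c : {nonneg K}), `|x i j|%:nng <= c -> `|x i j| <= c%:num by [].
rewrite -[leRHS]/(mx_norm x) mx_normE; apply: h.
exact: (le_bigmax _ (fun ij => `|x ij.1 ij.2|%:nng) (i, j)).
Qed.

(** * The inverse transform *)

Section inverse_transform.
Context (R : realType) (n : nat).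
Local Notation C := (Cx R).
Local Notation Re := (@ReC R).
Local Notation Im := (@ImC R).
Local Notation rV := 'rV[R]_n.
Local Notation cV := 'rV[C]_n.

Definition norm1 (x : rV) : R := \sum_j `|x 0 j|.

Lemma norm1_ge0 (x : rV) : 0 <= norm1 x. Proof. exact: sumr_ge0. Qed.

Lemma norm1_coord (x : rV) j : `|x 0 j| <= norm1 x.
Proof. by rewrite /norm1 (bigD1 j)//= lerDl sumr_ge0. Qed.

(** In each coordinate e^s >= 1 + s^2/2 >= (1 + s^2)/2. The l^1 norm is used because its exponential
    factorizes, as the weight does. *)
Lemma expR_norm1_weight (x : rV) : expR (- norm1 x) <= 2 ^+ n * weight x.
Proof.
have -> : 2 ^+ n * weight x = \prod_(j < n) (2 * (1 + x 0 j ^+ 2)^-1).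
  by rewrite big_split /= prodr_const card_ord.
rewrite /norm1 -sumrN expR_sum; apply: ler_prod => j _; rewrite expR_ge0 /= expRN.
have d0 : 0 < 1 + x 0 j ^+ 2 by rewrite ltr_pwDl ?sqr_ge0.
rewrite -[2]invrK -invfM lef_pV2 ?posrE ?expR_gt0 ?mulr_gt0 ?invr_gt0//.
have := @expR_ge1Dxn R `|x 0 j| 1 (normr_ge0 _).
rewrite real_normK ?num_real//= => h; apply: le_trans h.
have -> : (2`!%:R : R) = 2 by [].
have := sqr_ge0 (x 0 j); lra.
Qed.

Definition invF (g : rV -> C) (z : cV) : C := cintegral (fun x => g x * cexp (iC * cdot x z)).

(** Decay faster than every exponential: exactly what makes the inverse transform converge, and be
    differentiable, at every complex z. *)
Definition expdec (g : rV -> C) := ccont g /\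
  forall B : R, 0 <= B -> exists K : R, 0 <= K /\
    forall x, modC (g x) * expR (B * norm1 x) <= K.

Lemma cdot_Im_bound (x : rV) (z : cV) r : (forall j, `|Im (z 0 j)| <= r) ->
  `|Im (cdot x z)| <= r * norm1 x.
Proof.
move=> hr; rewrite Im_cdot /norm1 mulr_sumr; apply: le_trans (ler_norm_sum _ _ _) _.
by apply: ler_sum => j _; rewrite normrM mulrC ler_wpM2r.
Qed.

Lemma modC_cexp_cdot (x : rV) (z : cV) r : (forall j, `|Im (z 0 j)| <= r) ->
  modC (cexp (iC * cdot x z)) <= expR (r * norm1 x).
Proof.
move=> hr; rewrite modC_cexp ler_expR !CE mul0r mul1r sub0r.
by apply: le_trans (cdot_Im_bound x hr); rewrite -normrN ler_norm.
Qed.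

Lemma ccont_cdot_x (z : cV) : ccont (fun x : rV => cdot x z).
Proof.
apply: ccont_sum => j; apply: ccontM; last exact: ccont_cst.
by split; [exact: continuous_coord|exact: cont_cst].
Qed.

Lemma ccont_cexp_cdot (z : cV) : ccont (fun x : rV => cexp (iC * cdot x z)).
Proof.
apply: ccont_cexp; apply: ccontM; [exact: ccont_cst|exact: ccont_cdot_x].
Qed.

Lemma expdec_ctame (F : rV -> C) K : 0 <= K -> ccont F ->
  (forall x, modC (F x) * expR (norm1 x) <= K) ->
  ctame F /\ modC (cintegral F) <= 2 * (K * 2 ^+ n) * pi ^+ n.
Proof.
move=> K0 cF hK.
have bnd x : modC (F x) <= K * 2 ^+ n * weight x.
  have := hK x; rewrite -ler_pdivlMr ?expR_gt0// -expRN => /le_trans; apply.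
  by rewrite -mulrA ler_wpM2l// expR_norm1_weight.
by split; [exact: ctameP cF bnd|exact: cintegral_bound].
Qed.

(** Of the rate r + 1, r compensates the growth of e^{i<x,z>} and 1 is left for integrability. *)
Lemma invF_bound (g : rV -> C) (z : cV) K r : ccont g -> 0 <= K ->
  (forall j, `|Im (z 0 j)| <= r) ->
  (forall x, modC (g x) * expR ((r + 1) * norm1 x) <= K) ->
  ctame (fun x => g x * cexp (iC * cdot x z)) /\
  modC (invF g z) <= 2 * (K * 2 ^+ n) * pi ^+ n.
Proof.
move=> cg K0 hr hK; apply: expdec_ctame => //.
  by apply: ccontM => //; exact: ccont_cexp_cdot.
move=> x; apply: le_trans (hK x); rewrite modCM -mulrA ler_wpM2l ?modC_ge0//.
by rewrite mulrDl mul1r expRD ler_wpM2r ?expR_ge0// modC_cexp_cdot.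
Qed.

Lemma Im_bound_ex (z : cV) : exists r : R, 0 <= r /\ forall j, `|Im (z 0 j)| <= r.
Proof.
exists (\sum_j `|Im (z 0 j)|); split; first exact: sumr_ge0.
by move=> j; rewrite (bigD1 j)//= lerDl sumr_ge0.
Qed.

Lemma invF_ctame (g : rV -> C) (z : cV) : expdec g ->
  ctame (fun x => g x * cexp (iC * cdot x z)).
Proof.
move=> [cg dg]; have [r [r0 hr]] := Im_bound_ex z.
have [K [K0 hK]] := dg _ (addr_ge0 r0 ler01).
by have [] := invF_bound cg K0 hr hK.
Qed.

Lemma norm1_expR (x : rV) : norm1 x ^+ 2 <= 2 * expR (norm1 x).
Proof.
have := @expR_ge1Dxn R (norm1 x) 1 (norm1_ge0 x).
have -> : (2`!%:R : R) = 2 by [].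
lra.
Qed.

Lemma expdec_coord (g : rV -> C) i : expdec g -> expdec (fun x => g x * (iC * ofR (x 0 i))).
Proof.
move=> [cg dg]; split.
  apply: ccontM => //; apply: ccontM; first exact: ccont_cst.
  by split; [exact: continuous_coord|exact: cont_cst].
move=> B B0; have [K [K0 hK]] := dg _ (addr_ge0 B0 ler01); exists K; split=> // x.
apply: le_trans (hK x); rewrite !modCM modC_i mul1r modC_ofR -mulrA.
rewrite ler_wpM2l ?modC_ge0// mulrDl mul1r expRD mulrC ler_wpM2l ?expR_ge0//.
apply: le_trans (norm1_coord x i) _; apply: le_trans (expR_ge1Dx _); rewrite lerDr//.
Qed.

Lemma invF_differentiable (g : rV -> C) (z : cV) : expdec g -> differentiable (invF g) z.
Proof.
move=> eg; have [cg dg] := eg.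
(* The candidate differential comes from differentiating under the integral sign. *)
pose l j : C := invF (fun x => g x * (iC * ofR (x 0 j))) z.
pose L0 (h : cV) : C := \sum_j h 0 j * l j.
have lin : linear L0.
  move=> a u v; rewrite /L0 scaler_sumr -big_split /=; apply: eq_bigr => j _.
  by rewrite !mxE -[_ *: (_ * _)]/(_ * (_ * _)) mulrDl mulrA.
pose LM := GRing.isLinear.Build _ _ _ _ _ lin.
pose L : {linear cV -> C} := HB.pack L0 LM.
have cL : continuous L.
  apply/ccont_continuous; apply: ccont_sum => j; apply: ccontM; last exact: ccont_cst.
  apply/ccont_continuous; exact: coord_continuous.
have [r [r0 hr]] := Im_bound_ex z.
(* Besides r for the kernel, one unit of exponential decay pays for the squared l^1 norm, one for
   the factor e^{|Re w|} of the Taylor remainder, and one for integrability. *)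
have r3 : 0 <= r + 3 by rewrite addr_ge0.
have [K [K0 hK]] := dg _ r3.
(* The 4 is the 2 of [cexp_taylor] times the 2 of [norm1_expR]; adding 1 makes [M] strictly
   positive. *)
pose M : R := 2 * ((4 * K) * 2 ^+ n) * pi ^+ n + 1.
have M0 : 0 < M by rewrite ltr_wpDl// !mulr_ge0 ?exprn_ge0 ?pi_ge0.
apply: (@differentiable_quad _ _ _ L z (ofR M)) => //.
  by rewrite -[0]/(ofR 0) ofR_lt.
move=> h h1.
have [d d0 hd] : exists2 d : R, 0 <= d & `|h| = ofR d.
  have [h0|h0] := eqVneq h 0; first by exists 0; rewrite // h0 normr0.
  have /Cx_pos[d d0 ->] : 0 < `|h| by rewrite normr_gt0.
  by exists d => //; exact: ltW.
rewrite hd normCE -[ofR d ^+ 2]ofRM -ofRM ofR_le.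
have d1 : d <= 1 by rewrite -ofR_le -hd.
have hj j : modC (h 0 j) <= d by rewrite -ofR_le -normCE -hd coord_le_mx_norm.
pose w x := iC * cdot x h.
have tg y : ctame (fun x => g x * cexp (iC * cdot x y)) by exact: invF_ctame.
have LE : L0 h = cintegral (fun x => g x * cexp (iC * cdot x z) * w x).
  have tl j : ctame (fun x => g x * (iC * ofR (x 0 j)) * cexp (iC * cdot x z)).
    exact: (invF_ctame z (expdec_coord j eg)).
  have -> : (fun x => g x * cexp (iC * cdot x z) * w x) =
     (fun x => \sum_(j <- enum 'I_n) h 0 j * (g x * (iC * ofR (x 0 j)) * cexp (iC * cdot x z))).
    apply/funext => x; rewrite /w big_enum /= /cdot !mulr_sumr; apply: eq_bigr => j _.
    by rewrite -/(cdot x z); ring.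
  have : ctame (fun x => \sum_(j <- enum 'I_n) h 0 j * (g x * (iC * ofR (x 0 j)) * cexp (iC * cdot x z)))
   /\ cintegral (fun x => \sum_(j <- enum 'I_n) h 0 j * (g x * (iC * ofR (x 0 j)) * cexp (iC * cdot x z)))
      = \sum_(j <- enum 'I_n) h 0 j * l j.
    elim: (enum 'I_n) => [|j s [IH1 IH2]].
      under eq_fun do rewrite big_nil; rewrite big_nil; split; first exact: ctame0.
      exact: cintegral0.
    under eq_fun do rewrite big_cons; rewrite big_cons; split; first exact: ctame_lin.
    by rewrite (cintegral_lin _ (tl j) IH1) IH2.
  by move=> [_ ->]; rewrite big_enum.
have -> : invF g (h + z) - invF g z - L h =
    cintegral (fun x => g x * cexp (iC * cdot x z) * (cexp (w x) - 1 - w x)).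
  have tw : ctame (fun x => g x * cexp (iC * cdot x z) * w x).
    have -> : (fun x => g x * cexp (iC * cdot x z) * w x) =
       (fun x => \sum_(j <- enum 'I_n) h 0 j * (g x * (iC * ofR (x 0 j)) * cexp (iC * cdot x z))).
      apply/funext => x; rewrite /w big_enum /= /cdot !mulr_sumr; apply: eq_bigr => j _.
      by rewrite -/(cdot x z); ring.
    elim: (enum 'I_n) => [|j s IH].
      by under eq_fun do rewrite big_nil; exact: ctame0.
    under eq_fun do rewrite big_cons; apply: ctame_lin IH.
    exact: (invF_ctame z (expdec_coord j eg)).
  rewrite -[L h]/(L0 h) LE /invF -cintegralB// -cintegralB//; last first.
    by have := ctame_lin (-1) (tg z) (tg (h + z)); under eq_fun do rewrite mulN1r addrC.
  apply: eq_cintegral => x.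
  have -> : cdot x (h + z) = cdot x h + cdot x z.
    by rewrite /cdot -big_split; apply: eq_bigr => j _; rewrite mxE mulrDr.
  rewrite mulrDr cexpD -/(w x); ring.
have cw : ccont w by apply: ccontM; [exact: ccont_cst|exact: ccont_cdot_x].
have mw x : modC (w x) <= d * norm1 x.
  rewrite /w modCM modC_i mul1r; apply: le_trans (modC_sum _ _) _.
  rewrite /norm1 mulr_sumr; apply: ler_sum => j _.
  by rewrite modCM modC_ofR mulrC ler_wpM2r.
pose Fq x := g x * cexp (iC * cdot x z) * (cexp (w x) - 1 - w x).
have q1 : 0 <= 4 * K * d ^+ 2 by rewrite mulr_ge0 ?sqr_ge0// mulr_ge0.
have q2 : ccont Fq.
  apply: ccontM.
    by apply: ccontM => //; exact: ccont_cexp_cdot.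
  apply: ccontB => //; apply: ccontB; last exact: ccont_cst.
  exact: ccont_cexp.
have q3 x : modC (Fq x) * expR (norm1 x) <= 4 * K * d ^+ 2.
  rewrite /Fq !modCM.
  have e1 := modC_cexp_cdot x hr; have S0 := norm1_ge0 x.
  have e2 : modC (cexp (w x) - 1 - w x) <= 4 * d ^+ 2 * expR (2 * norm1 x).
    apply: le_trans (cexp_taylor _) _.
    have a1 : modC (w x) ^+ 2 <= d ^+ 2 * (2 * expR (norm1 x)).
      apply: (@le_trans _ _ ((d * norm1 x) ^+ 2)).
        by rewrite lerXn2r// nnegrE ?modC_ge0 ?mulr_ge0.
      by rewrite exprMn ler_wpM2l ?sqr_ge0// norm1_expR.
    have a2 : expR `|Re (w x)| <= expR (norm1 x).
      rewrite ler_expR; apply: le_trans (Re_le _) _; apply: le_trans (mw x) _.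
      by rewrite ler_piMl.
    apply: (@le_trans _ _ (2 * (d ^+ 2 * (2 * expR (norm1 x))) * expR (norm1 x))).
      have p1 : 0 <= 2 * modC (w x) ^+ 2 by rewrite pmulr_rge0// sqr_ge0.
      by apply: ler_pM => //; rewrite ?expR_ge0 ?ler_wpM2l.
    have -> : 2 * norm1 x = norm1 x + norm1 x by ring.
    rewrite expRD le_eqVlt; apply/orP; left; apply/eqP; ring.
  apply: (@le_trans _ _ (modC (g x) * expR (r * norm1 x) *
     (4 * d ^+ 2 * expR (2 * norm1 x)) * expR (norm1 x))).
    rewrite ler_wpM2r ?expR_ge0//; apply: ler_pM; rewrite ?mulr_ge0 ?modC_ge0//.
    by rewrite ler_wpM2l ?modC_ge0.
  have -> : modC (g x) * expR (r * norm1 x) * (4 * d ^+ 2 * expR (2 * norm1 x)) *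
     expR (norm1 x) = 4 * d ^+ 2 * (modC (g x) * expR ((r + 3) * norm1 x)).
    have -> : (r + 3) * norm1 x = r * norm1 x + 2 * norm1 x + norm1 x by ring.
    rewrite !expRD; ring.
  by rewrite [leRHS]mulrAC ler_wpM2l ?mulr_ge0 ?sqr_ge0.
have [_] := expdec_ctame q1 q2 q3.
move/le_trans; apply.
have -> : 2 * (4 * K * d ^+ 2 * 2 ^+ n) * pi ^+ n = (M - 1) * (d * d) by rewrite /M expr2; ring.
by rewrite ler_wpM2r ?mulr_ge0// gerBl.
Qed.
End inverse_transform.

(** * Fourier inversion *)

Section convergence.
Context (R : realType).
Local Notation RT := (measurableTypeR R).
Local Notation leb n := (@lebesgue_tuple R n).

Lemma rint_cvg n (F_ : nat -> 'rV[R]_n -> R) (F : 'rV[R]_n -> R) K :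
  (forall k, continuous (F_ k)) -> continuous F ->
  (forall k x, `|F_ k x| <= K * weight x) ->
  (forall x, (fun k => F_ k x) @ \oo --> F x) ->
  (fun k => rint (F_ k)) @ \oo --> rint F.
Proof.
move=> cF_ cF hK hF.
have tF : tame F.
  split=> //; exists K => x.
  have h : (fun k => `|F_ k x|) @ \oo --> `|F x| by apply: cvg_norm; exact: hF.
  rewrite -(cvg_lim _ h)//; apply: limr_le; first by apply/cvg_ex; exists `|F x|.
  by apply: nearW => k; exact: hK.
have tKw : tame (fun x : 'rV[R]_n => K * weight x).
  by have := tame_lin K (tame_weight R n) (tame0 R n); under eq_fun do rewrite addr0.
have [] := @dominated_convergence _ _ _ (leb n) setT measurableT
  (fun k => EFin \o (F_ k \o @trow R n)) (EFin \o (F \o @trow R n))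
  (EFin \o ((fun x => K * weight x) \o @trow R n)).
- by move=> k; apply/measurable_EFinP; exact: measurable_trow.
- by apply/measurable_EFinP; exact: measurable_trow.
- by apply/nearW => t _; apply: cvg_EFin; [exact: nearW|exact: hF].
- exact: tame_integrable tKw.
- by apply/nearW => t k _ /=; rewrite lee_fin; exact: hK.
move=> _ _ H.
apply: fine_cvg; rewrite fineK//; exact: integrable_fin_num (tame_integrable tF).
Qed.

(** Joint continuity is stated on rows of length n + n, so that measurability on pairs of tuples
    reduces to [measurable_trow] by concatenation. *)
Lemma rint_fubini n (H : 'rV[R]_n -> 'rV[R]_n -> R) K :
  continuous (fun v : 'rV[R]_(n + n) => H (lsubmx v) (rsubmx v)) ->
  (forall x t, `|H x t| <= K * (weight x * weight t)) ->
  rint (fun x => rint (fun t => H x t)) = rint (fun t => rint (fun x => H x t)).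
Proof.
move=> cH hK.
have K0 : 0 <= K.
  have := le_trans (normr_ge0 _) (hK 0 0); rewrite pmulr_lge0// mulr_gt0 ?weight_gt0//.
pose T := (n.-tuple RT * n.-tuple RT)%type.
pose H' (p : T) := H (trow p.1) (trow p.2).
have mH : measurable_fun [set: T] H'.
  pose cat (p : T) : (n + n).-tuple RT :=
    [tuple (row_mx (trow p.1) (trow p.2)) 0 i | i < n + n].
  have -> : H' = ((fun v => H (lsubmx v) (rsubmx v)) \o @trow R (n + n)) \o cat.
    apply/funext => p /=.
    have -> : trow (cat p) = row_mx (trow p.1) (trow p.2).
      by apply/rowP => i; rewrite mxE tnth_mktuple.
    by rewrite row_mxKl row_mxKr.
  apply: (measurableT_comp (measurable_trow cH)).
  apply/measurable_fun_tnthP => i; rewrite /comp /cat.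
  under eq_fun do rewrite tnth_mktuple.
  case: (split_ordP i) => j ->.
    under eq_fun do rewrite row_mxEl mxE.
    by apply: (@measurableT_comp _ _ _ _ _ _ (fun t : n.-tuple RT => tnth t j));
      [exact: measurable_tnth|exact: measurable_fst].
  under eq_fun do rewrite row_mxEr mxE.
  by apply: (@measurableT_comp _ _ _ _ _ _ (fun t : n.-tuple RT => tnth t j));
    [exact: measurable_tnth|exact: measurable_snd].
have mEH : measurable_fun [set: T] (EFin \o H') by exact/measurable_EFinP.
have iH : (product_measure1 (leb n) (leb n)).-integrable [set: T] (EFin \o H').
  apply/integrable12ltyP => //.
  apply: (@le_lt_trans _ _ (\int[leb n]_t ((K * pi ^+ n) * weight (trow t))%:E)%E); last first.
    have tKw : tame (fun x : 'rV[R]_n => (K * pi ^+ n) * weight x).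
      by have := tame_lin (K * pi ^+ n) (tame_weight R n) (tame0 R n);
        under eq_fun do rewrite addr0.
    by have := integrable_fin_num measurableT (tame_integrable tKw);
      rewrite fin_numElt => /andP[].
  apply: ge0_le_integral => //.
  - by move=> t _; apply: integral_ge0 => s _.
  - apply: (measurable_fun_fubini_tonelli_F (m2 := leb n) (fun p => `|(EFin \o H') p|%E)) => //.
    exact: measurableT_comp.
  - apply/measurable_EFinP; apply: measurable_funM => //.
    apply: measurable_trow; exact: continuous_weight.
  - move=> t _.
    rewrite mulrAC EFinM -integral_weight -ge0_integralZl_EFin//; last 3 first.
    + by move=> s _; rewrite lee_fin ltW ?weight_gt0.
    + by apply/measurable_EFinP; apply: measurable_trow; exact: continuous_weight.
    + by rewrite mulr_ge0// ltW// weight_gt0.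
    apply: ge0_le_integral => //.
    + apply: measurableT_comp => //.
      exact: (measurableT_comp mEH (measurable_pair1 _)).
    + under eq_fun do rewrite -EFinM.
      apply/measurable_EFinP; apply: measurable_funM => //.
      apply: measurable_trow; exact: continuous_weight.
    + by move=> s _ /=; rewrite -EFinM lee_fin -mulrA; exact: hK.
have tx x : tame (fun t => H x t).
  split; last by exists (K * weight x) => t; rewrite -mulrA; exact: hK.
  have -> : (fun t => H x t) = (fun t => (fun v => H (lsubmx v) (rsubmx v)) (row_mx x t)).
    by apply/funext => t; rewrite row_mxKl row_mxKr.
  have c1 : continuous (fun t : 'rV[R]_n => row_mx x t).
    apply: cont_row => i; case: (split_ordP i) => j ->.
      by under eq_fun do rewrite row_mxEl; exact: cont_cst.
    by under eq_fun do rewrite row_mxEr; exact: continuous_coord.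
  by move=> t; exact: (@continuous_comp _ _ _ (fun t => row_mx x t)
    (fun v => H (lsubmx v) (rsubmx v)) t (c1 t) (cH _)).
have tt t : tame (fun x => H x t).
  split; last by exists (K * weight t) => x; rewrite -mulrA [weight t * _]mulrC; exact: hK.
  have -> : (fun x => H x t) = (fun x => (fun v => H (lsubmx v) (rsubmx v)) (row_mx x t)).
    by apply/funext => x; rewrite row_mxKl row_mxKr.
  have c1 : continuous (fun x : 'rV[R]_n => row_mx x t).
    apply: cont_row => i; case: (split_ordP i) => j ->.
      by under eq_fun do rewrite row_mxEl; exact: continuous_coord.
    by under eq_fun do rewrite row_mxEr; exact: cont_cst.
  by move=> x; exact: (@continuous_comp _ _ _ (fun x => row_mx x t)
    (fun v => H (lsubmx v) (rsubmx v)) x (c1 x) (cH _)).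
have F := @Fubini _ _ _ _ _ (leb n) (leb n) _ iH.
rewrite rintE [RHS]rintE; congr fine.
transitivity (\int[leb n]_x \int[leb n]_y (EFin \o H') (x, y))%E.
  apply: eq_integral => t _; rewrite rintE fineK//.
  exact: integrable_fin_num (tame_integrable (tx _)).
rewrite F; apply: eq_integral => t _; rewrite rintE fineK//.
exact: integrable_fin_num (tame_integrable (tt _)).
Qed.
End convergence.

(** * The Abel factor and its transform *)

Section abel_kernel.
Context (R : realType).
Local Notation C := (Cx R).
Local Notation Re := (@ReC R).
Local Notation Im := (@ImC R).

Definition rot (s : R) : C := mkC (cos s) (sin s).

Lemma rotD s t : rot (s + t) = rot s * rot t.
Proof. by apply: eqCx; rewrite !CE ?cosD ?sinD; ring. Qed.

Lemma modC_rot s : modC (rot s) = 1.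
Proof. by rewrite /modC !CE cos2Dsin2 sqrtr1. Qed.

Lemma ccont_rot (T : topologicalType) (f : T -> R) : continuous f ->
  ccont (fun x => rot (f x)).
Proof.
move=> cf; split.
  by apply: (@cont_comp _ _ _ (@cos R)) => //; exact: continuous_cos.
by apply: (@cont_comp _ _ _ (@sin R)) => //; exact: continuous_sin.
Qed.

Definition abel (e s : R) : R := expR (- (e * `|s|)).

Lemma cont_abel e : continuous (abel e).
Proof.
apply: (@cont_comp _ _ _ (@expR R) (fun s => - (e * `|s|))); first exact: continuous_expR.
apply: contN; apply: contM; first exact: cont_cst.
by move=> s; exact: norm_continuous.
Qed.

Lemma abel_bound e s : 0 < e -> abel e s <= (1 + 2 / e ^+ 2) * (1 + s ^+ 2)^-1.
Proof.
move=> e0; have e20 : 0 < e ^+ 2 by rewrite exprn_gt0.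
have s0 : 0 < 1 + s ^+ 2 by rewrite ltr_pwDl ?sqr_ge0.
rewrite /abel expRN ler_pdivlMr// mulrC ler_pdivrMr ?expR_gt0//.
have es : 0 <= e * `|s| by rewrite mulr_ge0// ltW.
have := expR_ge1Dxn 1 es; rewrite exprMn real_normK ?num_real//.
have -> : (2`!%:R : R) = 2 by [].
move=> h; apply: (@le_trans _ _ ((1 + 2 / e ^+ 2) * (1 + e ^+ 2 * s ^+ 2 / 2))); last first.
  by rewrite ler_wpM2l// addr_ge0// divr_ge0// ltW.
have -> : (1 + 2 / e ^+ 2) * (1 + e ^+ 2 * s ^+ 2 / 2) =
    1 + s ^+ 2 + (2 / e ^+ 2 + e ^+ 2 * s ^+ 2 / 2) by field; rewrite gt_eqF.
rewrite lerDl; apply: addr_ge0; apply: divr_ge0 => //; first exact: ltW.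
by apply: mulr_ge0; [exact: ltW|exact: sqr_ge0].
Qed.

Lemma abel_cvg0 e K : 0 < e -> (fun k : nat => K * abel e k%:R) @ \oo --> 0.
Proof.
move=> e0; apply/cvgr0Pnorm_le => d d0; near=> k.
have h := abel_bound k%:R e0.
rewrite normrM (ger0_norm (expR_ge0 _)).
apply: le_trans (ler_wpM2l (normr_ge0 K) h) _; rewrite mulrA.
apply: le_trans (ler_norm _) _.
near: k; have /cvgr0Pnorm_le := oneDsqrV_cvg0 (`|K| * (1 + 2 / e ^+ 2)); exact.
Unshelve. all: by end_near. Qed.

(** The Abel factor has a corner at 0, so each half-line gets its own antiderivative. Both are
    extended to the whole line, which lets the fundamental theorem reach 0; at infinity they vanish
    like the Abel factor itself. *)
Lemma abel_half (e : R) (G : R -> R) (Gp Gn fp fn : R -> R) (l D : R) : 0 < e ->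
  tame1 G -> continuous fp -> continuous fn ->
  (forall s, 0 <= s -> G s = fp s) -> (forall s, s <= 0 -> G s = fn s) ->
  (forall s : R, is_derive s 1 Gp (fp s)) -> (forall s : R, is_derive s 1 Gn (fn s)) ->
  (forall s, 0 <= s -> `|Gp s| <= D * abel e s) ->
  (forall s, s <= 0 -> `|Gn s| <= D * abel e s) ->
  Gn 0 - Gp 0 = l -> rint1 G = l.
Proof.
move=> e0 tG cfp cfn Gfp Gfn dp dn bp bn hl; have [cG _] := tG.
apply: rint1_uniq => //.
suff : (fun k : nat => iint (- k%:R) k%:R G - l) @ \oo --> 0.
  by move/cvg_sub0 => H; apply: H; exact: cvg_cst.
apply/cvgr0Pnorm_le => d d0; near=> k.
have k0 : (0 < k)%N by near: k; exact: nbhs_infty_gt.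
have kR : 0 < k%:R :> R by rewrite ltr0n.
have kN : - k%:R < 0 :> R by rewrite oppr_lt0.
have -> : iint (- k%:R) k%:R G = (Gn 0 - Gn (- k%:R)) + (Gp k%:R - Gp 0).
  rewrite (iint_add (ltW kN) (ltW kR) cG); congr (_ + _).
    rewrite -(iint_FTC kN cfn dn); apply: eq_Rintegral => x.
    by rewrite inE /= in_itv /= => /andP[_ x0]; exact: Gfn.
  rewrite -(iint_FTC kR cfp dp); apply: eq_Rintegral => x.
  by rewrite inE /= in_itv /= => /andP[x0 _]; exact: Gfp.
have -> : Gn 0 - Gn (- k%:R) + (Gp k%:R - Gp 0) - l = Gp k%:R - Gn (- k%:R).
  by rewrite -hl; ring.
apply: le_trans (ler_normB _ _) _.
apply: (@le_trans _ _ (2 * D * abel e k%:R)).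
  have b1 := bp _ (ltW kR); have b2 := bn _ (ltW kN).
  by move: b1 b2; rewrite /abel normrN; lra.
apply: le_trans (ler_norm _) _.
near: k; have /cvgr0Pnorm_le := abel_cvg0 (2 * D) e0; exact.
Unshelve. all: by end_near. Qed.

Lemma abel_tame e (f : R -> R) : 0 < e -> continuous f -> (forall s, `|f s| <= 1) ->
  tame1 (fun s => abel e s * f s).
Proof.
move=> e0 cf f1; split; first by apply: contM => //; exact: cont_abel.
exists (1 + 2 / e ^+ 2) => s; apply: le_trans (abel_bound s e0).
by rewrite normrM ger0_norm ?expR_ge0// ler_piMr ?expR_ge0.
Qed.

(** The explicit antiderivatives are the real parts of e^{(-e + it)s} / (-e + it) and e^{(e + it)s}
    / (e + it), on the right and on the left of 0. *)
Lemma abel_cos e t : 0 < e -> rint1 (fun s => abel e s * cos (s * t)) = 2 * e / (e ^+ 2 + t ^+ 2).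
Proof.
move=> e0; have D0 : 0 < e ^+ 2 + t ^+ 2 by rewrite ltr_pwDl ?sqr_ge0 ?exprn_gt0.
have Dn : e ^+ 2 + t ^+ 2 != 0 by rewrite gt_eqF.
have cid : continuous (fun s : R => s) by move=> ?; exact: cvg_id.
have clin (a : R) : continuous (fun s : R => s * a) by apply: contM => //; exact: cont_cst.
have ct : continuous (fun s : R => cos (s * t)).
  by apply: (@cont_comp _ _ _ (@cos R)) => //; exact: continuous_cos.
have ce (a : R) : continuous (fun s : R => expR (s * a)).
  by apply: (@cont_comp _ _ _ (@expR R)) => //; exact: continuous_expR.
have c1 s := cos_le1 (s : R); have c2 s := cos_geN1 (s : R).
have s1 s := sin_le1 (s : R); have s2 s := sin_geN1 (s : R).
have tr (a b : R) s : `|a * cos s + b * sin s| <= `|a| + `|b|.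
  apply: le_trans (ler_normD _ _) _; rewrite !normrM; apply: lerD; apply: ler_piMr => //;
  by rewrite ler_norml ?c1 ?c2 ?s1 ?s2.
have hb (E X K : R) : 0 <= E -> `|X| <= K -> `|E * X / (e ^+ 2 + t ^+ 2)| <=
    K / (e ^+ 2 + t ^+ 2) * E.
  move=> E0 XK; rewrite !normrM normfV (ger0_norm E0) (gtr0_norm D0) -mulrA mulrC.
  by rewrite ler_wpM2r// ler_wpM2r// invr_ge0 ltW.
apply: (@abel_half e _
  (fun s => expR (s * - e) * (- e * cos (s * t) + t * sin (s * t)) / (e ^+ 2 + t ^+ 2))
  (fun s => expR (s * e) * (e * cos (s * t) + t * sin (s * t)) / (e ^+ 2 + t ^+ 2))
  (fun s => expR (s * - e) * cos (s * t)) (fun s => expR (s * e) * cos (s * t)) _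
  ((`|e| + `|t|) / (e ^+ 2 + t ^+ 2))) => //.
- by apply: abel_tame => // s; rewrite ler_norml c1 c2.
- exact: contM.
- exact: contM.
- by move=> s s0; rewrite /abel ger0_norm// mulrN [s * e]mulrC.
- by move=> s s0; rewrite /abel ler0_norm// mulrN opprK [e * s]mulrC.
- by move=> s; apply: is_derive_eq; rewrite /GRing.scale /=; field.
- by move=> s; apply: is_derive_eq; rewrite /GRing.scale /=; field.
- move=> s s0; rewrite /abel (ger0_norm s0) (_ : - (e * s) = s * - e); last by ring.
  apply: hb; first exact: expR_ge0.
  apply: le_trans (tr _ _ _) _; rewrite ?normrN; by rewrite ?lexx.
- move=> s s0; rewrite /abel (ler0_norm s0) (_ : - (e * - s) = s * e); last by ring.
  apply: hb; first exact: expR_ge0.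
  apply: le_trans (tr _ _ _) _; rewrite ?normrN; by rewrite ?lexx.
- by rewrite !mul0r expR0 cos0 sin0; field.
Qed.

Lemma abel_sin e t : 0 < e -> rint1 (fun s => abel e s * sin (s * t)) = 0.
Proof.
move=> e0; have D0 : 0 < e ^+ 2 + t ^+ 2 by rewrite ltr_pwDl ?sqr_ge0 ?exprn_gt0.
have Dn : e ^+ 2 + t ^+ 2 != 0 by rewrite gt_eqF.
have cid : continuous (fun s : R => s) by move=> ?; exact: cvg_id.
have clin (a : R) : continuous (fun s : R => s * a) by apply: contM => //; exact: cont_cst.
have ct : continuous (fun s : R => sin (s * t)).
  by apply: (@cont_comp _ _ _ (@sin R)) => //; exact: continuous_sin.
have ce (a : R) : continuous (fun s : R => expR (s * a)).
  by apply: (@cont_comp _ _ _ (@expR R)) => //; exact: continuous_expR.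
have c1 s := cos_le1 (s : R); have c2 s := cos_geN1 (s : R).
have s1 s := sin_le1 (s : R); have s2 s := sin_geN1 (s : R).
have tr (a b : R) s : `|a * cos s + b * sin s| <= `|a| + `|b|.
  apply: le_trans (ler_normD _ _) _; rewrite !normrM; apply: lerD; apply: ler_piMr => //;
  by rewrite ler_norml ?c1 ?c2 ?s1 ?s2.
have hb (E X K : R) : 0 <= E -> `|X| <= K -> `|E * X / (e ^+ 2 + t ^+ 2)| <=
    K / (e ^+ 2 + t ^+ 2) * E.
  move=> E0 XK; rewrite !normrM normfV (ger0_norm E0) (gtr0_norm D0) -mulrA mulrC.
  by rewrite ler_wpM2r// ler_wpM2r// invr_ge0 ltW.
apply: (@abel_half e _
  (fun s => expR (s * - e) * (- t * cos (s * t) + - e * sin (s * t)) / (e ^+ 2 + t ^+ 2))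
  (fun s => expR (s * e) * (- t * cos (s * t) + e * sin (s * t)) / (e ^+ 2 + t ^+ 2))
  (fun s => expR (s * - e) * sin (s * t)) (fun s => expR (s * e) * sin (s * t)) _
  ((`|t| + `|e|) / (e ^+ 2 + t ^+ 2))) => //.
- by apply: abel_tame => // s; rewrite ler_norml s1 s2.
- exact: contM.
- exact: contM.
- by move=> s s0; rewrite /abel ger0_norm// mulrN [s * e]mulrC.
- by move=> s s0; rewrite /abel ler0_norm// mulrN opprK [e * s]mulrC.
- by move=> s; apply: is_derive_eq; rewrite /GRing.scale /=; field.
- by move=> s; apply: is_derive_eq; rewrite /GRing.scale /=; field.
- move=> s s0; rewrite /abel (ger0_norm s0) (_ : - (e * s) = s * - e); last by ring.
  apply: hb; first exact: expR_ge0.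
  apply: le_trans (tr _ _ _) _; rewrite ?normrN; by rewrite ?lexx.
- move=> s s0; rewrite /abel (ler0_norm s0) (_ : - (e * - s) = s * e); last by ring.
  apply: hb; first exact: expR_ge0.
  apply: le_trans (tr _ _ _) _; rewrite ?normrN; by rewrite ?lexx.
- by rewrite !mul0r expR0 cos0 sin0; field.
Qed.

(** The Poisson kernel of width e, up to the factor 2 pi. *)
Lemma abel_transform e t : 0 < e ->
  cint1 (fun s => ofR (abel e s) * rot (s * t)) = ofR (2 * e / (e ^+ 2 + t ^+ 2)).
Proof.
move=> e0; transitivity (mkC (rint1 (fun s => abel e s * cos (s * t)))
  (rint1 (fun s => abel e s * sin (s * t)))); last by rewrite abel_cos// abel_sin.
by rewrite /cint1; congr mkC; congr rint1; apply/funext => s; rewrite !CE; ring.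
Qed.
End abel_kernel.

Section inversion.
Context (R : realType).
Local Notation C := (Cx R).
Local Notation Re := (@ReC R).
Local Notation Im := (@ImC R).

Lemma ctame1P (h : R -> C) K : ccont h -> (forall s, modC (h s) <= K * (1 + s ^+ 2)^-1) ->
  ctame1 h.
Proof.
move=> [c1 c2] hK; split; split=> //; exists K => s.
  exact: le_trans (Re_le _) (hK s).
exact: le_trans (Im_le _) (hK s).
Qed.

Lemma cint1Z (c : C) (h : R -> C) : ctame1 h -> cint1 (fun s => c * h s) = c * cint1 h.
Proof.
move=> [/tame1_integrable i1 /tame1_integrable i2].
have lin (a b : R) : rint1 (fun s => a * Re (h s) + b * Im (h s)) =
    a * rint1 (fun s => Re (h s)) + b * rint1 (fun s => Im (h s)).
  rewrite /rint1 RintegralD//; last 2 first.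
  - exact: (integrableZl measurableT a i1).
  - exact: (integrableZl measurableT b i2).
  by rewrite !RintegralZl.
rewrite [RHS]mkC_eta; congr mkC; rewrite ?ReCM ?ImCM /cint1 !CE.
  by rewrite -mulNr -lin; congr rint1; apply/funext => s; rewrite !CE; ring.
by rewrite addrC -lin; congr rint1; apply/funext => s; rewrite !CE; ring.
Qed.

Lemma cintegral_prod n (g : 'I_n -> R -> C) (K : R) : 0 <= K ->
  (forall i, ccont (g i)) -> (forall i s, modC (g i s) <= K * (1 + s ^+ 2)^-1) ->
  ctame (fun x : 'rV[R]_n => \prod_i g i (x 0 i)) /\
  cintegral (fun x : 'rV[R]_n => \prod_i g i (x 0 i)) = \prod_i cint1 (g i).
Proof.
move=> K0; elim: n g => [|n IH] g cg hg.
  split.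
    split; split.
    - by under eq_fun do rewrite big_ord0; exact: cont_cst.
    - by exists 1 => x; rewrite big_ord0 /weight big_ord0 CE normr1 mulr1.
    - by under eq_fun do rewrite big_ord0; exact: cont_cst.
    - by exists 1 => x; rewrite big_ord0 /weight big_ord0 CE normr0 mulr1.
  rewrite big_ord0 cintegralE [RHS]mkC_eta; congr mkC.
    transitivity (rint (@weight R 0)).
      by congr rint; apply/funext => x; rewrite big_ord0 /weight big_ord0.
    by rewrite rint_weight expr0.
  transitivity (rint (fun x : 'rV[R]_0 => 0 * weight x)).
    by congr rint; apply/funext => x; rewrite big_ord0 mul0r.
  by rewrite rintZ ?mul0r//; exact: tame_weight.
have tP : ctame (fun x : 'rV[R]_n.+1 => \prod_i g i (x 0 i)).
  apply: (@ctameP _ _ _ (K ^+ n.+1)).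
    have : forall s : seq 'I_n.+1, ccont (fun x : 'rV[R]_n.+1 => \prod_(i <- s) g i (x 0 i)).
      elim=> [|i s IHs]; first by under eq_fun do rewrite big_nil; exact: ccont_cst.
      under eq_fun do rewrite big_cons; apply: ccontM => //.
      by apply: (ccont_comp (cg i)); exact: continuous_coord.
    exact.
  move=> x; have -> : K ^+ n.+1 * weight x = \prod_(i < n.+1) (K * (1 + x 0 i ^+ 2)^-1).
    by rewrite big_split /= prodr_const card_ord.
  have mp : forall s : seq 'I_n.+1, modC (\prod_(i <- s) g i (x 0 i)) =
      \prod_(i <- s) modC (g i (x 0 i)).
    by elim=> [|i s IHs]; rewrite ?big_nil ?modC1// !big_cons modCM IHs.
  by rewrite mp; apply: ler_prod => i _; rewrite modC_ge0 hg.
split=> //; rewrite cintegral_consl// big_ord_recl.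
have [tI eI] := IH (fun i => g (lift ord0 i)) (fun i => cg _) (fun i => hg _).
have t0 : ctame1 (g ord0) by apply: ctame1P (cg _) (hg _).
rewrite mulrC -cint1Z//; apply: eq_cint1 => s.
rewrite -eI mulrC -cintegralZ//; apply: eq_cintegral => v.
rewrite big_ord_recl vcons0; congr (_ * _).
by apply: eq_bigr => i _; rewrite vconsS.
Qed.

Section affine.
Variables (n : nat) (xi : 'rV[R]_n) (e : R).
Hypothesis e0 : 0 < e.

(** The substitution x -> xi + e x carried out in the first k coordinates only, so that the change
    of variables can proceed one coordinate at a time. *)
Definition aff (k : nat) (x : 'rV[R]_n) : 'rV[R]_n :=
  \row_j if (j < k)%N then xi 0 j + e * x 0 j else x 0 j.

Lemma ctame_aff k (F : 'rV[R]_n -> C) : ctame F -> ctame (fun x => F (aff k x)).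
Proof.
move=> tF; have [K [K0 hK]] := ctame_bound tF.
pose M j := 2 * (1 + xi 0 j ^+ 2) * (1 + (e ^+ 2)^-1).
(* The majorant carries the factor [M j] for all j, also for coordinates not yet substituted, where
   1 <= M j is what is needed. *)
have M1 j : 1 <= M j.
  have h1 : 1 <= 1 + xi 0 j ^+ 2 by rewrite lerDl sqr_ge0.
  have h2 : 1 <= 1 + (e ^+ 2)^-1 by rewrite lerDl invr_ge0 sqr_ge0.
  have h3 : 1 <= 2 * (1 + xi 0 j ^+ 2) by lra.
  exact: mulr_ege1.
apply: (@ctameP _ _ _ (K * \prod_j M j)).
  apply: (ccont_comp (ctame_cont tF)); apply: cont_row => j.
  under eq_fun do rewrite mxE; case: (j < k)%N; last exact: (@continuous_coord R n j).
  apply: contD; first exact: cont_cst.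
  by apply: contM; [exact: cont_cst|exact: continuous_coord].
move=> x; apply: le_trans (hK _) _; rewrite -mulrA ler_wpM2l// /weight -big_split /=.
apply: ler_prod => j _; rewrite oneDsqrV_ge0 /= mxE; case: ifP => _.
  exact: oneDsqrV_subst.
by rewrite ler_peMl ?oneDsqrV_ge0.
Qed.

Lemma cintegral_aff (F : 'rV[R]_n -> C) : ctame F ->
  ofR (e ^+ n) * cintegral (fun x => F (xi + e *: x)) = cintegral F.
Proof.
move=> tF.
have step k : (k <= n)%N -> ofR (e ^+ k) * cintegral (fun x => F (aff k x)) = cintegral F.
  elim: k => [_|k IH kn].
    have -> : (fun x => F (aff 0 x)) = F.
      by apply/funext => x; congr F; apply/rowP => j; rewrite mxE.
    by rewrite expr0 -[ofR 1]/(1 : C) mul1r.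
  rewrite -(IH (ltnW kn)) exprSr ofRM -mulrA; congr (_ * _).
  rewrite -cintegralZ; last exact: ctame_aff.
  pose i := Ordinal kn.
  apply: (cintegral_coord (i := i)).
  - exact: ctameZ (ctame_aff _ tF).
  - exact: ctame_aff.
  move=> x; pose h s := F (aff k (upd x i s)).
  have hE s : F (aff k.+1 (upd x i s)) = h (xi 0 i + e * s).
    congr F; apply/rowP => j; rewrite !mxE -val_eqE /= ltnS leq_eqVlt.
    have [jk|//] := eqVneq (j : nat) k.
    by rewrite jk ltnn /=; congr (xi 0 _ + _); apply: val_inj.
  have th : ctame1 h.
    have tG := ctame_aff k tF; have [K [K0 hK]] := ctame_bound tG.
    apply: (@ctame1P _ K).
      apply: (ccont_comp (ctame_cont tG) (g := upd x i)); apply: cont_row => j.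
      under eq_fun do rewrite mxE; case: (j == i); last exact: cont_cst.
      by move=> s; exact: cvg_id.
    by move=> s; apply: le_trans (hK _) _; rewrite ler_wpM2l// weight_upd.
  have [t1 t2] := th.
  rewrite /cint1; congr mkC.
    rewrite -(rint1_subst (xi 0 i) e0 t1).
    have [ts _] := tame1_subst (xi 0 i) e0 t1.
    rewrite /rint1 -RintegralZl//; last first.
      by have := tame1_integrable (tame1_subst (xi 0 i) e0 t1).
    by apply: eq_Rintegral => s _; rewrite hE !CE mul0r subr0.
  rewrite -(rint1_subst (xi 0 i) e0 t2).
  rewrite /rint1 -RintegralZl//; last first.
    by have := tame1_integrable (tame1_subst (xi 0 i) e0 t2).
  by apply: eq_Rintegral => s _; rewrite hE !CE mul0r addr0.
rewrite -(step n (leqnn n)); congr (_ * _); apply: eq_cintegral => x; congr F.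
by apply/rowP => j; rewrite !mxE ltn_ord.
Qed.
End affine.

Lemma cintegral_fubini n (H : 'rV[R]_n -> 'rV[R]_n -> C) K :
  ccont (fun v : 'rV[R]_(n + n) => H (lsubmx v) (rsubmx v)) ->
  (forall x t, modC (H x t) <= K * (weight x * weight t)) ->
  cintegral (fun x => cintegral (fun t => H x t)) =
  cintegral (fun t => cintegral (fun x => H x t)).
Proof.
move=> [c1 c2] hK; rewrite [LHS]cintegralE [RHS]cintegralE.
apply: (f_equal2 (@mkC R)).
  exact: (@rint_fubini _ _ (fun x t => Re (H x t)) K c1
    (fun x t => le_trans (Re_le _) (hK x t))).
exact: (@rint_fubini _ _ (fun x t => Im (H x t)) K c2
  (fun x t => le_trans (Im_le _) (hK x t))).
Qed.

(** Passage to the limit in an identity between integrals, by dominated convergence on each side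
    with its own majorant. *)
Lemma cintegral_cvg_uniq n (F_ G_ : nat -> 'rV[R]_n -> C) (F G : 'rV[R]_n -> C) K L :
  (forall k, ccont (F_ k)) -> ccont F -> (forall k, ccont (G_ k)) -> ccont G ->
  (forall k x, modC (F_ k x) <= K * weight x) ->
  (forall k x, modC (G_ k x) <= L * weight x) ->
  (forall x, (fun k => F_ k x) @ \oo --> F x) -> (forall x, (fun k => G_ k x) @ \oo --> G x) ->
  (forall k, cintegral (F_ k) = cintegral (G_ k)) -> cintegral F = cintegral G.
Proof.
move=> cF_ cF cG_ cG hK hL lF lG FG; rewrite [LHS]cintegralE [RHS]cintegralE; congr mkC.
  have l1 : (fun k => rint (fun x => Re (F_ k x))) @ \oo --> rint (fun x => Re (F x)).
    apply: (rint_cvg (K := K)).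
    - by move=> k; have [] := cF_ k.
    - by case: cF.
    - by move=> k x; exact: le_trans (Re_le _) (hK k x).
    - by move=> x; apply: continuous_cvg; [exact: continuous_ReC|exact: lF].
  have l2 : (fun k => rint (fun x => Re (G_ k x))) @ \oo --> rint (fun x => Re (G x)).
    apply: (rint_cvg (K := L)).
    - by move=> k; have [] := cG_ k.
    - by case: cG.
    - by move=> k x; exact: le_trans (Re_le _) (hL k x).
    - by move=> x; apply: continuous_cvg; [exact: continuous_ReC|exact: lG].
  have e k : rint (fun x => Re (F_ k x)) = rint (fun x => Re (G_ k x)).
    by have := congr1 Re (FG k).
  by move: l1; under eq_fun do rewrite e; move=> l1; apply: cvg_unique l1 l2.
have l1 : (fun k => rint (fun x => Im (F_ k x))) @ \oo --> rint (fun x => Im (F x)).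
  apply: (rint_cvg (K := K)).
  - by move=> k; have [] := cF_ k.
  - by case: cF.
  - by move=> k x; exact: le_trans (Im_le _) (hK k x).
  - by move=> x; apply: continuous_cvg; [exact: continuous_ImC|exact: lF].
have l2 : (fun k => rint (fun x => Im (G_ k x))) @ \oo --> rint (fun x => Im (G x)).
  apply: (rint_cvg (K := L)).
  - by move=> k; have [] := cG_ k.
  - by case: cG.
  - by move=> k x; exact: le_trans (Im_le _) (hL k x).
  - by move=> x; apply: continuous_cvg; [exact: continuous_ImC|exact: lG].
have e k : rint (fun x => Im (F_ k x)) = rint (fun x => Im (G_ k x)).
  by have := congr1 Im (FG k).
by move: l1; under eq_fun do rewrite e; move=> l1; apply: cvg_unique l1 l2.
Qed.
End inversion.

(** * The inversion formula by Abel summation *)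

Section fourier_inversion.
Context (R : realType) (n : nat).
Local Notation C := (Cx R).
Local Notation rV := 'rV[R]_n.

Lemma cont_rdot (T : topologicalType) (f g : T -> rV) :
  (forall j, continuous (fun x => f x 0 j)) -> (forall j, continuous (fun x => g x 0 j)) ->
  continuous (fun x => rdot (f x) (g x)).
Proof. by move=> cf cg; apply: cont_sum => j; exact: contM. Qed.

Lemma ccont_ofR (T : topologicalType) (f : T -> R) : continuous f -> ccont (fun x => ofR (f x)).
Proof. by move=> cf; split=> //; exact: cont_cst. Qed.

Definition abeln (e : R) (x : rV) : R := \prod_j abel e (x 0 j).

Lemma abeln_ge0 e x : 0 <= abeln e x.
Proof. by apply: prodr_ge0 => j _; exact: expR_ge0. Qed.

Lemma abeln_le1 e x : 0 < e -> abeln e x <= 1.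
Proof.
move=> e0; apply: prodr_ile1 => j _; rewrite expR_ge0 -expR0 ler_expR.
by rewrite oppr_le0 mulr_ge0// ltW.
Qed.

Lemma abeln_bound e x : 0 < e -> abeln e x <= (1 + 2 / e ^+ 2) ^+ n * weight x.
Proof.
move=> e0; have -> : (1 + 2 / e ^+ 2) ^+ n * weight x =
    \prod_(j < n) ((1 + 2 / e ^+ 2) * (1 + x 0 j ^+ 2)^-1).
  by rewrite big_split /= prodr_const card_ord.
by apply: ler_prod => j _; rewrite expR_ge0 abel_bound.
Qed.

Lemma cont_abeln e : continuous (abeln e).
Proof.
apply: cont_prod => j; apply: (@cont_comp _ _ _ (abel e)); first exact: cont_abel.
exact: continuous_coord.
Qed.

Lemma rot_sum (I : Type) (s : seq I) (f : I -> R) :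
  rot (\sum_(i <- s) f i) = \prod_(i <- s) rot (f i).
Proof.
elim: s => [|i s IH]; rewrite ?big_nil ?big_cons ?rotD ?IH//.
by rewrite /rot cos0 sin0.
Qed.

Lemma ofR_prod (I : Type) (s : seq I) (f : I -> R) :
  ofR (\prod_(i <- s) f i) = \prod_(i <- s) ofR (f i).
Proof. by elim: s => [|i s IH]; rewrite ?big_nil ?big_cons ?ofRM ?IH. Qed.

Variable u : rV -> C.
Hypothesis tu : ctame u.

Definition ft (x : rV) : C := cintegral (fun t => u t * rot (- rdot x t)).

Hypothesis tft : ctame ft.

Lemma ft_ctame x : ctame (fun t => u t * rot (- rdot x t)).
Proof.
have [K [K0 hK]] := ctame_bound tu; apply: (@ctameP _ _ _ K).
  apply: ccontM; first exact: ctame_cont.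
  apply: ccont_rot; apply: contN; apply: cont_rdot => j; first exact: cont_cst.
  exact: continuous_coord.
by move=> t; rewrite modCM modC_rot mulr1.
Qed.

Lemma abel_kernelE (e : R) (d : rV) : 0 < e ->
  cintegral (fun x => ofR (abeln e x) * rot (rdot x d)) =
  ofR (\prod_j (2 * e / (e ^+ 2 + d 0 j ^+ 2))).
Proof.
move=> e0; rewrite ofR_prod.
under [RHS]eq_bigr do rewrite -abel_transform//.
have [|j||_ <-] := @cintegral_prod R n (fun j s => ofR (abel e s) * rot (s * d 0 j))
   (1 + 2 / e ^+ 2).
- by rewrite addr_ge0// divr_ge0// sqr_ge0.
- apply: ccontM; first by apply: ccont_ofR; exact: cont_abel.
  apply: ccont_rot; apply: contM; last exact: cont_cst.
  by move=> s; exact: cvg_id.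
- move=> j s; rewrite modCM modC_rot mulr1 modC_ofR ger0_norm ?expR_ge0//.
  exact: abel_bound.
apply: eq_cintegral => x; rewrite big_split /= -ofR_prod; congr (_ * _).
by rewrite /rdot rot_sum.
Qed.

(** For fixed e the Abel factor makes the double integral absolutely convergent, so Fubini applies;
    the inner integral is a product of Poisson kernels at xi - t. After t = xi + e s the parameter
    survives only in the argument of [u], and the majorant becomes independent of e. *)
Lemma abel_regularization (e : R) (xi : rV) : 0 < e ->
  cintegral (fun x => ft x * rot (rdot x xi) * ofR (abeln e x)) =
  cintegral (fun s => ofR (2 ^+ n) * (u (xi + e *: s) * ofR (weight s))).
Proof.
move=> e0; have [K [K0 hK]] := ctame_bound tu.
pose H (x t : rV) := rot (rdot x xi) * ofR (abeln e x) * (u t * rot (- rdot x t)).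
have cl (j : 'I_n) : continuous (fun v : 'rV[R]_(n + n) => lsubmx v 0 j).
  by under eq_fun do rewrite mxE; exact: continuous_coord.
have cr (j : 'I_n) : continuous (fun v : 'rV[R]_(n + n) => rsubmx v 0 j).
  by under eq_fun do rewrite mxE; exact: continuous_coord.
have cH : ccont (fun v : 'rV[R]_(n + n) => H (lsubmx v) (rsubmx v)).
  apply: ccontM; [apply: ccontM|apply: ccontM].
  - by apply: ccont_rot; apply: cont_rdot => // j; exact: cont_cst.
  - apply: (ccont_comp (ccont_ofR (@cont_abeln e)) (g := fun v : 'rV[R]_(n + n) => lsubmx v)).
    exact: cont_row.
  - apply: (ccont_comp (ctame_cont tu) (g := fun v : 'rV[R]_(n + n) => rsubmx v)).
    exact: cont_row.
  - by apply: ccont_rot; apply: contN; exact: cont_rdot.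
have hH x t : modC (H x t) <= ((1 + 2 / e ^+ 2) ^+ n * K) * (weight x * weight t).
  rewrite /H !modCM !modC_rot mul1r mulr1 modC_ofR ger0_norm ?abeln_ge0//.
  rewrite mulrACA; apply: ler_pM; rewrite ?abeln_ge0 ?modC_ge0//.
  exact: abeln_bound.
transitivity (cintegral (fun x => cintegral (fun t => H x t))).
  apply: eq_cintegral => x; rewrite /H cintegralZ; last exact: ft_ctame.
  by rewrite -/(ft x); ring.
rewrite (cintegral_fubini cH hH).
pose F t := u t * ofR (\prod_j (2 * e / (e ^+ 2 + (xi - t) 0 j ^+ 2))).
transitivity (cintegral F).
  apply: eq_cintegral => t; rewrite /F -abel_kernelE//.
  rewrite -cintegralZ; last first.
    apply: (@ctameP _ _ _ ((1 + 2 / e ^+ 2) ^+ n)).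
      apply: ccontM; first by apply: ccont_ofR; exact: cont_abeln.
      apply: ccont_rot; apply: cont_rdot => j; first exact: continuous_coord.
      exact: cont_cst.
    move=> x; rewrite modCM modC_rot mulr1 modC_ofR ger0_norm ?abeln_ge0//.
    exact: abeln_bound.
  apply: eq_cintegral => x; rewrite /H.
  have -> : rdot x (xi - t) = rdot x xi - rdot x t.
    by rewrite /rdot -sumrB; apply: eq_bigr => j _; rewrite !mxE mulrBr.
  rewrite rotD; ring.
have e20 : 0 < e ^+ 2 by rewrite exprn_gt0.
have tF : ctame F.
  apply: (@ctameP _ _ _ (K * (2 / e) ^+ n)).
    apply: ccontM; first exact: ctame_cont.
    apply: ccont_ofR; apply: cont_prod => j; apply: contM; first exact: cont_cst.
    apply: contV => [t|]; first by rewrite gt_eqF// ltr_pwDl// sqr_ge0.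
    apply: contD; first exact: cont_cst.
    have c : continuous (fun t : rV => (xi - t) 0 j).
      under eq_fun do rewrite !mxE; apply: contB; first exact: cont_cst.
      exact: continuous_coord.
    by apply: contM.
  move=> t; rewrite modCM modC_ofR mulrAC; apply: ler_pM; rewrite ?modC_ge0//.
  have hq (r : R) : 0 <= 2 * e / (e ^+ 2 + r ^+ 2) <= 2 / e.
    have D0 : 0 < e ^+ 2 + r ^+ 2 by rewrite ltr_pwDl// sqr_ge0.
    rewrite divr_ge0 ?(ltW D0) ?mulr_ge0 ?(ltW e0)//= ler_pdivrMr//.
    have -> : 2 / e * (e ^+ 2 + r ^+ 2) = 2 * e + 2 / e * r ^+ 2.
      by field; rewrite gt_eqF.
    by rewrite lerDl; apply: mulr_ge0; [rewrite divr_ge0// ltW|exact: sqr_ge0].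
  rewrite ger0_norm; last by apply: prodr_ge0 => j _; have /andP[] := hq ((xi - t) 0 j).
  have -> : (2 / e) ^+ n = \prod_(j < n) (2 / e) by rewrite prodr_const card_ord.
  by apply: ler_prod => j _; exact: hq.
(* The Jacobian e^n meets the (2 / e)^n of the rescaled Poisson kernels and leaves 2^n. *)
rewrite -(cintegral_aff xi e0 tF) -cintegralZ; last first.
  have := ctame_aff xi e0 n tF; congr ctame; apply/funext => x; congr F.
  by apply/rowP => j; rewrite !mxE ltn_ord.
apply: eq_cintegral => s; rewrite /F.
have -> : \prod_j (2 * e / (e ^+ 2 + (xi - (xi + e *: s)) 0 j ^+ 2)) =
    (2 / e) ^+ n * weight s.
  have -> : (2 / e) ^+ n = \prod_(j < n) (2 / e) by rewrite prodr_const card_ord.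
  rewrite -big_split /=; apply: eq_bigr => j _; rewrite !mxE.
  have s0 : 0 < 1 + s 0 j ^+ 2 by rewrite ltr_pwDl ?sqr_ge0.
  have -> : e ^+ 2 + (xi 0 j - (xi 0 j + e * s 0 j)) ^+ 2 = e ^+ 2 * (1 + s 0 j ^+ 2) by ring.
  by field; rewrite !gt_eqF.
rewrite mulrCA [RHS]mulrCA -!ofRM mulrA -exprMn.
by have -> : e * (2 / e) = 2 by field; rewrite gt_eqF.
Qed.

(** Let e = 1/(k + 1) tend to 0 in the regularized identity: the left side is dominated through
    [ft u], the right side through a bound of [u] times the weight. The constant is 2^n from the
    Poisson kernels times the mass pi^n of the weight. *)
Theorem fourier_inversion (xi : rV) :
  cintegral (fun x => ft x * rot (rdot x xi)) = ofR ((2 * pi) ^+ n) * u xi.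
Proof.
have [K [K0 hK]] := ctame_bound tu; have [L [L0 hL]] := ctame_bound tft.
pose e (k : nat) : R := k.+1%:R^-1.
have e0 k : 0 < e k by rewrite invr_gt0 ltr0n.
have ce : e @ \oo --> (0 : R) by exact: cvg_harmonic.
have Ku v : modC (u v) <= K.
  by apply: le_trans (hK v) _; rewrite ler_piMr// weight_le1.
transitivity (cintegral (fun s : rV => ofR (2 ^+ n) * (u xi * ofR (weight s)))).
  apply: (@cintegral_cvg_uniq R n
    (fun k x => ft x * rot (rdot x xi) * ofR (abeln (e k) x))
    (fun k s => ofR (2 ^+ n) * (u (xi + e k *: s) * ofR (weight s))) _ _ L (2 ^+ n * K)).
  - move=> k; apply: ccontM; last by apply: ccont_ofR; exact: cont_abeln.
    apply: ccontM; first exact: ctame_cont.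
    apply: ccont_rot; apply: cont_rdot => j; first exact: continuous_coord.
    exact: cont_cst.
  - apply: ccontM; first exact: ctame_cont.
    apply: ccont_rot; apply: cont_rdot => j; first exact: continuous_coord.
    exact: cont_cst.
  - move=> k; apply: ccontM; first exact: ccont_cst.
    apply: ccontM; last by apply: ccont_ofR; exact: continuous_weight.
    apply: (ccont_comp (ctame_cont tu) (g := fun s : rV => xi + e k *: s)).
    apply: cont_row => j; under eq_fun do rewrite !mxE.
    apply: contD; first exact: cont_cst.
    by apply: contM; [exact: cont_cst|exact: continuous_coord].
  - apply: ccontM; first exact: ccont_cst.
    by apply: ccontM; [exact: ccont_cst|apply: ccont_ofR; exact: continuous_weight].
  - move=> k x; rewrite !modCM modC_rot mulr1 modC_ofR ger0_norm ?abeln_ge0//.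
    by apply: le_trans (hL x); rewrite ler_piMr ?modC_ge0// abeln_le1.
  - move=> k s; rewrite !modCM !modC_ofR ger0_norm ?exprn_ge0// -mulrA.
    rewrite ler_wpM2l ?exprn_ge0// ger0_norm ?(ltW (weight_gt0 _))//.
    by rewrite ler_wpM2r ?(ltW (weight_gt0 _)).
  - move=> x.
    (* The parameter is freed to range over all reals, so that convergence along the sequence is
       continuity at r = 0. *)
    pose G (r : R) := ft x * rot (rdot x xi) * ofR (abeln r x).
    have cG : ccont G.
      apply: ccontM; first exact: ccont_cst.
      apply: ccont_ofR; apply: cont_prod => j.
      have cid : continuous (fun r : R => - (r * `|x 0 j|)).
        apply: contN; apply: contM; last exact: cont_cst.
        by move=> r; exact: cvg_id.
      exact: (cont_comp (@continuous_expR R) cid).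
    have /ccont_continuous cG' := cG.
    have e1 : ft x * rot (rdot x xi) = G 0.
      rewrite /G /abeln big1 => [|j _]; first by rewrite -[ofR 1]/(1 : C) mulr1.
      by rewrite /abel mul0r oppr0 expR0.
    suff h : (fun k => G (e k)) @ \oo --> ft x * rot (rdot x xi) by exact: h.
    by rewrite e1; exact: (continuous_cvg _ (cG' 0) ce).
  - move=> s.
    pose G (r : R) := ofR (2 ^+ n) * (u (xi + r *: s) * ofR (weight s)).
    have cG : ccont G.
      apply: ccontM; first exact: ccont_cst.
      apply: ccontM; last exact: ccont_cst.
      apply: (ccont_comp (ctame_cont tu) (g := fun r : R => xi + r *: s)).
      apply: cont_row => j; under eq_fun do rewrite !mxE.
      apply: contD; first exact: cont_cst.
      apply: contM; last exact: cont_cst.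
      by move=> r; exact: cvg_id.
    have /ccont_continuous cG' := cG.
    have e1 : ofR (2 ^+ n) * (u xi * ofR (weight s)) = G 0.
      by rewrite /G scale0r addr0.
    suff h : (fun k => G (e k)) @ \oo --> ofR (2 ^+ n) * (u xi * ofR (weight s)) by exact: h.
    by rewrite e1; exact: (continuous_cvg _ (cG' 0) ce).
  - by move=> k; exact: abel_regularization.
have tw : ctame (fun s : rV => ofR (weight s)).
  by split; [exact: tame_weight|exact: tame0].
have ew : cintegral (fun s : rV => ofR (weight s)) = ofR (pi ^+ n).
  rewrite cintegralE /ofR -rint_weight; congr mkC.
  transitivity (rint (fun s : rV => 0 * weight s)).
    by congr rint; apply/funext => s; rewrite mul0r.
  by rewrite rintZ ?mul0r//; exact: tame_weight.
under eq_cintegral do rewrite mulrA.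
rewrite cintegralZ// ew exprMn ofRM; ring.
Qed.
End fourier_inversion.

(** * Exponential decay in G(psi^* ) *)

Section gdecay.
Context (R : realType) (n : nat).
Local Notation C := (Cx R).
Local Notation Re := (@ReC R).
Local Notation Im := (@ImC R).
Local Notation rV := 'rV[R]_n.

(** The hypothesis bounds the N-th term A (sX)^N / N! of the series by Q 2^{-N}. Asking for moments
    at 2s in order to conclude at s is what makes the sum converge. *)
Lemma expR_series_bound (A s X Q : R) : 0 <= A -> 0 < s -> 0 <= Q ->
  (forall N, A * X ^+ N <= Q * N`!%:R * (2 * s) ^- N) -> A * expR (s * X) <= 2 * Q.
Proof.
move=> A0 s0 Q0 h; have [->|An0] := eqVneq A 0; first by rewrite mul0r mulr_ge0.
have A1 : 0 < A by rewrite lt_neqAle eq_sym An0.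
rewrite mulrC -ler_pdivlMr//; apply: limr_le; first exact: is_cvg_series_exp_coeff.
apply: nearW => m; rewrite ler_pdivlMr// mulrC /series /= mulr_sumr.
have geo : \sum_(0 <= k < m) (2 : R) ^- k <= 2 - 2 * 2 ^- m.
  elim: m => [|m IH]; first by rewrite big_nil expr0 invr1 mulr1 subrr.
  rewrite big_nat_recr//=; apply: le_trans (lerD IH (lexx _)) _.
  by rewrite exprS invfM; lra.
apply: (@le_trans _ _ (\sum_(0 <= k < m) Q * 2 ^- k)).
  rewrite !big_mkord; apply: ler_sum => k _; rewrite /exp_coeff /=.
  have k0 : 0 < k`!%:R :> R by rewrite ltr0n fact_gt0.
  rewrite mulrA ler_pdivrMr// exprMn mulrCA -ler_pdivlMl ?exprn_gt0//.
  apply: le_trans (h k) _; rewrite exprMn invfM le_eqVlt; apply/orP; left; apply/eqP; ring.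
rewrite -mulr_sumr mulrC ler_wpM2r//; apply: le_trans geo _.
by rewrite gerBl mulr_ge0// invr_ge0 exprn_ge0.
Qed.

(** Pure derivatives in one direction, componentwise; no mixed derivative is needed to obtain decay
    of the inverse transform. *)
Definition gd (i : 'I_n) (k : nat) (g : rV -> C) : rV -> C := fun x =>
  mkC (iter k (partial i) (fun y => Re (g y)) x) (iter k (partial i) (fun y => Im (g y)) x).

Definition single (i : 'I_n) (k : nat) : 'I_n -> nat := fun j => if j == i then k else 0%N.

Lemma msize_single i k : msize (single i k) = k.
Proof.
rewrite /msize (bigD1 i)//= /single eqxx big1 ?addn0// => j ji.
by rewrite (negPf ji).
Qed.

Lemma mderiv_single i k (g : rV -> R) : mderiv (single i k) g = iter k (partial i) g.
Proof.
rewrite /mderiv.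
have H (s : seq 'I_n) : uniq s -> foldr (fun j => iter (single i k j) (partial j)) g s =
    if i \in s then iter k (partial i) g else g.
  elim: s => [//|j s IH] /= /andP[js us]; rewrite IH// inE /single.
  have [eji|//] := eqVneq j i.
  by move: js; rewrite eji => /negPf ->.
by rewrite H ?enum_uniq// mem_enum.
Qed.

Lemma mderivC_single i k (g : rV -> C) x : mderivC (single i k) g x = gd i k g x.
Proof. by rewrite /mderivC !mderiv_single. Qed.

Lemma monom_single (x : rV) j N : monom x (single j N) = x 0 j ^+ N.
Proof.
rewrite /monom (bigD1 j)//= /single eqxx big1 ?mulr1// => l lj.
by rewrite (negPf lj).
Qed.

Lemma Ck_iter i k m (g : rV -> R) : Ck (k + m) g -> Ck m (iter k (partial i) g).
Proof. by move=> Cg; have [] := iter_partial_lin 0 i Cg Cg. Qed.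

Section weight.
Variable phi : R -> R.
Hypothesis phi_nd : forall x y, 0 <= x -> x <= y -> phi x <= phi y.
Hypothesis phi_ub : forall x, 0 <= x ->
  has_ubound [set x * y - psi phi y | y in [set y | 0 <= y]].
Local Notation psis := (young (psi phi)).
Variable g : rV -> C.
Hypothesis Gg : G_step psis g.

(** The supremum defining the conjugate is tested at y = ln r, which is admissible because r >=
    1. *)
Lemma pow_young r N : 1 <= r -> r ^+ N * expR (- psis N%:R) <= expR (phi r).
Proof.
move=> r1; have r0 : 0 < r by exact: lt_le_trans r1.
have h : N%:R * ln r - psi phi (ln r) <= psis N%:R.
  by apply: ub_le_sup; [exact: phi_ub|exists (ln r) => //=; exact: ln_ge0].
rewrite /psi lnK ?posrE// in h.
rewrite -[r in r ^+ _]lnK ?posrE// -expRM_natl -expRD ler_expR; lra.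
Qed.

Lemma Gnorm_ge0 m : 0 <= fine (Gnorm m psis g).
Proof.
rewrite -lee_fin fineK ?(Gnorm_fin m Gg)//.
pose z : 'I_n -> nat := fun=> 0%N.
apply: (@le_trans _ _ (`|monom 0 z| * modC (mderivC z g 0) /
         ((msize z)`!%:R * expR (- psis (msize z)%:R)))%:E).
  by rewrite lee_fin divr_ge0 ?mulr_ge0 ?modC_ge0 ?expR_ge0.
by apply: ereal_sup_ubound; exists 0, z, z; split=> //; rewrite /msize big1.
Qed.

Lemma gd_pow i k m j N (x : rV) : (k <= m)%N ->
  `|x 0 j| ^+ N * modC (gd i k g x) <=
   fine (Gnorm m psis g) * (N`!%:R * expR (- psis N%:R)).
Proof.
move=> km; have N0 : 0 < N`!%:R :> R by rewrite ltr0n fact_gt0.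
rewrite -ler_pdivrMr ?mulr_gt0 ?expR_gt0// -lee_fin fineK ?(Gnorm_fin m Gg)//.
apply: ereal_sup_ubound; exists x, (single i k), (single j N).
by rewrite !msize_single monom_single normrX mderivC_single.
Qed.

Lemma gd_exp i k m j (x : rV) s : (k <= m)%N -> 1 <= s ->
  modC (gd i k g x) * expR (s * `|x 0 j|) <= 2 * (fine (Gnorm m psis g) * expR (phi (2 * s))).
Proof.
move=> km s1; have s0 : 0 < s by exact: lt_le_trans s1.
apply: expR_series_bound => //; first exact: modC_ge0.
  by rewrite mulr_ge0 ?Gnorm_ge0 ?expR_ge0.
move=> N; rewrite mulrC; apply: le_trans (gd_pow i j N x km) _.
rewrite -[leRHS]mulrA -[leRHS]mulrA ler_wpM2l ?Gnorm_ge0// mulrCA ler_wpM2l//.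
rewrite ler_pdivlMr ?exprn_gt0 ?mulr_gt0// mulrC pow_young//; lra.
Qed.

(** For the largest coordinate x_j the l^1 norm is at most n |x_j|, so decay in that coordinate at
    the rate s = n(B + 1) suffices; this s is at least 1, as [gd_exp] requires. *)
Lemma gd_norm1 i k m (x : rV) B : (0 < n)%N -> (k <= m)%N -> 0 <= B ->
  modC (gd i k g x) * expR ((B + 1) * norm1 x) <=
    2 * (fine (Gnorm m psis g) * expR (phi (2 * (n%:R * (B + 1))))).
Proof.
move=> n0 km B0; have [j hj] := max_coord x n0.
have n1 : 1 <= n%:R :> R by rewrite ler1n.
apply: le_trans (gd_exp i j x km _); last by rewrite mulr_ege1// lerDr.
have hn : norm1 x <= n%:R * `|x 0 j|.
  apply: (@le_trans _ _ (\sum_(l < n) `|x 0 j|)); first exact: ler_sum.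
  by rewrite sumr_const card_ord -[leLHS]mulr_natl.
rewrite ler_wpM2l ?modC_ge0// ler_expR [n%:R * _]mulrC -mulrA.
by rewrite ler_wpM2l// addr_ge0.
Qed.

Lemma gd_expdec i k : (0 < n)%N -> expdec (gd i k g).
Proof.
move=> n0; split.
  have [[C1 C2] _] := @Gg k I.
  have C1' : Ck (k + 0) (fun y => Re (g y)) by rewrite addn0.
  have C2' : Ck (k + 0) (fun y => Im (g y)) by rewrite addn0.
  by split; [exact: (Ck_iter i C1')|exact: (Ck_iter i C2')].
move=> B B0; exists (2 * (fine (Gnorm k psis g) * expR (phi (2 * (n%:R * (B + 1)))))).
split; first by rewrite !mulr_ge0 ?Gnorm_ge0 ?expR_ge0.
move=> x; apply: le_trans (gd_norm1 i x n0 (leqnn k) B0).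
by rewrite ler_wpM2l ?modC_ge0// ler_expR ler_wpM2r ?norm1_ge0// lerDl.
Qed.
End weight.
End gdecay.

(** * Integration by parts in the inverse transform *)

Section by_parts.
Context (R : realType) (n : nat).
Local Notation C := (Cx R).
Local Notation Re := (@ReC R).
Local Notation Im := (@ImC R).
Local Notation rV := 'rV[R]_n.
Local Notation cV := 'rV[C]_n.

Lemma is_derive_upd (u : rV -> R) (x : rV) i (s : R) :
  derivable u (upd x i s) (delta_mx 0 i) ->
  is_derive s 1 (fun t => u (upd x i t)) (partial i u (upd x i s)).
Proof.
move=> du.
have e : (fun h : R => h^-1 *: (((fun t => u (upd x i t)) \o shift s) (h *: 1) - u (upd x i s))) =
   (fun h : R => h^-1 *: ((u \o shift (upd x i s)) (h *: delta_mx 0 i) - u (upd x i s))).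
  apply/funext => h /=; congr (_ *: (u _ - _)); apply/rowP => j.
  rewrite !mxE eqxx /= -[h *: 1]/(h * 1) mulr1.
  by case: (j == i); rewrite ?mulr1 ?mulr0 ?add0r.
by apply: DeriveDef; [rewrite /derivable e|rewrite /partial /derive e].
Qed.

Lemma cdot_upd (x : rV) (z : cV) i s : cdot (upd x i s) z = cdot (upd x i 0) z + ofR s * z 0 i.
Proof.
rewrite /cdot (bigD1 i)//= [in RHS](bigD1 i)//= !mxE eqxx.
rewrite -[ofR 0]/(0 : C) mul0r add0r addrC; congr (_ + _).
by apply: eq_bigr => j ji; rewrite !mxE (negPf ji).
Qed.

Lemma is_derive_cexp_line (a b : C) (s : R) :
  is_derive s 1 (fun t : R => Re (cexp (a + ofR t * b))) (Re (b * cexp (a + ofR s * b))) /\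
  is_derive s 1 (fun t : R => Im (cexp (a + ofR t * b))) (Im (b * cexp (a + ofR s * b))).
Proof.
have eR t : Re (a + ofR t * b) = Re a + t * Re b by rewrite !CE mul0r subr0.
have eI t : Im (a + ofR t * b) = Im a + t * Im b by rewrite !CE mul0r addr0.
split.
  have -> : (fun t : R => Re (cexp (a + ofR t * b))) =
     (fun t => expR (Re a + t * Re b) * cos (Im a + t * Im b)).
    by apply/funext => t; rewrite /cexp ReCE eR eI.
  apply: is_derive_eq; rewrite /GRing.scale /= ReCM /cexp ReCE ImCE eR eI; ring.
have -> : (fun t : R => Im (cexp (a + ofR t * b))) =
   (fun t => expR (Re a + t * Re b) * sin (Im a + t * Im b)).
  by apply/funext => t; rewrite /cexp ImCE eR eI.
apply: is_derive_eq; rewrite /GRing.scale /= ImCM /cexp ReCE ImCE eR eI; ring.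
Qed.

Lemma invF_partial (g g' : rV -> C) i (z : cV) :
  (forall x, derivable (fun y => Re (g y)) x (delta_mx 0 i)) ->
  (forall x, derivable (fun y => Im (g y)) x (delta_mx 0 i)) ->
  (forall x, g' x = mkC (partial i (fun y => Re (g y)) x) (partial i (fun y => Im (g y)) x)) ->
  expdec g -> expdec g' -> invF g' z = - (iC * z 0 i) * invF g z.
Proof.
move=> d1 d2 g'E eg eg'.
have tg := invF_ctame z eg; have tg' := invF_ctame z eg'.
pose b := iC * z 0 i.
pose E x := cexp (iC * cdot x z).
have tG : ctame (fun x => b * (g x * E x) + g' x * E x) by exact: ctame_lin.
(* The integrand is the i-th partial derivative of g(x) e^{i<x,z>}, which integrates to 0 on every
   line parallel to e_i. *)
have : cintegral (fun x => b * (g x * E x) + g' x * E x) = cintegral (fun _ : rV => 0).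
  refine (@cintegral_coord R n _ _ i tG (ctame0 R n) _) => x.
  pose a := iC * cdot (upd x i 0) z.
  have EE s : E (upd x i s) = cexp (a + ofR s * b).
    by rewrite /E cdot_upd; congr cexp; rewrite /a /b; ring.
  have [K [K0 hK]] := ctame_bound tg.
  have bnd s : modC (g (upd x i s) * E (upd x i s)) <= K * (1 + s ^+ 2)^-1.
    by apply: le_trans (hK _) _; rewrite ler_wpM2l// weight_upd.
  have [L [L0 hL]] := ctame_bound tG.
  have bndL s : modC (b * (g (upd x i s) * E (upd x i s)) + g' (upd x i s) * E (upd x i s))
      <= L * (1 + s ^+ 2)^-1.
    by apply: le_trans (hL _) _; rewrite ler_wpM2l// weight_upd.
  have cu : continuous (fun s => upd x i s).
    apply: cont_row => j; under eq_fun do rewrite mxE.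
    by case: (j == i); [move=> s; exact: cvg_id|exact: cont_cst].
  have [c1 c2] := ccont_comp (ctame_cont tG) cu.
  have z1 : rint1 (fun=> 0) = 0 :> R by rewrite /rint1 /Rintegral integral0_eq.
  have dE s := is_derive_cexp_line a b s.
  rewrite /cint1; congr mkC.
    rewrite z1; apply: (@rint1_deriv0 R (fun s => Re (g (upd x i s) * E (upd x i s))) _ K).
    - split=> //; exists L => s; exact: le_trans (Re_le _) (bndL s).
    - move=> s; have [e1 e2] := dE s.
      have h1 := is_derive_upd (d1 (upd x i s)); have h2 := is_derive_upd (d2 (upd x i s)).
      have -> : (fun s => Re (g (upd x i s) * E (upd x i s))) = (fun s =>
         Re (g (upd x i s)) * Re (cexp (a + ofR s * b)) -
         Im (g (upd x i s)) * Im (cexp (a + ofR s * b))).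
        by apply/funext => t; rewrite EE ReCM.
      apply: is_derive_eq; rewrite /GRing.scale /= g'E EE -?[expR _ * cos _]/(Re (cexp (a + ofR s * b)))
        -?[expR _ * sin _]/(Im (cexp (a + ofR s * b))).
      move: (cexp (a + ofR s * b)) (partial i _ _) (partial i _ _) (g _) => e p q h; move: (b) => b'; rewrite !CE.
      ring.
    - by move=> s; exact: le_trans (Re_le _) (bnd s).
  rewrite z1; apply: (@rint1_deriv0 R (fun s => Im (g (upd x i s) * E (upd x i s))) _ K).
  - split=> //; exists L => s; exact: le_trans (Im_le _) (bndL s).
  - move=> s; have [e1 e2] := dE s.
    have h1 := is_derive_upd (d1 (upd x i s)); have h2 := is_derive_upd (d2 (upd x i s)).
    have -> : (fun s => Im (g (upd x i s) * E (upd x i s))) = (fun s =>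
       Re (g (upd x i s)) * Im (cexp (a + ofR s * b)) +
       Im (g (upd x i s)) * Re (cexp (a + ofR s * b))).
      by apply/funext => t; rewrite EE ImCM.
    apply: is_derive_eq; rewrite /GRing.scale /= g'E EE -?[expR _ * cos _]/(Re (cexp (a + ofR s * b)))
        -?[expR _ * sin _]/(Im (cexp (a + ofR s * b))).
    move: (cexp (a + ofR s * b)) (partial i _ _) (partial i _ _) (g _) => e p q h; move: (b) => b'; rewrite !CE.
      ring.
  - by move=> s; exact: le_trans (Im_le _) (bnd s).
rewrite cintegral0 (cintegral_lin b tg tg') -/(invF g z) -/(invF g' z) => /eqP.
by rewrite addrC addr_eq0 => /eqP ->; rewrite /b mulNr.
Qed.
End by_parts.

(** * The backward estimate *)

Section backward.
Context (R : realType) (n : nat).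
Local Notation C := (Cx R).
Local Notation Re := (@ReC R).
Local Notation Im := (@ImC R).
Local Notation rV := 'rV[R]_n.
Local Notation cV := 'rV[C]_n.

Lemma enorm_ge0 (x : rV) : 0 <= enorm x. Proof. exact: sqrtr_ge0. Qed.

Lemma enorm_ge (x : rV) j : `|x 0 j| <= enorm x.
Proof. by rewrite -sqrtr_sqr ler_wsqrtr// (bigD1 j)//= lerDl sumr_ge0// => l _; exact: sqr_ge0. Qed.

(** For the largest |z_i| one has 1 + ||z|| <= 2n max(1, |z_i|), and the k-th power of the maximum
    is at most the sum. Thus derivatives of order 0 and k in one direction give decay of order k. *)
Lemma one_plus_cnorm_pow (z : cV) k : (0 < n)%N -> exists i : 'I_n,
  (1 + cnorm z) ^+ k <= (2 * n%:R) ^+ k * (1 + modC (z 0 i) ^+ k).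
Proof.
move=> n0; pose i0 : 'I_n := Ordinal n0.
have [i _ hi] := @Order.TotalTheory.arg_maxP _ _ _ i0 xpredT (fun j => modC (z 0 j)) isT.
exists i; set X := modC _; have X0 : 0 <= X := modC_ge0 _.
have n1 : 1 <= n%:R :> R by rewrite ler1n.
have cX : cnorm z <= n%:R * X.
  rewrite -[leRHS]ger0_norm ?mulr_ge0// -sqrtr_sqr ler_wsqrtr//.
  apply: (@le_trans _ _ (\sum_(j < n) X ^+ 2)).
    apply: ler_sum => j _; rewrite lerXn2r// ?nnegrE ?modC_ge0//; exact: hi.
  rewrite sumr_const card_ord -[leLHS]mulr_natl exprMn ler_wpM2r ?sqr_ge0//.
  by rewrite expr2 ler_peMl.
have h : 1 + cnorm z <= 2 * n%:R * Num.max 1 X.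
  have m1 : 1 <= Num.max 1 X by rewrite le_max lexx.
  have m2 : X <= Num.max 1 X by rewrite le_max lexx orbT.
  have m3 : n%:R * X <= n%:R * Num.max 1 X by rewrite ler_wpM2l.
  have m4 : 1 <= n%:R * Num.max 1 X by rewrite mulr_ege1.
  have -> : 2 * n%:R * Num.max 1 X = n%:R * Num.max 1 X + n%:R * Num.max 1 X by ring.
  by rewrite lerD// (le_trans cX).
have m0 : 0 <= Num.max 1 X by rewrite le_max ler01.
apply: (@le_trans _ _ ((2 * n%:R * Num.max 1 X) ^+ k)).
  by rewrite lerXn2r// nnegrE ?(ltW (cnorm1_gt0 _)) ?mulr_ge0.
rewrite exprMn ler_wpM2l ?exprn_ge0 ?mulr_ge0//.
have [x1|x1] := leP X 1; first by rewrite expr1n lerDl exprn_ge0.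
by rewrite lerDr.
Qed.

Variables phi phi' : R -> R.
Hypothesis n0 : (0 < n)%N.
Hypothesis phi_nd : forall x y, 0 <= x -> x <= y -> phi x <= phi y.
Hypothesis phi_ub : forall x, 0 <= x ->
  has_ubound [set x * y - psi phi y | y in [set y | 0 <= y]].
Variable c : R.
Hypothesis phi_dil : forall r, 0 <= r -> phi (2 * (n%:R * (r + 1))) <= phi' r + c.
Local Notation psis := (young (psi phi)).
Variable g : rV -> C.
Hypothesis Gg : G_step psis g.

Lemma gd0 i : gd i 0 g = g.
Proof. by apply/funext => x; rewrite /gd /= -mkC_eta. Qed.

Lemma G_step_expdec : expdec g.
Proof. by rewrite -(gd0 (Ordinal n0)); exact: (gd_expdec phi_ub Gg). Qed.

Lemma invF_gd i k z : invF (gd i k g) z = (- (iC * z 0 i)) ^+ k * invF g z.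
Proof.
elim: k => [|k IH]; first by rewrite gd0 mul1r.
rewrite exprS -mulrA -IH.
have [[C1 C2] _] := @Gg k.+1 I.
have C1' : Ck (k + 1) (fun y => Re (g y)) by rewrite addn1.
have C2' : Ck (k + 1) (fun y => Im (g y)) by rewrite addn1.
have [_ /(_ i)[d1 _]] := Ck_iter i C1'.
have [_ /(_ i)[d2 _]] := Ck_iter i C2'.
apply: (invF_partial (i := i)) => //; exact: (gd_expdec phi_ub Gg).
Qed.

(** (2n)^k and the outer 2 come from splitting (1 + ||z||)^k into two terms; 2, 2^n and pi^n from
    [invF_bound]; the innermost 2 from the geometric series; [expR c] from the dilation of the
    weight. *)
Definition invF_cst (k : nat) : R :=
  (2 * n%:R) ^+ k * (2 * (2 * (2 * expR c * 2 ^+ n) * pi ^+ n)).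

Lemma invF_cst_ge0 k : 0 <= invF_cst k.
Proof. by rewrite /invF_cst !mulr_ge0 ?exprn_ge0 ?mulr_ge0 ?expR_ge0 ?pi_ge0. Qed.

Lemma invF_decay k z : modC (invF g z) * (1 + cnorm z) ^+ k <=
  invF_cst k * fine (Gnorm k psis g) * expR (phi' (enorm (imvec z))).
Proof.
set G := fine _; have G0 : 0 <= G := Gnorm_ge0 Gg k.
set r := enorm _; have r0 : 0 <= r := enorm_ge0 _.
have hr j : `|Im (z 0 j)| <= r by have := enorm_ge (imvec z) j; rewrite mxE.
pose Q := 2 * (2 * expR c * 2 ^+ n) * pi ^+ n * (G * expR (phi' r)).
have hQ i l : (l <= k)%N -> modC (invF (gd i l g) z) <= Q.
  move=> lk; have [cg _] := gd_expdec phi_ub Gg i l n0.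
  have K0 : 0 <= 2 * (G * expR (phi (2 * (n%:R * (r + 1))))) by rewrite !mulr_ge0 ?expR_ge0.
  have [_] := invF_bound cg K0 hr (fun x => gd_norm1 phi_ub Gg i x n0 lk r0).
  move=> /le_trans; apply.
  have h : expR (phi (2 * (n%:R * (r + 1)))) <= expR c * expR (phi' r).
    by rewrite -expRD ler_expR [leRHS]addrC phi_dil.
  apply: (@le_trans _ _ (2 * (2 * (G * (expR c * expR (phi' r))) * 2 ^+ n) * pi ^+ n)).
    rewrite ler_wpM2r ?exprn_ge0 ?pi_ge0// ler_wpM2l// ler_wpM2r ?exprn_ge0//.
    by rewrite ler_wpM2l// ler_wpM2l.
  rewrite le_eqVlt; apply/orP; left; apply/eqP; rewrite /Q; ring.
have [i hi] := one_plus_cnorm_pow z k n0.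
have h1 := hQ i 0%N (leq0n _); have h2 := hQ i k (leqnn k).
rewrite gd0 in h1; rewrite invF_gd modCM modCX modCN modCM modC_i mul1r in h2.
apply: (@le_trans _ _ (modC (invF g z) * ((2 * n%:R) ^+ k * (1 + modC (z 0 i) ^+ k)))).
  by rewrite ler_wpM2l ?modC_ge0.
have -> : invF_cst k * G * expR (phi' r) = (2 * n%:R) ^+ k * (Q + Q).
  rewrite /invF_cst /Q; ring.
rewrite mulrCA ler_wpM2l ?exprn_ge0 ?mulr_ge0//.
by rewrite mulrDr mulr1 lerD// mulrC.
Qed.

Lemma invF_Enorm k : (Enorm phi' k (invF g) <= (invF_cst k)%:E * Gnorm k psis g)%E.
Proof.
rewrite -(fineK (Gnorm_fin k Gg)) -EFinM; apply: ge_ereal_sup => _ [z _ <-].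
by rewrite lee_fin ler_pdivrMr ?expR_gt0// invF_decay.
Qed.

Lemma invF_E_step : E_step phi' (invF g).
Proof.
move=> k _; split; first by move=> z; apply: invF_differentiable; exact: G_step_expdec.
apply: le_lt_trans (invF_Enorm k) _.
by rewrite -(fineK (Gnorm_fin k Gg)) -EFinM ltry.
Qed.
End backward.

(** For r >= 1 the argument is at most 4n r <= 2^{4n} r, and the dilation property is iterated 4n
    times. For r < 1 the left side is bounded by a constant and the right side is at least its value
    at 0. *)
Lemma weight_family_dilate (R : realType) (phi : nat -> R -> R) (n nu : nat) :
  weight_family phi -> exists j c, forall r, 0 <= r ->
    phi nu (2 * (n%:R * (r + 1))) <= phi (nu + j)%N r + c.
Proof.
move=> hphi.
have it j : exists c, forall r, 0 <= r -> phi nu (2 ^+ j * r) <= phi (nu + j)%N r + c.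
  elim: j => [|j [c hc]]; first by exists 0 => r r0; rewrite addn0 addr0 expr0 mul1r.
  have [a _ ha] := wf_dilation hphi (nu + j)%N; exists (a + c) => r r0.
  rewrite exprSr -mulrA; apply: le_trans (hc _ _) _; first by rewrite mulr_ge0.
  by rewrite addnS addrA lerD2r ha.
(* The absolute values are there because the weights may be negative; the last two terms settle r <
   1. *)
have [c hc] := it (4 * n)%N; exists (4 * n)%N, (`|c| + `|phi nu (2 ^+ (4 * n))| +
  `|phi (nu + 4 * n)%N 0|).
have e4 : 4 * n%:R <= 2 ^+ (4 * n) :> R by rewrite -natrX -natrM ler_nat ltnW// ltn_expl.
have nd := wf_nondecreasing hphi.
have n0 : 0 <= n%:R :> R by [].
move=> r r0; have [r1|r1] := leP 1 r.
  apply: (@le_trans _ _ (phi nu (2 ^+ (4 * n) * r))).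
    apply: nd; first by rewrite !mulr_ge0// addr_ge0.
    apply: (@le_trans _ _ (4 * n%:R * r)); last by rewrite ler_wpM2r.
    have : n%:R * (r + 1) <= n%:R * (2 * r) by rewrite ler_wpM2l//; lra.
    lra.
  apply: le_trans (hc r r0) _; rewrite lerD2l -addrA.
  by apply: le_trans (ler_norm c) _; rewrite lerDl addr_ge0.
apply: (@le_trans _ _ (phi nu (2 ^+ (4 * n)))).
  apply: nd; first by rewrite !mulr_ge0// addr_ge0.
  apply: le_trans e4.
  have : n%:R * (r + 1) <= n%:R * 2 by rewrite ler_wpM2l//; lra.
  lra.
have h0 : phi (nu + 4 * n)%N 0 <= phi (nu + 4 * n)%N r by exact: nd.
have := ler_norm (phi nu (2 ^+ (4 * n))); have := ler_norm (- phi (nu + 4 * n)%N 0).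
rewrite normrN; have := normr_ge0 c; lra.
Qed.

(** * The two transforms are mutually inverse up to (2 pi)^n *)

Section inversion.
Context (R : realType) (n : nat).
Local Notation C := (Cx R).
Local Notation Re := (@ReC R).
Local Notation Im := (@ImC R).
Local Notation rV := 'rV[R]_n.
Local Notation cV := 'rV[C]_n.

Lemma cexp_rot (a t : R) (w : C) : Re w = a -> Im w = t -> cexp w = ofR (expR a) * rot t.
Proof. by move=> <- <-; apply: eqCx; rewrite /cexp /rot /ofR !CE; ring. Qed.

Lemma cdot_cpt (x u v : rV) : cdot x (cpt u v) = mkC (rdot x u) (rdot x v).
Proof.
apply: eqCx; rewrite ?Re_cdot ?Im_cdot ?ReCE ?ImCE; apply: eq_bigr => j _; by rewrite mxE.
Qed.

Lemma kerf_cpt (x u v : rV) :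
  kerf x (cpt u v) = ofR (expR (rdot x v)) * rot (- rdot x u).
Proof. by apply: cexp_rot; rewrite cdot_cpt !CE; ring. Qed.

Lemma cexp_cdot_cpt (x u v : rV) :
  cexp (iC * cdot x (cpt u v)) = ofR (expR (- rdot x v)) * rot (rdot x u).
Proof. by apply: cexp_rot; rewrite cdot_cpt !CE; ring. Qed.

Lemma expdec_ctame1 (g : rV -> C) v : expdec g ->
  ctame (fun x => ofR (expR (- rdot x v)) * g x).
Proof.
move=> eg; have t := invF_ctame (cpt (0 : rV) v) eg.
have -> // : (fun x => ofR (expR (- rdot x v)) * g x) =
  (fun x => g x * cexp (iC * cdot x (cpt 0 v))).
apply/funext => x; rewrite cexp_cdot_cpt.
have -> : rdot x 0 = 0 by rewrite /rdot big1// => j _; rewrite mxE mulr0.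
rewrite /rot cos0 sin0; have -> : mkC 1 0 = 1 :> C by [].
by rewrite mulr1 mulrC.
Qed.

(** At z = xi + iv inversion is applied to u(t) = f(t + iv). By the contour shift its transform is
    e^{-<x,v>} times that of f, and this factor is precisely the modulus of e^{i<x,z>}. *)
Lemma invF_fourier (f : cV -> C) : rapid f -> expdec (fun x => fourier f x) ->
  forall z, invF (fun x => fourier f x) z = ofR ((2 * pi) ^+ n) * f z.
Proof.
move=> rf ef z; rewrite [z]cpt_eta; move: (map_mx _ _) (map_mx _ _) => v xi.
pose u t := f (cpt t v).
have tu : ctame u := tube_ctame v (rapid_tube rf).
have ftE : ft u = (fun x => ofR (expR (- rdot x v)) * fourier f x).
  apply/funext => x; rewrite (fourier_shift x v rf).
  have -> : cintegral (fun t => f (cpt t v) * kerf x (cpt t v)) =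
     cintegral (fun t => ofR (expR (rdot x v)) * (u t * rot (- rdot x t))).
    by apply: eq_cintegral => t; rewrite kerf_cpt mulrCA.
  rewrite cintegralZ; last exact: ft_ctame.
  rewrite mulrA -ofRM -expRD addNr expR0.
  by have -> : ofR 1 = 1 :> C by []; rewrite mul1r.
have tft : ctame (ft u) by rewrite ftE; exact: expdec_ctame1.
rewrite -[f _]/(u xi) -(fourier_inversion tu tft xi) ftE.
by apply: eq_cintegral => x; rewrite cexp_cdot_cpt mulrCA mulrA.
Qed.

Definition conjC (z : C) : C := mkC (Re z) (- Im z).

Lemma conjCM (z w : C) : conjC (z * w) = conjC z * conjC w.
Proof. by apply: eqCx; rewrite /conjC !CE; ring. Qed.

Lemma conjCK : involutive conjC.
Proof. by move=> [a b]; rewrite /conjC /mkC /ReC /ImC /= opprK. Qed.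

Lemma conjC_rot t : conjC (rot t) = rot (- t).
Proof. by rewrite /conjC /rot ReCE ImCE cosN sinN. Qed.

Lemma conjC_ofR (a : R) : conjC (ofR a) = ofR a.
Proof. by rewrite /conjC /ofR ReCE ImCE oppr0. Qed.

Lemma modC_conjC z : modC (conjC z) = modC z.
Proof. by rewrite /modC /conjC ReCE ImCE sqrrN. Qed.

Lemma ccont_conjC (F : rV -> C) : ccont F -> ccont (fun x => conjC (F x)).
Proof. by move=> [c1 c2]; split=> //; exact: contN. Qed.

Lemma ctame_conjC (F : rV -> C) : ctame F -> ctame (fun x => conjC (F x)).
Proof.
move=> tF; have [K [K0 hK]] := ctame_bound tF; apply: (@ctameP _ _ _ K).
  exact: ccont_conjC (ctame_cont tF).
by move=> x; rewrite modC_conjC.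
Qed.

Lemma cintegral_conjC (F : rV -> C) : ctame F ->
  cintegral (fun x => conjC (F x)) = conjC (cintegral F).
Proof.
move=> [t1 t2]; rewrite [LHS]cintegralE [in RHS]cintegralE /conjC ReCE ImCE; congr mkC.
have -> : (fun x => Im (mkC (Re (F x)) (- Im (F x)))) = (fun x => (-1) * Im (F x)).
  by apply/funext => x; rewrite mulN1r.
by rewrite rintZ// mulN1r.
Qed.

(** At real points conjugation exchanges the kernels of the two transforms, so this order of
    composition follows from the same inversion theorem applied to the conjugate of g. *)
Lemma fourier_invF (g : rV -> C) : expdec g -> rapid (invF g) ->
  forall x, fourier (invF g) x = ofR ((2 * pi) ^+ n) * g x.
Proof.
move=> eg rg x; pose u t := conjC (g t).
have tg : ctame g.
  have := expdec_ctame1 0 eg; congr ctame; apply/funext => y.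
  have -> : rdot y 0 = 0 by rewrite /rdot big1// => j _; rewrite mxE mulr0.
  by rewrite oppr0 expR0; have -> : ofR 1 = 1 :> C by []; rewrite mul1r.
have tu : ctame u := ctame_conjC tg.
have ftE : ft u = (fun t => conjC (invF g (cpt t 0))).
  apply/funext => t; rewrite /invF -cintegral_conjC; last exact: invF_ctame.
  apply: eq_cintegral => y; rewrite cexp_cdot_cpt !conjCM conjC_rot conjC_ofR /u.
  have -> : rdot y 0 = 0 by rewrite /rdot big1// => j _; rewrite mxE mulr0.
  rewrite oppr0 expR0; have -> : ofR 1 = 1 :> C by []; rewrite mul1r.
  by congr (_ * rot (- _)); apply: eq_bigr => j _; rewrite mulrC.
have tI : ctame (fun t => invF g (cpt t 0)) := tube_ctame 0 (rapid_tube rg).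
have tft : ctame (ft u) by rewrite ftE; exact: ctame_conjC.
rewrite -[LHS]conjCK -[g x]conjCK -[conjC (g x)]/(u x) -[ofR _]conjC_ofR -conjCM.
rewrite -(fourier_inversion tu tft x) fourierE -cintegral_conjC; last first.
  have := tube_ctame 0 (rapid_tube (rapid_ker x rg)); exact.
congr conjC; apply: eq_cintegral => t; rewrite conjCM ftE kerf_cpt conjCM conjC_ofR conjC_rot.
have -> : rdot x 0 = 0 by rewrite /rdot big1// => j _; rewrite mxE mulr0.
rewrite expR0 opprK; have -> : ofR 1 = 1 :> C by []; rewrite mul1r.
by congr (_ * rot _); apply: eq_bigr => j _; rewrite mulrC.
Qed.
End inversion.

(** * Maps between inductive limits *)

Section indlim_maps.
Context (R : realType).

Definition step_bounded (V W : lmodType (Cx R)) (S : lc_spectrum V) (S' : lc_spectrum W)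
    (T : V -> W) :=
  forall nu, exists nu', (forall v, step S nu v -> step S' nu' (T v)) /\
    forall k, exists l (c : R), 0 <= c /\
      forall v, step S nu v -> (snorm S' nu' k (T v) <= c%:E * snorm S nu l v)%E.

(** The preimage of a basic neighbourhood is again basic: absolute convexity passes through a linear
    map, and the trace condition is checked one step at a time with the seminorm estimates. *)
Lemma step_bounded_continuous (V W : lmodType (Cx R)) (S : lc_spectrum V)
    (S' : lc_spectrum W) (T : V -> W) (F : indlim S -> indlim S') :
  step_bounded S S' T -> (forall x, val (F x) = T (val x)) -> linear F ->
  continuous F.
Proof.
move=> bT FE linF x A [U [cU nU] UA].
have FD y z : F (y + z) = F y + F z by have := linF 1 y z; rewrite !scale1r.
have FZ a y : F (a *: y) = a *: F y.
  have F0 : F 0 = 0 by have := linF (-1) 0 0; rewrite scaler0 addr0 scaleN1r addNr.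
  by have := linF a y 0; rewrite !addr0 F0 addr0.
exists [set y | U (F y)]; last by move=> u Uu; rewrite /= FD; exact: UA.
split=> [a b y z ab Uy Uz /=|nu]; first by rewrite FD !FZ; exact: cU.
have [nu' [st bd]] := bT nu; have [m [e [e0 h]]] := nU nu'.
have [l hl] := choice bd; have [c hc] := choice hl.
(* The sum dominates all the constants involved, and s + 1 is positive even when they vanish.
   Likewise the maximum of the [l k] bounds all the seminorm indices required. *)
pose s := \sum_(k < m.+1) c k.
have cs k : (k <= m)%N -> c k <= s.
  move=> km; rewrite /s (bigD1 (Ordinal (km : (k < m.+1)%N)))//= lerDl.
  by apply: sumr_ge0 => j _; have [] := hc j.
have s1 : 0 < s + 1 by rewrite ltr_wpDl// sumr_ge0// => j _; have [] := hc j.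
exists (\max_(k < m.+1) l k), (e / (s + 1)); split; first by rewrite divr_gt0.
move=> y sy hy /=; apply: h; first by rewrite FE; exact: st.
move=> k km; rewrite FE; have [c0 hck] := hc k.
apply: le_lt_trans (hck _ sy) _.
have := hy (l k); rewrite (leq_bigmax (Ordinal (km : (k < m.+1)%N))) => /(_ isT).
rewrite -(fineK (snorm_fin (l k) sy)) -EFinM !lte_fin => hlt.
apply: (@le_lt_trans _ _ (c k * (e / (s + 1)))); first by rewrite ler_wpM2l// ltW.
rewrite mulrCA gtr_pMr// ltr_pdivrMr// mul1r.
by apply: le_lt_trans (cs k km) _; rewrite ltrDl.
Qed.

(** Linearity of [T] is asked only within a step, where the integrals behave; two vectors are first
    moved into a common step. Linearity of the inverse follows from injectivity. *)
Lemma indlim_isomorphism (V W : lmodType (Cx R)) (S : lc_spectrum V)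
    (S' : lc_spectrum W) (T : V -> W) (T' : W -> V) :
  step_bounded S S' T -> step_bounded S' S T' ->
  (forall nu a u v, step S nu u -> step S nu v -> T (a *: u + v) = a *: T u + T v) ->
  (forall nu v, step S nu v -> T' (T v) = v) ->
  (forall nu w, step S' nu w -> T (T' w) = w) ->
  exists F : indlim S -> indlim S',
    (forall x, val (F x) = T (val x)) /\ tvs_isomorphism F.
Proof.
move=> bT bT' linT TK T'K.
have mT v : v \in indlim_mem S -> T v \in indlim_mem S'.
  move=> /asboolP[nu hv]; have [nu' [st _]] := bT nu.
  by apply/asboolP; exists nu'; exact: st.
have mT' w : w \in indlim_mem S' -> T' w \in indlim_mem S.
  move=> /asboolP[nu hv]; have [nu' [st _]] := bT' nu.
  by apply/asboolP; exists nu'; exact: st.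
pose F (x : indlim S) : indlim S' := exist _ (T (val x)) (mT _ (valP x)).
pose F' (y : indlim S') : indlim S := exist _ (T' (val y)) (mT' _ (valP y)).
have FE x : val (F x) = T (val x) by [].
have FE' y : val (F' y) = T' (val y) by [].
have FK : cancel F F'.
  move=> x; apply: val_inj; rewrite FE' FE.
  by have /asboolP[nu hx] := valP x; exact: TK hx.
have FK' : cancel F' F.
  move=> y; apply: val_inj; rewrite FE FE'.
  by have /asboolP[nu hy] := valP y; exact: T'K hy.
have linF : linear F.
  move=> a x y; apply: val_inj; rewrite linearP !FE linearP.
  have /asboolP[nu hx] := valP x; have /asboolP[mu hy] := valP y.
  apply: (linT (maxn nu mu)).
    exact: step_le (leq_maxl _ _) _ hx.
  exact: step_le (leq_maxr _ _) _ hy.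
have linF' : linear F'.
  by move=> a x y; apply: (can_inj FK); rewrite FK' linF !FK'.
exists F; split=> //; split=> //; split; first exact: step_bounded_continuous bT FE linF.
by exists F'; split=> //; exact: step_bounded_continuous bT' FE' linF'.
Qed.
End indlim_maps.

(** * Normalization and assembly of the isomorphism *)

Section transform.
Context (R : realType) (n : nat).
Local Notation C := (Cx R).
Local Notation rV := 'rV[R]_n.
Local Notation cV := 'rV[C]_n.

Lemma rapid_fourier_ctame (f : cV -> C) (x : rV) : rapid f ->
  ctame (fun u => f (cpt u 0) * kerf x (cpt u 0)).
Proof. by move=> rf; exact: (tube_ctame 0 (rapid_tube (rapid_ker x rf))). Qed.

Lemma fourier_linear (a : C) (f g : cV -> C) : rapid f -> rapid g ->
  (fun x : rV => fourier (a *: f + g) x) = a *: (fun x : rV => fourier f x) + (fun x => fourier g x).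
Proof.
move=> rf rg; apply/funext => x.
rewrite -[RHS]/(a * fourier f x + fourier g x) !fourierE.
rewrite -cintegral_lin; [|exact: rapid_fourier_ctame..].
by apply: eq_cintegral => u; rewrite -[(_ + _) _]/(a * _ + _) mulrDl mulrA.
Qed.

Definition inv_fourier (g : rV -> C) : cV -> C := ofR ((2 * pi) ^- n) *: invF g.

Lemma cst2pi : ofR ((2 * pi) ^- n) * ofR ((2 * pi) ^+ n) = 1 :> C.
Proof.
by rewrite -ofRM mulVf// lt0r_neq0// exprn_gt0// mulr_gt0// pi_gt0.
Qed.
End transform.

Theorem theorem3 (R : realType) (n : nat) (n_gt0 : (0 < n)%N)
    (phi : nat -> R -> R) (hphi : weight_family phi) :
  exists F : E_lim n hphi -> G_lim n hphi,
    (forall (f : E_lim n hphi) (x : 'rV[R]_n), val (F f) x = fourier (val f) x) /\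
    tvs_isomorphism F.
Proof.
have nd nu : forall x y, 0 <= x -> x <= y -> phi nu x <= phi nu y := @wf_nondecreasing _ _ hphi nu.
have ub nu := @young_psi_ub _ _ hphi nu.
pose T (f : 'rV[Cx R]_n -> Cx R) := fun x : 'rV[R]_n => fourier f x.
have rE nu (f : 'rV[Cx R]_n -> Cx R) : E_step (phi nu) f -> rapid f := @E_step_rapid R n _ (nd nu) f.
(* The target step depends on nu alone and not on the seminorm, as continuity into the inductive
   limit requires. *)
have inv_step nu : exists nu' c, forall g, G_step (psi_star phi nu) g ->
    E_step (phi nu') (@inv_fourier R n g) /\ forall k,
    (Enorm (phi nu') k (inv_fourier g) <=
      ((2 * pi) ^- n * invF_cst n c k)%:E * Gnorm k (psi_star phi nu) g)%E.
  have [j [c hc]] := weight_family_dilate n nu hphi; exists (nu + j)%N, c => g Gg.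
  split=> [|k].
    have := E_step_lin (ofR ((2 * pi) ^- n)) (invF_E_step n_gt0 (ub nu) hc Gg) (E_step0 n (phi (nu + j)%N)).
    by rewrite addr0.
  rewrite /inv_fourier EnormZ modC_ofR ger0_norm ?invr_ge0 ?exprn_ge0 ?mulr_ge0 ?pi_ge0//.
  rewrite EFinM -muleA lee_wpmul2l ?lee_fin ?invr_ge0 ?exprn_ge0 ?mulr_ge0 ?pi_ge0//.
  exact: (invF_Enorm n_gt0 (ub nu) hc Gg).
have eG nu g : G_step (psi_star phi nu) g -> @expdec R n g :=
  @G_step_expdec R n _ n_gt0 (ub nu) g.
have eT nu f : E_step (phi nu) f -> expdec (T f).
  by move=> Ef; apply: (eG nu); exact: fourier_G_step n_gt0 (nd nu) Ef.
have [F [FE isoF]] : exists F : E_lim n hphi -> G_lim n hphi,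
    (forall f, val (F f) = T (val f)) /\ tvs_isomorphism F.
  apply: (indlim_isomorphism (T' := @inv_fourier R n)).
  - move=> nu; exists nu; split; first by move=> f Ef; exact: fourier_G_step n_gt0 (nd nu) Ef.
    move=> m; exists (m + 2 * n)%N, (2 * pi ^+ n); split.
      by rewrite mulr_ge0 ?exprn_ge0 ?pi_ge0.
    by move=> f Ef; exact: fourier_Gnorm n_gt0 (nd nu) Ef.
  - move=> nu; have [nu' [c hc]] := inv_step nu; exists nu'; split.
      by move=> g /hc[].
    move=> k; exists k, ((2 * pi) ^- n * invF_cst n c k); split.
      by rewrite mulr_ge0 ?invF_cst_ge0// invr_ge0 exprn_ge0// mulr_ge0// pi_ge0.
    by move=> g /hc[_]; exact.
  - move=> nu a f g Ef Eg; exact: (fourier_linear a (rE _ _ Ef) (rE _ _ Eg)).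
  - move=> nu f Ef; apply/funext => z.
    rewrite /inv_fourier -[LHS]/(ofR _ * invF (T f) z) invF_fourier ?mulrA ?cst2pi ?mul1r//.
      exact: rE Ef.
    exact: eT Ef.
  - move=> nu g Gg; apply/funext => x.
    have [nu' [c hc]] := inv_step nu; have [Eg _] := hc g Gg.
    have [j [d hd]] := weight_family_dilate n nu hphi.
    have rg : rapid (invF g) := rE _ _ (invF_E_step n_gt0 (ub nu) hd Gg).
    have E0 : rapid (0 : 'rV[Cx R]_n -> Cx R) := rE nu _ (E_step0 n (phi nu)).
    (* The normalizing constant is pulled out of the transform by linearity, with zero as the second
       function. *)
    have := congr1 (@^~ x) (fourier_linear (ofR ((2 * pi) ^- n)) rg E0).
    rewrite addr0 -/(inv_fourier g) -/(T (inv_fourier g) x) => ->.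
    have F0 : fourier (0 : 'rV[Cx R]_n -> Cx R) x = 0.
      rewrite fourierE (eq_cintegral (G := fun=> 0)) ?cintegral0// => u.
      by rewrite -[(0 : _ -> _) _]/(0 : Cx R) mul0r.
    rewrite -[LHS]/(ofR _ * fourier (invF g) x + fourier (0 : 'rV[Cx R]_n -> Cx R) x) F0 addr0.
    by rewrite fourier_invF ?mulrA ?cst2pi ?mul1r//; exact: eG Gg.
by exists F; split=> // f x; rewrite FE.
Qed.
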